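(* Let $\psi:\mathbb{R}\to\mathbb{R}_+$ be a convex function of the form $\psi(u)=u^{\varkappa}\theta(u)$ for $u>0$, with $\varkappa\in[1,2)$, where $\theta$ is slowly varying at zero and admits, for $u\in(0,1)$, the Karamata representation $$\theta(u)=c(u)\exp\left(\int_u^1\frac{\varepsilon(v)}{v}\,\mathrm{d}v\right),$$ where $c(\cdot)$ is a positive bounded measurable function with a nonzero limit at zero and $\varepsilon(\cdot)$ is a bounded measurable function with zero limit at zero. Assume further that there exists $\alpha\in(0,1)$ such that, for all sufficiently small $v>0$, $$|\varepsilon(v)|<\frac{1}{|\log v|^{\alpha}}.$$ Let $g(\cdot)$ be a slowly varying function at infinity satisfying, for some $\xi_\circ>2-\varkappa>\xi^\circ>0$, $$(\log b)^{-\xi_\circ}\ll g(b)\ll(\log b)^{-\xi^\circ},\quad b\to\infty,$$ and $$\int^{\infty}\frac{g(b)^{1/(2-\varkappa)}}{b}\,\mathrm{d}b=\infty$$ (divergence at infinity). Then, for any $r>0$, almost surely $$\liminf_{T\to\infty}\frac{I_W^{\psi}(T,r)}{T\,\psi(T^{-1/2})\,g(T)}=0.$$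
   Context: $W(\cdot)$ is a standard Wiener process on $[0,\infty)$ with $W(0)=0$. $AC[0,T]$ is the space of absolutely continuous functions on $[0,T]$. $\mathbb{R}_+=[0,\infty)$. For convex $\psi:\mathbb{R}\to\mathbb{R}_+$ and $h\in AC[0,T]$, $|h|_T^{\psi}:=\int_0^T\psi(h'(t))\,\mathrm{d}t$. For $T,r>0$, $I_W^{\psi}(T,r):=\inf\{|h|_T^{\psi}: h\in AC[0,T],\ h(0)=r,\ h(t)\ge W(t)\ \text{for all } t\in[0,T]\}$ (a random variable; equivalently one may require $h(0)=0$ and $h\ge W-r$). The notation $f\ll g$ means $f=O(g)$ in the indicated limit. Slowly varying functions are positive and measurable. *)

(* Defs.v *)
From HB Require Import structures.
From mathcomp Require Import all_boot all_order all_algebra.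
From mathcomp Require Import all_classical all_reals all_analysis.
From mathcomp Require Import measurable_realfun.

Set Implicit Arguments.
Unset Strict Implicit.
Unset Printing Implicit Defensive.

Import Order.TTheory GRing.Theory Num.Theory.
Import numFieldNormedType.Exports.

Local Open Scope classical_set_scope.
Local Open Scope ring_scope.

(* Taking some of the [A i] to be [setT] gives the product rule for every
   subfamily. *)
Definition mutually_independent (d : measure_display) (Om : measurableType d)
    (R : realType) (P : probability Om R) (I : finType)
    (X : I -> {RV P >-> R}) : Prop :=
  forall A : I -> set R, (forall i, measurable (A i)) ->
    P (\bigcap_(i in [set: I]) (X i @^-1` A i)) =
    (\prod_(i : I) P (X i @^-1` A i))%E.

(* Only the restriction of the index set to [0, +oo[ is meaningful: nothing is
   assumed about [W t] for t < 0.  The second parameter of [normal_prob] is the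
   standard deviation. *)
Record wiener_process (d : measure_display) (Om : measurableType d)
    (R : realType) (P : probability Om R) (W : R -> {RV P >-> R}) : Prop := {
  wiener_start : {ae P, forall w, W 0 w = 0} ;
  wiener_indep : forall (n : nat) (t : nat -> R), 0 <= t 0%N ->
    {homo t : i j / (i <= j)%N >-> i <= j} ->
    @mutually_independent _ _ _ P _
      (fun i : 'I_n => W (t i.+1) - W (t i) : {mfun Om >-> R}) ;
  wiener_normal : forall s t : R, 0 <= s -> s < t ->
    forall A : set R, measurable A ->
      distribution P (W t - W s : {mfun Om >-> R}) A =
        normal_prob 0 (Num.sqrt (t - s)) A ;
  wiener_continuous :
    {ae P, forall w, {within `[0, +oo[, continuous (fun t : R => W t w)}}
}.

Definition absolutely_continuous (R : realType) (a b : R) (h : R -> R) : Prop :=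
  forall e : R, 0 < e -> exists2 delta : R, 0 < delta &
    forall (n : nat) (s t : 'I_n -> R),
      (forall i, a <= s i /\ s i <= t i /\ t i <= b) ->
      trivIset [set: 'I_n] (fun i => `]s i, t i[%classic) ->
      \sum_(i < n) (t i - s i) < delta ->
      \sum_(i < n) `|h (t i) - h (s i)| < e.

(* The values of [h] outside [0, T], and those of [derive1 h] on the null set where
   [h] is not derivable, do not affect this integral when [h] is absolutely
   continuous on [0, T]. *)
Definition energy (R : realType) (psi : R -> R) (T : R) (h : R -> R) : \bar R :=
  (\int[lebesgue_measure]_(t in `[0%R, T]) (psi (derive1 h t))%:E)%E.

Definition min_energy (R : realType) (psi : R -> R) (w : R -> R) (T r : R) :
    \bar R :=
  ereal_inf [set energy psi T h | h in [set h : R -> R |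
    [/\ absolutely_continuous 0 T h, h 0 = r &
        forall t, 0 <= t <= T -> w t <= h t]]].

(* Positivity and measurability are only required near the limit point. *)
Definition slowly_varying_at0 (R : realType) (L : R -> R) : Prop :=
  (exists2 a : R, 0 < a &
     measurable_fun `]0, a] L /\ forall x, 0 < x <= a -> 0 < L x) /\
  forall l : R, 0 < l -> L (l * x) / L x @[x --> 0^'+] --> (1 : R).

Definition slowly_varying_at_infty (R : realType) (L : R -> R) : Prop :=
  (exists a : R,
     measurable_fun `[a, +oo[ L /\ forall x, a <= x -> 0 < L x) /\
  forall l : R, 0 < l -> L (l * x) / L x @[x --> +oo_R] --> (1 : R).

(* [c] and [eps] are functions on ]0, 1[; hence the open interval of
   integration. *)
Record karamata_representation (R : realType) (theta c eps : R -> R) : Prop := {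
  karamata_c_measurable : measurable_fun (`]0, 1[ : set R) c ;
  karamata_c_gt0 : forall u, 0 < u < 1 -> 0 < c u ;
  karamata_c_bounded : [bounded c u | u in (`]0, 1[ : set R)] ;
  karamata_c_lim : exists2 c0 : R, c0 != 0 & c u @[u --> 0^'+] --> c0 ;
  karamata_eps_measurable : measurable_fun (`]0, 1[ : set R) eps ;
  karamata_eps_bounded : [bounded eps v | v in (`]0, 1[ : set R)] ;
  karamata_eps_lim : eps v @[v --> 0^'+] --> (0 : R) ;
  karamata_eq : forall u, 0 < u < 1 ->
    theta u = c u * expR (\int[lebesgue_measure]_(v in `]u, 1[) (eps v / v))
}.

(* [pinfty_nbhs] bundled with its filter structure, as the Landau notations
   require. *)
Definition pinfty_filter (R : realType) : filter_on R :=
  FilterType (pinfty_nbhs R) _.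

(* Main.v *)
(* Put b = sqrt(T) p, where p = dl g(T)^(1/(2 - kappa)) with dl small. An attempt
   at scale T runs W until it exits a concave barrier which has slope
   K min(1, b^-1 (b^2/k)^zeta) at times k <= b^2 and is flat afterwards, with
   1/2 < zeta < 1/kp for some kp in (kappa, 2). It succeeds if W survives until
   time T. By Levy's maximal inequality W survives until time b^2 and then ends
   below 0 with probability >= 1/4, and it stays below the flat part, of height
   of order b, with probability of order b / sqrt T = p. The energy of the
   barrier is O(b^2 psi(1/b)) by Potter's bound, as zeta kp < 1.
   After a failure, the attempt at the next larger scale starts at the exit time,
   so the attempts are independent. Since the p's sum to infinity over scales
   T_l in [4^l, 4^(l+1)], arbitrarily large scales succeed almost surely. On
   success the barriers of all attempts, concatenated, majorize W, and their
   energies sum geometrically to O(b^2 psi(1/b)). The Karamata representation with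
   |eps| < |log|^-alpha, together with the logarithmic lower bound on g, compares
   theta(1/b) with theta(T^(-1/2)), whence
   b^2 psi(1/b) <= 16 dl^(2 - kappa) T psi(T^(-1/2)) g(T).
   The overshoots at the exits and the oscillations of W within unit time are
   O(log T) each, and are paid for by an initial stretch of slope 8 and length
   O(log^2 T).
   Choosing T_l near the supremum of g^(1/(2 - kappa)) over that interval, and
   dropping the scales whose p is much smaller than an earlier one, replaces the
   uniform convergence theorem for slowly varying functions. *)

Require Import Defs.
From HB Require Import structures.
From mathcomp Require Import all_boot all_order all_algebra.
From mathcomp Require Import all_classical all_reals all_analysis.
From mathcomp Require Import measurable_realfun.
From mathcomp Require Import ring lra zify.

Set Implicit Arguments.
Unset Strict Implicit.
Unset Printing Implicit Defensive.

Import Order.TTheory GRing.Theory Num.Theory.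
Import numFieldNormedType.Exports.

Local Open Scope classical_set_scope.
Local Open Scope ring_scope.

(** * Independence and first passages *)

(** The exponent [1 / (2 - kappa)] comes from a balance. Up to slowly varying factors,
    [b^2 psi(1/b)] with [b = p sqrt T] is [p^(2 - kappa) T psi(T^(-1/2))]; making this a small
    multiple of the normalization forces [p] to be a small multiple of [g^(1/(2 - kappa))], and the
    integral test is the divergence of the sum of these [p]. The obstacle is the start of each
    attempt. A straight line of slope of order [1 / b] is crossed with probability close to one,
    because [W] is of size [sqrt k] at time [k]. The barrier has to be steeper early: [zeta > 1/2]
    makes it beat diffusion at every dyadic scale with summable errors, while [zeta kp < 1] keeps
    the sum of the powers [k^(-zeta kp)] governed by its last scale. Both conditions can be met
    because [kappa < 2]. Exits are considered at integer times only, so an exit time takes finitely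
    many values and a finite partition replaces the strong Markov property. The thresholds in the
    path estimates are random; success is therefore proved beyond every starting scale, and the
    starting scale is chosen afterwards for each path. *)

Section independence.
Context (R : realType) (d : measure_display) (Om : measurableType d)
  (P : probability Om R).

(** In [A], both sides are finite measures: the restriction of [P] to [B], and [P] times the
    constant [P B]. They agree on the pi-system [G], hence on the sigma-algebra it generates. *)
Lemma pi_lambda_independent (G : set (set Om)) (B : set Om) :
  setI_closed G -> G `<=` measurable -> G setT -> measurable B ->
  (forall A, G A -> P (A `&` B) = P A * P B)%E ->
  forall A, <<s G >> A -> (P (A `&` B) = P A * P B)%E.
Proof.
move=> GI Gm GT mB GAB A GA.
have PB0 : 0 <= fine (P B) by exact: fine_ge0.
have PBE : (P B = (fine (P B))%:E)%E by rewrite fineK// fin_num_measure.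
rewrite [RHS](_ : _ = mscale (NngNum PB0) P A); last first.
  by rewrite /mscale/= -PBE muleC.
rewrite [LHS](_ : _ = mrestr P mB A); last by [].
apply: (g_sigma_algebra_measure_unique G Gm (fun=> setT)) => //.
- by rewrite bigcup_const.
- by move=> C GC; rewrite /= /mrestr /mscale/= -PBE GAB// muleC.
- by move=> k; rewrite /= /mrestr setTI; rewrite ltey_eq fin_num_measure.
Qed.

Variable X : nat -> {RV P >-> R}.

(** Coordinates outside [I] stay in the intersection with the constraint [setT], so cylinders over
    different index sets can be intersected coordinate by coordinate on one common range. *)
Definition cylinders (I : set nat) : set (set Om) :=
  [set E | exists n (A : nat -> set R),
    [/\ forall i, measurable (A i), forall i, ~ I i -> A i = setT &
        E = \bigcap_(i < n) (X i @^-1` A i)]].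

Lemma cylinders_setI (I : set nat) : setI_closed (cylinders I).
Proof.
move=> _ _ [n [A [mA AT ->]]] [m [B [mB BT ->]]].
exists (maxn n m), (fun i => (if (i < n)%N then A i else setT) `&`
                             (if (i < m)%N then B i else setT)); split.
- by move=> i; apply: measurableI; case: ifP.
- by move=> i Ii; rewrite AT// BT// !if_same setTI.
- apply/seteqP; split => [x [Ax Bx] i /= _|x ABx].
    by split; case: ifP => // h; [exact: Ax|exact: Bx].
  split => i /= h.
    by have [+ _] := ABx i (leq_trans h (leq_maxl n m)); rewrite h.
  by have [_ +] := ABx i (leq_trans h (leq_maxr n m)); rewrite h.
Qed.

Lemma cylinders_measurable (I : set nat) : cylinders I `<=` measurable.
Proof.
move=> _ [n [A [mA _ ->]]]; apply: bigcap_measurableType => i _.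
by rewrite -[X in measurable X]setTI; exact: measurable_funPT.
Qed.

Lemma cylindersT (I : set nat) : cylinders I setT.
Proof.
exists 0%N, (fun=> setT); split => //; apply/seteqP; split => // x _ i.
Qed.

Lemma cylinders_preimage (I : set nat) i (A : set R) : I i -> measurable A ->
  cylinders I (X i @^-1` A).
Proof.
move=> Ii mA; exists i.+1, (fun j => if j == i then A else setT); split.
- by move=> j; case: ifP.
- by move=> j; have [->//|] := eqVneq j i.
- apply/seteqP; split => [x Ax j _ /=|x Ax].
    by have [->|] := eqVneq j i.
  by have := Ax i (ltnSn i); rewrite eqxx.
Qed.

Hypothesis indepX : forall n (A : nat -> set R), (forall i, measurable (A i)) ->
  (P (\bigcap_(i < n) (X i @^-1` A i)) = \prod_(i < n) P (X i @^-1` A i))%E.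

Lemma cylinders_independent (I J : set nat) A B : (forall i, I i -> ~ J i) ->
  cylinders I A -> cylinders J B -> (P (A `&` B) = P A * P B)%E.
Proof.
move=> IJ [n [F [mF FT ->]]] [m [G [mG GT ->]]].
pose ext k (F : nat -> set R) i := if (i < k)%N then F i else setT.
have capE k (H : nat -> set R) : (k <= maxn n m)%N ->
    \bigcap_(i < k) (X i @^-1` H i) =
    \bigcap_(i < maxn n m) (X i @^-1` ext k H i).
  move=> kN; apply/seteqP; split => x Hx i /= ik.
    by rewrite /ext; case: ifP => // h; exact: Hx.
  by have := Hx i (leq_trans ik kN); rewrite /ext ik.
have mext k H : (forall i, measurable (H i)) -> forall i, measurable (ext k H i).
  by move=> mH i; rewrite /ext; case: ifP.
rewrite (capE n)// ?leq_maxl// (capE m)// ?leq_maxr//.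
rewrite -[X in P X]bigcapI.
have -> : \bigcap_(i < maxn n m) (X i @^-1` ext n F i `&` X i @^-1` ext m G i) =
   \bigcap_(i < maxn n m) (X i @^-1` (ext n F i `&` ext m G i)) by [].
rewrite !indepX; [|exact: mext|exact: mext|by move=> i; apply: measurableI; exact: mext].
rewrite -big_split/=; apply: eq_bigr => i _.
have [Ii|Ii] := pselect (I i).
- have -> : ext m G i = setT by rewrite /ext GT ?if_same//; exact: IJ.
  by rewrite setIT preimage_setT probability_setT mule1.
- have -> : ext n F i = setT by rewrite /ext FT ?if_same.
  by rewrite setTI preimage_setT probability_setT mul1e.
Qed.

Lemma sigma_independent (I J : set nat) A B : (forall i, I i -> ~ J i) ->
  <<s cylinders I >> A -> <<s cylinders J >> B ->
  (P (A `&` B) = P A * P B)%E.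
Proof.
move=> IJ sA sB.
have sm K C : <<s cylinders K >> C -> measurable C.
  by apply: smallest_sub => //; [exact: sigma_algebra_measurable|
    exact: cylinders_measurable].
move: A sA; apply: pi_lambda_independent.
- exact: cylinders_setI.
- exact: cylinders_measurable.
- exact: cylindersT.
- exact: sm sB.
- move=> A cA; rewrite setIC muleC.
  move: B sB; apply: pi_lambda_independent.
  + exact: cylinders_setI.
  + exact: cylinders_measurable.
  + exact: cylindersT.
  + exact: cylinders_measurable cA.
  + by move=> B cB; rewrite setIC muleC; exact: cylinders_independent cA cB.
Qed.

End independence.

Section real_probability.
Context (R : realType) (d : measure_display) (Om : measurableType d)
  (P : probability Om R).

Definition pr (A : set Om) : R := fine (P A).

Lemma prE A : measurable A -> P A = (pr A)%:E.
Proof. by move=> mA; rewrite /pr fineK// fin_num_measure. Qed.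

Lemma pr_ge0 A : 0 <= pr A.
Proof. by rewrite /pr fine_ge0. Qed.

Lemma prT : pr setT = 1.
Proof. by rewrite /pr probability_setT. Qed.

Lemma le_pr A B : measurable A -> measurable B -> A `<=` B -> pr A <= pr B.
Proof.
by move=> mA mB AB; rewrite -lee_fin -!prE//; apply: le_measure; rewrite ?inE.
Qed.

Lemma pr_le1 A : measurable A -> pr A <= 1.
Proof. by move=> mA; rewrite -prT; apply: le_pr. Qed.

Lemma prC A : measurable A -> pr (~` A) = 1 - pr A.
Proof.
move=> mA; rewrite /pr probability_setC// fineB//.
by rewrite fin_num_measure.
Qed.

Lemma pr_le_sum n (F : nat -> set Om) E : measurable E ->
  (forall k, (k < n)%N -> measurable (F k)) ->
  (forall w, E w -> exists2 k, (k < n)%N & F k w) ->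
  pr E <= \sum_(k < n) pr (F k).
Proof.
move=> mE mF EF; rewrite -lee_fin -prE//.
have mU : measurable (\big[setU/set0]_(k < n) F k).
  by apply: bigsetU_measurable => k _; exact: mF.
apply: (@le_trans _ _ (P (\big[setU/set0]_(k < n) F k))).
  apply: le_measure; rewrite ?inE// => w Ew.
  by have [k kn Fk] := EF _ Ew; rewrite -bigcup_mkord; exists k.
apply: le_trans (Boole_inequality P _) _; first exact: mF.
by rewrite -sumEFin; apply: lee_sum => k _; rewrite -prE//; exact: mF.
Qed.

Lemma sum_pr_le n (F : nat -> set Om) E : measurable E ->
  (forall k, (k < n)%N -> measurable (F k)) ->
  (forall k w, (k < n)%N -> F k w -> E w) ->
  (forall i j w, (i < j < n)%N -> F i w -> F j w -> False) ->
  \sum_(k < n) pr (F k) <= pr E.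
Proof.
move=> mE mF FE Fd; rewrite -lee_fin -sumEFin.
rewrite (_ : (\sum_(i < n) _)%E = (\sum_(i < n) P (F i))%E); last first.
  by apply: eq_bigr => k _; rewrite -prE//; exact: mF.
rewrite -measure_bigsetU_ord//; last 2 first.
- by move=> k; exact: mF.
- apply/trivIsetP => /= i j _ _ ij; apply/seteqP; split => // w [Fi Fj].
  have : ((i < j) || (j < i))%N by rewrite -neq_ltn.
  by move=> /orP[] h; [apply: (Fd i j w)|apply: (Fd j i w)]; rewrite ?h/=.
rewrite -prE//; apply: le_measure; rewrite ?inE//.
  by apply: bigsetU_measurable => k _; exact: mF.
by move=> w; rewrite -bigcup_mkord => -[k /= kn Fk]; exact: FE Fk.
Qed.

End real_probability.

(** * First passages of a random walk *)

Section random_walk.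
Context (R : realType) (d : measure_display) (Om : measurableType d)
  (P : probability Om R) (X : nat -> {RV P >-> R}).
Hypothesis indepX : forall n (A : nat -> set R), (forall i, measurable (A i)) ->
  (P (\bigcap_(i < n) (X i @^-1` A i)) = \prod_(i < n) P (X i @^-1` A i))%E.

(** Heights are measured from index [s]: the first [k] steps then depend only on the increments with
    index from [s] to [s + k - 1], as a restart at an exit time requires. *)
Definition walk (s k : nat) (w : Om) : R := \sum_(i < k) X (s + i)%N w.

Definition sig (I : set nat) : set (set Om) := <<s cylinders X I >>.

Lemma sig_measurable I E : sig I E -> measurable E.
Proof.
by apply: smallest_sub => //; [exact: sigma_algebra_measurable|
  exact: cylinders_measurable].
Qed.

Lemma sig_sub (I J : set nat) : I `<=` J -> sig I `<=` sig J.
Proof.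
move=> IJ; apply: smallest_sub; first exact: smallest_sigma_algebra.
move=> _ [n [A [mA AT ->]]]; apply: sub_sigma_algebra.
by exists n, A; split => // i Ji; apply: AT => /IJ.
Qed.

Lemma sigI I E F : sig I E -> sig I F -> sig I (E `&` F).
Proof.
by move=> ? ?; apply: (@measurableI _ (g_sigma_algebraType (cylinders X I))).
Qed.

Lemma sigT I : sig I setT.
Proof. exact: (@measurableT _ (g_sigma_algebraType (cylinders X I))). Qed.

Lemma sig_bigcup I (D : set nat) (F : nat -> set Om) :
  (forall k, D k -> sig I (F k)) -> sig I (\bigcup_(k in D) F k).
Proof.
by move=> h; apply: (@bigcup_measurable _ (g_sigma_algebraType (cylinders X I))).
Qed.

Lemma sig_bigcap I (D : set nat) (F : nat -> set Om) :
  (forall k, D k -> sig I (F k)) -> sig I (\bigcap_(k in D) F k).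
Proof.
move=> h.
by apply: (@bigcap_measurableType _ (g_sigma_algebraType (cylinders X I))).
Qed.

Lemma sig_walk (I : set nat) s k (A : set R) :
  (forall i, (s <= i < s + k)%N -> I i) -> measurable A ->
  sig I (walk s k @^-1` A).
Proof.
move=> hI mA.
pose GT : measurableType _ := g_sigma_algebraType (cylinders X I).
have : measurable_fun setT (walk s k : GT -> R).
  apply: measurable_sum => i _ B mB; rewrite setTI.
  apply: sub_sigma_algebra; apply: cylinders_preimage => //.
  by apply: hI; rewrite leq_addr ltn_add2l ltn_ord.
by move=> /(_ measurableT _ mA); rewrite setTI.
Qed.

Lemma walk0 s w : walk s 0 w = 0.
Proof. by rewrite /walk big_ord0. Qed.

Lemma walkD s k l w : walk s (k + l) w = walk s k w + walk (s + k) l w.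
Proof.
rewrite /walk big_split_ord/=; congr (_ + _).
by apply: eq_bigr => i _; rewrite addnA.
Qed.

Lemma pr_past_future s A B : sig `I_s A -> sig [set i | (s <= i)%N] B ->
  pr P (A `&` B) = pr P A * pr P B.
Proof.
move=> sA sB; rewrite /pr -fineM ?fin_num_measure//; last 2 first.
- exact: sig_measurable sA.
- exact: sig_measurable sB.
congr fine; apply: sigma_independent sA sB => // i /= h1 h2.
by have := leq_trans h1 h2; rewrite ltnn.
Qed.

Definition exits (f : nat -> R) s k : set Om :=
  [set w | f k < walk s k w /\ forall j, (j < k)%N -> walk s j w <= f j].

Definition survives (f : nat -> R) s n : set Om :=
  [set w | forall k, (k <= n)%N -> walk s k w <= f k].

Lemma sig_exits (I : set nat) f s k :
  (forall i, (s <= i < s + k)%N -> I i) -> sig I (exits f s k).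
Proof.
move=> hI; rewrite (_ : exits f s k = (walk s k @^-1` `]f k, +oo[) `&`
    \bigcap_(j in `I_k) (walk s j @^-1` `]-oo, f j])); last first.
  apply/seteqP; split => w /=; rewrite in_itv/= andbT => -[h1 h2]; split => //.
apply: sigI; first exact: sig_walk.
apply: sig_bigcap => j /= jk; apply: sig_walk => // i /andP[h1 h2].
by apply: hI; rewrite h1 (leq_trans h2)// leq_add2l ltnW.
Qed.

Lemma sig_survives (I : set nat) f s n :
  (forall i, (s <= i < s + n)%N -> I i) -> sig I (survives f s n).
Proof.
move=> hI; rewrite (_ : survives f s n =
    \bigcap_(j in `I_n.+1) (walk s j @^-1` `]-oo, f j])); last first.
  by apply/seteqP; split => w /= h j /= jk; have := h j jk;
    rewrite /= in_itv.
apply: sig_bigcap => j /= jk; apply: sig_walk => // i /andP[h1 h2].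
by apply: hI; rewrite h1 (leq_trans h2)// leq_add2l.
Qed.

Lemma exits_disjoint f s i j w : (i < j)%N ->
  exits f s i w -> exits f s j w -> False.
Proof. by move=> ij [h _] [_ /(_ i ij)]; rewrite leNgt h. Qed.

Lemma survivesPn f s n w : ~ survives f s n w ->
  exists2 k, (k < n.+1)%N & exits f s k w.
Proof.
move=> h.
have ex : exists k, (k < n.+1)%N && (f k < walk s k w).
  apply: contrapT => nex; apply: h => k kn.
  by rewrite leNgt; apply/negP => fk; apply: nex; exists k; rewrite ltnS kn.
case: (ex_minnP ex) => k /andP[kn fk] kmin.
exists k => //; split => // j jk; rewrite leNgt; apply/negP => fj.
have := kmin j; rewrite fj (ltn_trans jk kn) => /(_ isT).
by rewrite leqNgt jk.
Qed.

Lemma exits_not_survives f s n k w : (k < n.+1)%N -> exits f s k w ->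
  ~ survives f s n w.
Proof. by move=> kn [h _] /(_ k kn); rewrite leNgt h. Qed.

Lemma measurable_exits f s k : measurable (exits f s k).
Proof. by apply: (@sig_measurable setT); exact: sig_exits. Qed.

Lemma measurable_survives f s n : measurable (survives f s n).
Proof. by apply: (@sig_measurable setT); exact: sig_survives. Qed.

Lemma measurable_walk_preimage s k (A : set R) : measurable A ->
  measurable (walk s k @^-1` A).
Proof. by move=> mA; apply: (@sig_measurable setT); exact: sig_walk. Qed.

Hypothesis half : forall s k, 2^-1 <= pr P [set w | 0 <= walk s k w].

(* Levy's maximal inequality: after its first passage above [a], the walk ends
   above [a] at time [n] with probability at least 1/2. *)
Lemma pr_max_le s n a :
  1 - pr P (survives (fun=> a) s n) <= 2 * pr P [set w | a < walk s n w].
Proof.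
have mg : measurable [set w | a < walk s n w].
  have := measurable_walk_preimage s n (measurable_itv `]a, +oo[).
  by congr measurable; apply/seteqP; split => w /=; rewrite in_itv/= andbT.
have sh k : sig [set i | (s + k <= i)%N] [set w | 0 <= walk (s + k) (n - k) w].
  rewrite (_ : mkset _ = walk (s + k) (n - k) @^-1` `[0, +oo[); last first.
    by apply/seteqP; split => w /=; rewrite in_itv/= andbT.
  by apply: sig_walk => // i /andP[].
have sx k : sig `I_(s + k) (exits (fun=> a) s k).
  by apply: sig_exits => i /andP[].
rewrite -prC; last exact: measurable_survives.
apply: (@le_trans _ _ (\sum_(k < n.+1) pr P (exits (fun=> a) s k))).
  apply: pr_le_sum => [|k _|w].
  - exact/measurableC/measurable_survives.
  - exact: measurable_exits.
  - exact: survivesPn.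
rewrite mulrC -ler_pdivrMr// mulr_suml.
apply: (@le_trans _ _ (\sum_(k < n.+1) pr P (exits (fun=> a) s k `&`
    [set w | 0 <= walk (s + k) (n - k) w]))).
  apply: ler_sum => k _; rewrite (pr_past_future (sx k) (sh k)).
  by apply: ler_wpM2l; rewrite ?pr_ge0.
apply: (@sum_pr_le _ _ _ _ _ (fun k => exits (fun=> a) s k `&`
    [set w | 0 <= walk (s + k) (n - k) w])) => // [k _|k w|i j w].
- apply: measurableI; first exact: measurable_exits.
  exact: sig_measurable (sh k).
- move=> kn [[/= h1 _] h2]; rewrite -(subnKC (m := k) (n := n))//.
  by rewrite walkD; lra.
- by move=> /andP[ij _] [h1 _] [h2 _]; exact: exits_disjoint ij h1 h2.
Qed.

Variables (F : nat -> nat -> R) (N : nat -> nat).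

(* [all_fail s L]: from time [s] on, the barriers [F l], for [l] in [L], are
   tried in turn, each one started when the walk exits the previous one, and
   the walk exits each of them within [N l] steps. *)
Fixpoint all_fail (s : nat) (L : seq nat) : set Om :=
  if L is l :: L' then
    \bigcup_(k in `I_(N l).+1) (exits (F l) s k `&` all_fail (s + k) L')
  else setT.

Lemma sig_all_fail s L : sig [set i | (s <= i)%N] (all_fail s L).
Proof.
elim: L s => [|l L IH] s /=; first exact: sigT.
apply: sig_bigcup => k _; apply: sigI.
  by apply: sig_exits => i /andP[].
apply: sig_sub (IH (s + k)%N) => i /=.
by apply: leq_trans; exact: leq_addr.
Qed.

(** Split by the exit time [k]: the exit is decided by increments before [s + k], the remaining
    attempts by later ones, and the bound [q l] is uniform in the starting time. The exit events are
    disjoint and exclude survival, so their probabilities sum to at most [1 - q l]. *)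
Lemma pr_all_fail (q : nat -> R) s L :
  (forall l s, l \in L -> q l <= pr P (survives (F l) s (N l))) ->
  pr P (all_fail s L) <= \prod_(l <- L) (1 - q l).
Proof.
elim: L s => [|l L IH] s hq; first by rewrite big_nil /= prT.
rewrite big_cons.
have mf s' L' : measurable (all_fail s' L') by apply: sig_measurable; exact: sig_all_fail.
have sx k : sig `I_(s + k) (exits (F l) s k).
  by apply: sig_exits => i /andP[].
have hL s' : pr P (all_fail s' L) <= \prod_(l <- L) (1 - q l).
  by apply: IH => l' s'' l'L; apply: hq; rewrite inE l'L orbT.
apply: (@le_trans _ _ (\sum_(k < (N l).+1)
    pr P (exits (F l) s k `&` all_fail (s + k) L))).
  apply: (@pr_le_sum _ _ _ _ _
    (fun k => exits (F l) s k `&` all_fail (s + k) L)).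
  - exact: mf s (l :: L).
  - by move=> k _; apply: measurableI => //; exact: measurable_exits.
  - by move=> w [k /= kN h]; exists k.
apply: (@le_trans _ _ (\sum_(k < (N l).+1) pr P (exits (F l) s k) *
    \prod_(l <- L) (1 - q l))).
  apply: ler_sum => k _; rewrite (pr_past_future (sx k) (@sig_all_fail (s + k)%N L)).
  by apply: ler_wpM2l; rewrite ?pr_ge0.
rewrite -mulr_suml; apply: ler_wpM2r.
  exact: le_trans (pr_ge0 P (all_fail s L)) (hL s).
apply: (@le_trans _ _ (1 - pr P (survives (F l) s (N l)))); last first.
  by rewrite lerD2l lerN2; apply: hq; rewrite inE eqxx.
rewrite -prC; last exact: measurable_survives.
apply: (@sum_pr_le _ _ _ _ _ (exits (F l) s)) => // [|k _|k w|i j w].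
- exact/measurableC/measurable_survives.
- exact: measurable_exits.
- exact: exits_not_survives.
- by move=> /andP[ij _]; exact: exits_disjoint.
Qed.

End random_walk.

(** * Gaussian estimates *)

Section normal_bounds.
Context (R : realType).
Local Notation mu := (@lebesgue_measure R).
Implicit Types s a x : R.

Lemma expR_half_le2 : expR 2^-1 <= 2 :> R.
Proof.
have h : 2^-1 <= expR (- 2^-1) :> R by have := expR_ge1Dx (- 2^-1 : R); lra.
by rewrite expRN in h; rewrite -lef_pV2 ?posrE ?expR_gt0.
Qed.

Lemma normal_pdf0E s x : 0 < s ->
  normal_pdf 0 s x = normal_peak s * expR (- x ^+ 2 / (s ^+ 2 *+ 2)).
Proof. by move=> s0; rewrite normal_pdfE ?gt_eqF// /normal_fun subr0. Qed.

Lemma normal_prob_half s : 0 < s -> normal_prob 0 s `[0, +oo[ = (2^-1)%:E.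
Proof.
move=> s0.
have := integral_normal_pdf 0 s.
rewrite ge0_symfun_integralT; first last.
- by move=> x; rewrite /= !normal_pdf0E// sqrrN.
- by apply: continuous_normal_pdf; rewrite gt_eqF.
- exact: normal_pdf_ge0.
rewrite -set_itvcy -/(normal_prob 0 s `[0, +oo[) => h.
have : normal_prob 0 s `[0, +oo[ \is a fin_num by exact: fin_num_measure.
move: h; case: (normal_prob 0 s `[0, +oo[) => //= r [h] _.
by congr EFin; lra.
Qed.

Lemma normal_peak_le s : 0 < s -> normal_peak s <= s^-1.
Proof.
move=> s0; rewrite /normal_peak lef_pV2 ?posrE//; last first.
  by rewrite sqrtr_gt0 mulrn_wgt0// mulr_gt0 ?pi_gt0// exprn_gt0.
rewrite -[leLHS]ger0_norm; last exact: ltW.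
rewrite -sqrtr_sqr; apply: ler_wsqrtr.
have := pi_ge2 R; have : 0 < s ^+ 2 by rewrite exprn_gt0.
by rewrite -mulrnAr => h1 h2; rewrite ler_pMr//; rewrite -mulr_natr; lra.
Qed.

Lemma normal_peak_ge s : 0 < s -> (3 * s)^-1 <= normal_peak s.
Proof.
move=> s0; rewrite /normal_peak lef_pV2 ?posrE ?(mulr_gt0 _ s0)//; last first.
  by rewrite sqrtr_gt0 mulrn_wgt0// mulr_gt0 ?pi_gt0// exprn_gt0.
rewrite -[leRHS]ger0_norm; last by rewrite mulr_ge0// ltW.
rewrite -sqrtr_sqr; apply: ler_wsqrtr.
have pi4 : pi <= 4 :> R.
  by have := pihalf_lt2 R; lra.
have : 0 < s ^+ 2 by rewrite exprn_gt0.
rewrite -mulrnAr exprMn (mulrC (3 ^+ 2)) => h2.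
by rewrite ler_pM2l//; rewrite -mulr_natr; lra.
Qed.

(** For [x <= a <= s] the density is at least [normal_peak s * exp(-1/2)], and these factors are at
    least [1 / (3 s)] and [1 / 2]. *)
Lemma normal_prob_itv_ge s a : 0 < s -> 0 <= a <= s ->
  ((a / s * 6^-1)%:E <= normal_prob 0 s `[0%R, a])%E.
Proof.
move=> s0 /andP[a0 as_]; rewrite /normal_prob.
apply: (@le_trans _ _ (\int[mu]_(x in `[0%R, a]) (cst (s^-1 * 6^-1)%:E x))%E).
  rewrite integral_cst//= lebesgue_measure_itv/= lte_fin.
  case: ltP => h; rewrite -?EFinD -EFinM lee_fin.
    by rewrite oppr0 addr0 [leRHS]mulrC mulrA.
  by rewrite (_ : a = 0) ?mul0r ?mulr0//; lra.
apply: ge0_le_integral => //.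
- by move=> x _; rewrite lee_fin mulr_ge0// ?invr_ge0 ltW.
- by apply/measurable_EFinP/measurable_funTS; exact: measurable_normal_pdf.
move=> x /=; rewrite in_itv/= => /andP[x0 xa]; rewrite lee_fin normal_pdf0E//.
have e2 : 2^-1 <= expR (- x ^+ 2 / (s ^+ 2 *+ 2)).
  apply: (@le_trans _ _ (expR (- 2^-1))).
    by have := expR_ge1Dx (- 2^-1 : R); lra.
  rewrite ler_expR mulNr lerN2 -mulr_natr invfM mulrA ler_piMl//.
  rewrite ler_pdivrMr ?exprn_gt0// mul1r ler_sqr ?nnegrE ?(ltW s0)//.
  exact: le_trans xa as_.
have p3 := normal_peak_ge s0.
rewrite (_ : s^-1 * 6^-1 = (3 * s)^-1 * 2^-1); last by field; rewrite gt_eqF.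
by apply: ler_pM => //; rewrite invr_ge0 mulr_ge0// ltW.
Qed.

(** By [(x / s - 1)^2 >= 0] the Gaussian density lies below [exp(1/2 - x / s) / s], which has an
    elementary antiderivative. *)
Lemma normal_prob_tail s a : 0 < s -> 0 <= a ->
  (normal_prob 0 s `]a, +oo[ <= (expR (2^-1 - a / s))%:E)%E.
Proof.
move=> s0 a0; rewrite /normal_prob.
pose f x := s^-1 * expR (2^-1 - x / s).
pose F x := - expR (2^-1 - x / s).
have cg : continuous (fun x => 2^-1 - x / s).
  by move=> x; apply: cvgB; [exact: cvg_cst|apply: cvgMl; exact: cvg_id].
have ce : continuous (fun x => expR (2^-1 - x / s)).
  move=> x; apply: (cvg_comp (fun x => 2^-1 - x / s) expR).
    exact: cg.
  exact: continuous_expR.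
have cf : continuous f by move=> x; apply: cvgMr; exact: ce.
have dF x : is_derive x 1 F (f x).
  rewrite /F /f; apply: is_derive_eq.
  rewrite /GRing.scale/=.
  by rewrite !mulr0 !add0r mul1r mulr1 mulrN opprK mulrC.
have intf : (\int[mu]_(x in `[a, +oo[) (f x)%:E = 0%:E - (F a)%:E)%E.
  apply: ge0_continuous_FTC2y.
  - by move=> x _; rewrite mulr_ge0 ?expR_ge0// invr_ge0 ltW.
  - exact: continuous_subspaceT.
  - rewrite -oppr0 /F; apply: cvgN.
    rewrite (_ : (fun x => _) =
        (fun z => expR (- z)) \o (fun x => x / s - 2^-1)); last first.
      by apply/funext => x /=; rewrite opprB.
    apply: (@cvg_comp _ _ _ _ _ _ (pinfty_nbhs R)); last exact: cvgr_expR.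
    apply: (@cvg_comp _ _ _ (fun x => x / s) (fun z => z - 2^-1) _
      (pinfty_nbhs R)); last exact: cvg_addrr.
    by apply: gt0_cvgMly; [rewrite invr_gt0|exact: cvg_id].
  - by move=> x _; have [] := dF x.
  - by apply: cvg_at_right_filter; apply: cvgN; exact: ce.
  - by move=> x _; rewrite derive1E; have [_ ->] := dF x.
apply: (@le_trans _ _ (\int[mu]_(x in `[a, +oo[) (f x)%:E)%E); last first.
  by rewrite intf /F EFinN oppeK add0e.
rewrite -integral_itv_obnd_cbnd; last first.
  by apply/measurable_EFinP/measurable_funTS; exact: continuous_measurable_fun.
apply: ge0_le_integral => //.
- by move=> x _; rewrite lee_fin normal_pdf_ge0.
- by apply/measurable_EFinP/measurable_funTS; exact: measurable_normal_pdf.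
- by apply/measurable_EFinP/measurable_funTS; exact: continuous_measurable_fun.
move=> x _; rewrite lee_fin normal_pdf0E// /f.
apply: ler_pM; rewrite ?normal_peak_ge0 ?expR_ge0 ?normal_peak_le//.
rewrite ler_expR.
rewrite (_ : - x ^+ 2 / (s ^+ 2 *+ 2) = - 2^-1 * (x / s) ^+ 2); last first.
  by rewrite -mulr_natr; field; rewrite gt_eqF.
by have := sqr_ge0 (x / s - 1); rewrite sqrrB1; lra.
Qed.

(** An inverse square is all that is needed: over dyadic scales it produces geometric sums. The 8 is
    [exp(1/2) <= 2] times the 4 in [exp x >= (x / 2)^2]. *)
Lemma expR_half_sub_le x : 0 < x -> expR (2^-1 - x) <= 8 / x ^+ 2.
Proof.
move=> x0; rewrite expRD expRN.
have h2 : (x / 2) ^+ 2 <= expR x.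
  rewrite [X in expR X](_ : x = x / 2 + x / 2); last lra.
  rewrite expRD -expr2 ler_sqr ?nnegrE ?expR_ge0//; last lra.
  by have := expR_ge1Dx (x / 2); lra.
have x2 : 0 < x ^+ 2 by rewrite exprn_gt0.
rewrite ler_pdivrMr ?expR_gt0// mulrAC ler_pdivlMr//.
have := expR_half_le2; rewrite expr_div_n in h2 => h3.
apply: (@le_trans _ _ (2 * x ^+ 2)); last by lra.
by rewrite ler_pM2r.
Qed.

End normal_bounds.

Lemma borel_cantelli (R : realType) (d : measure_display)
    (Om : measurableType d) (P : probability Om R) (B : nat -> set Om) (C : R) :
  (forall i, measurable (B i)) -> (forall i, pr P (B i) <= C / 2 ^+ i) ->
  {ae P, forall w, exists i0, forall i, (i0 <= i)%N -> ~ B i w}.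
Proof.
move=> mB prB.
have C0 : 0 <= C by have := le_trans (pr_ge0 P (B 0%N)) (prB 0%N); rewrite divr1.
exists (lim_sup_set B); split.
- apply: bigcap_measurableType => k _; apply: bigcup_measurable => j _.
  exact: mB.
- apply: lim_sup_set_cvg0 => //.
  apply: (@le_lt_trans _ _ (\sum_(i <oo) ((2 * C) / (2 ^ i.+1)%:R)%:E)%E).
    apply: lee_nneseries => [i _ _|i _]; first exact: measure_ge0.
    have := prB i; rewrite -lee_fin -prE// => /le_trans; apply.
    rewrite lee_fin natrX exprS le_eqVlt; apply/orP; left; apply/eqP.
    by field; rewrite expf_neq0.
  apply: le_lt_trans (ltry (2 * C)).
  by apply: epsilon_trick0; rewrite mulr_ge0.
- move=> w /= h n _ /=; apply: contrapT => nw; apply: h; exists n => i ni Bi.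
  by apply: nw; exists i.
Qed.

(** * Increments of the Wiener process along a grid *)

Section wiener.
Context (R : realType) (d : measure_display) (Om : measurableType d)
  (P : probability Om R) (W : R -> {RV P >-> R}).
Hypothesis hW : wiener_process W.

Definition incr (t : nat -> R) (i : nat) : {RV P >-> R} :=
  W (t i.+1) - W (t i).

Lemma incr_indep t : 0 <= t 0%N -> {homo t : i j / (i <= j)%N >-> i <= j} ->
  forall n (A : nat -> set R), (forall i, measurable (A i)) ->
  (P (\bigcap_(i < n) (incr t i @^-1` A i)) =
   \prod_(i < n) P (incr t i @^-1` A i))%E.
Proof.
move=> t0 ht n A mA.
have /(_ (fun i => A i) (fun i => mA i)) <- := wiener_indep hW (n := n) t0 ht.
congr (P _); apply/seteqP; split => w h i /=.
  by move=> _; exact: h (ltn_ord i).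
by move=> ni; exact: (h (Ordinal ni)).
Qed.

Lemma walk_incr t s k w :
  walk (incr t) s k w = W (t (s + k)%N) w - W (t s) w.
Proof.
elim: k => [|k IH]; first by rewrite addn0 subrr walk0.
rewrite -addn1 walkD IH /walk big_ord1 addn0 addn1 addnS /incr /=.
by rewrite /= addrC subrKA.
Qed.

Lemma pr_incr s u (A : set R) : 0 <= s -> s < u -> measurable A ->
  pr P [set w | A (W u w - W s w)] = fine (normal_prob 0 (Num.sqrt (u - s)) A).
Proof. by move=> s0 su mA; rewrite -(wiener_normal hW). Qed.

Lemma pr_incr_ge0 s u : 0 <= s -> s <= u ->
  2^-1 <= pr P [set w | 0 <= W u w - W s w].
Proof.
move=> s0; rewrite le_eqVlt => /predU1P[<-|su].
  rewrite (_ : [set w | _] = setT) ?prT; last first.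
    by apply/seteqP; split => // w _ /=; rewrite subrr.
  lra.
have := pr_incr s0 su (measurable_itv `[0, +oo[).
rewrite normal_prob_half ?sqrtr_gt0 ?subr_gt0//= => <-.
by rewrite le_eqVlt; apply/orP; left; apply/eqP; congr (pr P _);
  apply/seteqP; split => w /=; rewrite in_itv/= andbT.
Qed.

Lemma pr_incr_gtE s u a : 0 <= s -> s < u ->
  pr P [set w | a < W u w - W s w] =
  fine (normal_prob 0 (Num.sqrt (u - s)) `]a, +oo[).
Proof.
move=> s0 su; rewrite -(pr_incr s0 su)//; congr (pr P _).
by apply/seteqP; split => w /=; rewrite in_itv/= andbT.
Qed.

Lemma pr_incr_gt s u a : 0 <= s -> s < u -> 0 <= a ->
  pr P [set w | a < W u w - W s w] <= expR (2^-1 - a / Num.sqrt (u - s)).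
Proof.
move=> s0 su a0; rewrite pr_incr_gtE//.
rewrite -lee_fin fineK; last exact: fin_num_measure.
by apply: normal_prob_tail => //; rewrite sqrtr_gt0 subr_gt0.
Qed.

(** By symmetry the right-hand side is twice the mass of [[0, a]]. Levy's inequality makes it a
    lower bound for the probability of never exceeding [a]. *)
Lemma pr_incr_gt_compl s u a : 0 <= s -> s < u -> 0 <= a <= Num.sqrt (u - s) ->
  a / Num.sqrt (u - s) / 3 <= 1 - 2 * pr P [set w | a < W u w - W s w].
Proof.
move=> s0 su a0; rewrite pr_incr_gtE//.
set v := Num.sqrt (u - s) in a0 *.
have v0 : 0 < v by rewrite sqrtr_gt0 subr_gt0.
have h1 := normal_prob_itv_ge v0 a0.
have h2 : normal_prob 0 v `[0, +oo[ =
    (normal_prob 0 v `[0%R, a] + normal_prob 0 v `]a, +oo[)%E.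
  rewrite -measureU//; last first.
    apply/seteqP; split => // x /=; rewrite !in_itv/= andbT.
    by move=> [/andP[_ xa]]; rewrite ltNge xa.
  congr (normal_prob 0 v); apply/seteqP; split => x /=;
    rewrite !in_itv/= !andbT.
    by move=> x0; case: (leP x a) => ?; [left; rewrite x0|right].
  by move=> [/andP[]//|ax]; case/andP: a0 => a0 _; rewrite ltW// (le_lt_trans a0).
rewrite normal_prob_half// in h2.
have f1 : normal_prob 0 v `[0%R, a] \is a fin_num by exact: fin_num_measure.
have f2 : normal_prob 0 v `]a, +oo[ \is a fin_num by exact: fin_num_measure.
move: h1 h2; rewrite -(fineK f1) -(fineK f2) lee_fin -EFinD => h1 [h2].
by rewrite /=; lra.
Qed.

End wiener.

(** * Survival below a barrier *)

Section barrier.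
Context (R : realType).
Implicit Types (zeta K b : R).

Lemma powRE (a x : R) : 0 < a -> a `^ x = expR (x * ln a).
Proof. by move=> a0; rewrite /powR gt_eqF. Qed.

Lemma exprn_powR (a x : R) n : 0 <= a -> (a `^ x) ^+ n = (a ^+ n) `^ x.
Proof.
by move=> a0; rewrite -(powR_mulrn n (powR_ge0 a x)) -powRrM mulrC powRrM powR_mulrn.
Qed.

Definition width b : nat := (Num.truncn (b ^+ 2)).+1.

Lemma width_gt b : b ^+ 2 < (width b)%:R.
Proof. exact: truncnS_gt. Qed.

Lemma width_le b : 1 <= b -> (width b)%:R <= 2 * b ^+ 2.
Proof.
move=> b1; rewrite /width -addn1 natrD.
have h : 1 <= b ^+ 2 by rewrite expr_ge1// (le_trans _ b1).
have : (Num.truncn (b ^+ 2))%:R <= b ^+ 2 by rewrite truncn_le (le_trans _ h).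
lra.
Qed.

(* This is [min(1, b^-1 (b^2 / y)^zeta)]: on time scale [y] the sum of these
   slopes exceeds the diffusive size [sqrt y] by the factor
   [(b^2 / y)^(zeta - 1/2)], or is of order [y] when [y] is small. *)
Definition decay zeta b (y : R) : R :=
  Num.min 1 (b `^ (2 * zeta - 1) * y `^ (- zeta)).

(** The shift to [k.+1] matters: [powR] sends 0 to 0 for a nonzero exponent, so [decay] would vanish
    at 0. It also makes each of the first [k] slopes at least [K * decay zeta b k]. *)
Definition slope zeta K b (k : nat) : R :=
  if (k < width b)%N then K * decay zeta b k.+1%:R else 0.

Definition barrier zeta K b (k : nat) : R := \sum_(j < k) slope zeta K b j.

Lemma decay_ge0 zeta b y : 0 <= decay zeta b y.
Proof. by rewrite /decay le_min ler01 mulr_ge0 ?powR_ge0. Qed.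

Lemma decay_le zeta b y z : 0 <= zeta -> 0 < y -> y <= z ->
  decay zeta b z <= decay zeta b y.
Proof.
move=> z0 y0 yz; rewrite /decay; apply: le_min2 => //.
apply: ler_wpM2l; first exact: powR_ge0.
rewrite !powRN lef_pV2 ?posrE ?powR_gt0//; last exact: lt_le_trans yz.
by apply: ge0_ler_powR => //; rewrite nnegrE ltW// (lt_le_trans y0).
Qed.

Lemma slope_ge0 zeta K b k : 0 <= K -> 0 <= slope zeta K b k.
Proof. by move=> K0; rewrite /slope; case: ifP => // _; rewrite mulr_ge0 ?decay_ge0. Qed.

Lemma slope_le zeta K b k : 0 <= K -> slope zeta K b k <= K.
Proof.
move=> K0; rewrite /slope; case: ifP => // _.
by rewrite ler_piMr// /decay ge_min lexx.
Qed.

Lemma barrier_le zeta K b k l : 0 <= K -> (k <= l)%N ->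
  barrier zeta K b k <= barrier zeta K b l.
Proof.
move=> K0 kl; rewrite /barrier -(subnKC kl) big_split_ord/= lerDl.
by apply: sumr_ge0 => i _; exact: slope_ge0.
Qed.

Lemma barrier_ge0 zeta K b k : 0 <= K -> 0 <= barrier zeta K b k.
Proof. by move=> K0; apply: sumr_ge0 => i _; exact: slope_ge0. Qed.

Lemma barrier_ge zeta K b k : 0 <= K -> 0 <= zeta -> (0 < k <= width b)%N ->
  K * k%:R * decay zeta b k%:R <= barrier zeta K b k.
Proof.
move=> K0 z0 /andP[k0 kw]; rewrite /barrier.
apply: (@le_trans _ _ (\sum_(j < k) K * decay zeta b k%:R)).
  by rewrite sumr_const card_ord -[leRHS]mulr_natr mulrAC.
apply: ler_sum => j _; rewrite /slope (leq_trans (ltn_ord j) kw).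
by apply: ler_wpM2l => //; apply: decay_le; rewrite ?ltr0n// ler_nat.
Qed.

(** By [barrier_ge] the height is at least [b^(2 zeta - 1) w^(1 - zeta)], or [w] itself, with
    [w = width b >= b^2]. A walk that is below 0 at time [width b] thus has room [b] under the flat
    part. *)
Lemma barrier_width zeta K b : 1 <= K -> 2^-1 < zeta < 1 -> 1 <= b ->
  b <= barrier zeta K b (width b).
Proof.
move=> K1 /andP[z0 z1] b1.
have b0 : 0 < b by exact: lt_le_trans b1.
have w0 : 0 < (width b)%:R :> R by rewrite ltr0n.
have wb := ltW (width_gt b).
have lb : ln (b ^+ 2) <= ln (width b)%:R.
  by rewrite ler_ln// posrE exprn_gt0.
rewrite lnXn// -(mulr_natr (ln b)) in lb.
have lb0 : 0 <= ln b by exact: ln_ge0.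
apply: le_trans (barrier_ge (k := width b) _ _ _); rewrite ?leqnn//; try lra.
apply: (@le_trans _ _ ((width b)%:R * decay zeta b (width b)%:R)); last first.
  by rewrite -mulrA ler_peMl// mulr_ge0 ?decay_ge0.
rewrite /decay; case: (leP 1 (b `^ (2 * zeta - 1) * (width b)%:R `^ (- zeta))) => _.
  by rewrite mulr1 (le_trans _ wb)// expr2 ler_peMl// ltW.
rewrite !powRE// -expRD -{1}(lnK b0) -{1}(lnK w0) -expRD ler_expR.
rewrite -subr_ge0.
rewrite (_ : _ - _ = (1 - zeta) * (ln (width b)%:R - ln b * 2)); last by ring.
by apply: mulr_ge0; rewrite subr_ge0// ltW.
Qed.

(** The level is a lower bound of the barrier at time [y], the deviation that of the walk at time
    [2 y]. The inverse square of [decay] is a maximum of two terms, bounded by their sum; along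
    [y = 2^j] this gives one decreasing and one increasing geometric series. *)
Lemma decay_tail zeta K b y : 0 < K -> 0 < y -> 0 < b ->
  expR (2^-1 - K * y * decay zeta b y / Num.sqrt (2 * y)) <=
  16 / K ^+ 2 * (y^-1 + b `^ (- (2 * (2 * zeta - 1))) * y `^ (2 * zeta - 1)).
Proof.
move=> K0 y0 b0.
have m0 : 0 < decay zeta b y.
  by rewrite /decay lt_min ltr01 mulr_gt0 ?powR_gt0.
have sy : 0 < Num.sqrt (2 * y) by rewrite sqrtr_gt0 mulr_gt0.
apply: le_trans (expR_half_sub_le _) _.
  by rewrite divr_gt0// mulr_gt0// mulr_gt0.
have -> : 8 / (K * y * decay zeta b y / Num.sqrt (2 * y)) ^+ 2 =
    16 / K ^+ 2 * (y^-1 * (decay zeta b y ^+ 2)^-1).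
  rewrite expr_div_n sqr_sqrtr; last by rewrite mulr_ge0// ltW.
  by field; rewrite !gt_eqF.
apply: ler_wpM2l; first by rewrite divr_ge0// sqr_ge0.
have -> : y^-1 + b `^ (- (2 * (2 * zeta - 1))) * y `^ (2 * zeta - 1) =
    y^-1 * (1 + b `^ (- (2 * (2 * zeta - 1))) * y `^ (2 * zeta)).
  rewrite [RHS]mulrDr mulr1; congr (_ + _); rewrite [RHS]mulrCA; congr (_ * _).
  by rewrite -(powR_inv1 (ltW y0)) -powRD ?(gt_eqF y0) ?implybT//; congr powR; ring.
apply: ler_wpM2l; first by rewrite invr_ge0 ltW.
rewrite /decay; case: (leP 1 (b `^ (2 * zeta - 1) * y `^ (- zeta))) => _.
  by rewrite expr1n invr1 lerDl mulr_ge0 ?powR_ge0.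
rewrite -[leLHS]add0r lerD// le_eqVlt; apply/orP; left; apply/eqP.
rewrite !powRE// -!expRD -expRM_natl -expRN; congr expR.
by rewrite mulr_natl; ring.
Qed.

Lemma sum_geometric_le (q : R) n : 1 < q ->
  \sum_(j < n) q ^+ j <= q ^+ n / (q - 1).
Proof.
move=> q1; rewrite ler_pdivlMr ?subr_gt0// mulrC -subrX1 gerBl.
exact: ler01.
Qed.

Lemma sum_half_le n : \sum_(j < n) ((2 : R) ^+ j)^-1 <= 2.
Proof.
suff -> : \sum_(j < n) ((2 : R) ^+ j)^-1 = 2 - 2 / 2 ^+ n.
  by rewrite gerBl divr_ge0// exprn_ge0.
elim: n => [|n IH]; first by rewrite big_ord0 expr0; lra.
by rewrite big_ord_recr/= IH exprS; field; rewrite expf_neq0.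
Qed.

(** Fitted to [sum_decay_tail]: 2 and [q^2 / (q - 1)] bound the two geometric series, and 128 = 4 *
    32 brings the total down to [1 / (4 K)]. *)
Definition barrier_const zeta : R :=
  let q := 2 `^ (2 * zeta - 1) in 128 * (2 + q ^+ 2 / (q - 1)).

Lemma powR2_gt1 x : 0 < x -> 1 < 2 `^ x :> R.
Proof.
by move=> x0; rewrite powRE// expR_gt1 mulr_gt0// ln_gt0// ltr1n.
Qed.

Lemma barrier_const_ge1 zeta : 2^-1 < zeta -> 1 <= barrier_const zeta.
Proof.
move=> z; rewrite /barrier_const.
set q := _ `^ _; have q1 : 1 < q by apply: powR2_gt1; lra.
have : 0 <= q ^+ 2 / (q - 1) by rewrite divr_ge0 ?sqr_ge0//; lra.
lra.
Qed.

Lemma sum_decay_tail zeta b : 2^-1 < zeta -> 1 <= b ->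
  \sum_(j < (trunc_log 2 (width b)).+1) 2 * expR (2^-1 -
    barrier_const zeta * 2 ^+ j * decay zeta b (2 ^+ j) /
    Num.sqrt (2 * 2 ^+ j)) <= 4^-1.
Proof.
move=> z b1; set K := barrier_const zeta; set J := trunc_log _ _.
set x := 2 * zeta - 1; have x0 : 0 < x by rewrite /x; lra.
have q1 := powR2_gt1 x0; set q := 2 `^ x in q1.
have b0 : 0 < b by exact: lt_le_trans b1.
have K1 : 1 <= K by exact: barrier_const_ge1.
apply: (@le_trans _ _ (\sum_(j < J.+1) 32 / K ^+ 2 *
    ((2 ^+ j)^-1 + b `^ (- (2 * x)) * q ^+ j))).
  apply: ler_sum => j _.
  have -> : 32 / K ^+ 2 = 2 * (16 / K ^+ 2) by field; rewrite gt_eqF//; lra.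
  rewrite -[leRHS]mulrA; apply: ler_wpM2l => //.
  have -> : q ^+ j = (2 ^+ j) `^ x.
    exact: exprn_powR.
  by apply: decay_tail => //; rewrite ?exprn_gt0//; lra.
rewrite -mulr_sumr big_split/= -mulr_sumr.
apply: (@le_trans _ _ (32 / K ^+ 2 * (2 + q ^+ 2 / (q - 1)))); last first.
  have -> : 2 + q ^+ 2 / (q - 1) = K / 128 by rewrite /K /barrier_const -/x -/q; field; lra.
  have -> : 32 / K ^+ 2 * (K / 128) = 4^-1 / K by field; lra.
  by rewrite ler_pdivrMr; lra.
apply: ler_wpM2l; first by rewrite divr_ge0// sqr_ge0.
apply: lerD; first exact: sum_half_le.
apply: (@le_trans _ _ (b `^ (- (2 * x)) * (q ^+ J.+1 / (q - 1)))).
  by apply: ler_wpM2l; [exact: powR_ge0|exact: sum_geometric_le].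
rewrite mulrA ler_pM2r ?invr_gt0 ?subr_gt0// exprS mulrCA expr2 ler_pM2l; last lra.
rewrite powRN mulrC ler_pdivrMr ?powR_gt0//.
have -> : q ^+ J = (2 ^+ J) `^ x.
  exact: exprn_powR.
(* The increasing series is governed by its last term, and the last scale satisfies
   [2^J <= width b <= 2 b^2]; the prefactor [b^(-2 x)] compensates exactly this. *)
have -> : q * b `^ (2 * x) = (2 * b ^+ 2) `^ x.
  by rewrite powRM// ?sqr_ge0// powRrM powR_mulrn// ltW.
apply: ge0_ler_powR; rewrite ?nnegrE; [exact: ltW|exact: exprn_ge0| |].
  by rewrite mulr_ge0// sqr_ge0.
apply: le_trans (width_le b1); rewrite -natrX ler_nat.
exact: trunc_logP.
Qed.

End barrier.

(** * Survival probabilities at integer times *)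

Section integer_walk.
Context (R : realType) (d : measure_display) (Om : measurableType d)
  (P : probability Om R) (W : R -> {RV P >-> R}).
Hypothesis hW : wiener_process W.

Definition unit_incr : nat -> {RV P >-> R} := incr W (fun i => i%:R).

Local Notation S := (walk unit_incr).

Let nat_homo : {homo (fun i : nat => i%:R : R) : i j / (i <= j)%N >-> i <= j}.
Proof. by move=> i j; rewrite ler_nat. Qed.

Lemma unit_incr_indep n (A : nat -> set R) : (forall i, measurable (A i)) ->
  (P (\bigcap_(i < n) (unit_incr i @^-1` A i)) =
   \prod_(i < n) P (unit_incr i @^-1` A i))%E.
Proof. exact: incr_indep. Qed.

Lemma walk_unit s k w : S s k w = W (s + k)%:R w - W s%:R w.
Proof. exact: walk_incr. Qed.

Lemma walk_half s k : 2^-1 <= pr P [set w | 0 <= S s k w].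
Proof.
rewrite (_ : mkset _ = [set w | 0 <= W (s + k)%:R w - W s%:R w]).
  by apply: pr_incr_ge0; rewrite ?ler_nat ?leq_addr.
by apply/seteqP; split => w /=; rewrite walk_unit.
Qed.

Lemma walk_gtE s n a : [set w | a < S s n w] =
  [set w | a < W (s + n)%:R w - W s%:R w].
Proof. by apply/seteqP; split => w /=; rewrite walk_unit. Qed.

Let natD (s n : nat) : (s + n)%:R - s%:R = n%:R :> R.
Proof. by rewrite natrD addrAC subrr add0r. Qed.

Lemma pr_walk_gt s n a : (0 < n)%N -> 0 <= a ->
  pr P [set w | a < S s n w] <= expR (2^-1 - a / Num.sqrt n%:R).
Proof.
move=> n0 a0; rewrite walk_gtE -(natD s n); apply: pr_incr_gt => //.
by rewrite ltr_nat -[X in (X < _)%N]addn0 ltn_add2l.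
Qed.

Lemma pr_max_gt s n a : (0 < n)%N -> 0 <= a ->
  1 - pr P (survives unit_incr (fun=> a) s n) <=
  2 * expR (2^-1 - a / Num.sqrt n%:R).
Proof.
move=> n0 a0; apply: le_trans (pr_max_le unit_incr_indep walk_half _ _ _) _.
by rewrite ler_pM2l// pr_walk_gt.
Qed.

Lemma pr_max_le_ge s n a : (0 < n)%N -> 0 <= a <= Num.sqrt n%:R ->
  a / Num.sqrt n%:R / 3 <= pr P (survives unit_incr (fun=> a) s n).
Proof.
move=> n0 a0; rewrite -(natD s n) in a0 *.
have ss : s%:R < (s + n)%:R :> R.
  by rewrite ltr_nat -[X in (X < _)%N]addn0 ltn_add2l.
have := pr_incr_gt_compl hW (ler0n _ s) ss a0.
have := pr_max_le unit_incr_indep walk_half s n a.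
rewrite walk_gtE; lra.
Qed.

Lemma pr_walk_le0 s n : (0 < n)%N -> 2^-1 <= pr P [set w | S s n w <= 0].
Proof.
move=> n0; have ss : s%:R < (s + n)%:R :> R.
  by rewrite ltr_nat -[X in (X < _)%N]addn0 ltn_add2l.
rewrite (_ : mkset _ = ~` [set w | 0 < S s n w]); last first.
  by apply/seteqP; split => w /=; rewrite leNgt => /negP.
have m0 : measurable [set w | 0 < S s n w].
  have := measurable_walk_preimage unit_incr s n (measurable_itv `]0, +oo[).
  by congr measurable; apply/seteqP; split => w /=; rewrite in_itv/= andbT.
have m1 : measurable [set w | 0 <= - S s n w].
  have := measurable_walk_preimage unit_incr s n (measurable_itv `]-oo, 0]).
  by congr measurable; apply/seteqP; split => w /=; rewrite in_itv/= oppr_ge0.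
rewrite prC// walk_gtE pr_incr_gtE//.
have sq : 0 < Num.sqrt ((s + n)%:R - s%:R) :> R by rewrite sqrtr_gt0 subr_gt0.
have : fine (normal_prob 0 (Num.sqrt ((s + n)%:R - s%:R)) `]0, +oo[) <= 2^-1 :> R.
  rewrite -lee_fin fineK; last exact: fin_num_measure.
  rewrite -(normal_prob_half sq); apply: le_measure; rewrite ?inE//.
  by move=> x /=; rewrite !in_itv/= !andbT => /ltW.
lra.
Qed.

Lemma barrier_width_survival zeta b s : 2^-1 < zeta < 1 -> 1 <= b ->
  4^-1 <= pr P (survives unit_incr (barrier zeta (barrier_const zeta) b) s
                         (width b) `&` [set w | S s (width b) w <= 0]).
Proof.
move=> /andP[z0 z1] b1; set K := barrier_const zeta.
have K1 : 1 <= K by exact: barrier_const_ge1.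
have K0 : 0 <= K by lra.
set f := barrier zeta K b; set w0 := width b.
have m2 : measurable [set w | S s w0 w <= 0].
  have := measurable_walk_preimage unit_incr s w0 (measurable_itv `]-oo, 0]).
  by congr measurable; apply/seteqP; split => w /=; rewrite in_itv/=.
(* An exit at some [k] with [2^j <= k < 2^(j+1)] forces the walk above [A j], which is at most the
   barrier at [k], within [2^(j+1)] steps. One maximal inequality per dyadic block therefore
   suffices. *)
pose A j : R := K * 2 ^+ j * decay zeta b (2 ^+ j).
have A0 j : 0 <= A j by apply: mulr_ge0; [apply: mulr_ge0 => //; exact: exprn_ge0|exact: decay_ge0].
have h1 : 1 - pr P (survives unit_incr f s w0) <= 4^-1.
  rewrite -prC; last exact: measurable_survives.
  apply: le_trans (sum_decay_tail z0 b1).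
  apply: (@le_trans _ _ (\sum_(j < (trunc_log 2 w0).+1)
      pr P (~` survives unit_incr (fun=> A j) s (2 ^ j.+1)))).
    apply: (@pr_le_sum _ _ _ _ _
        (fun j => ~` survives unit_incr (fun=> A j) s (2 ^ j.+1))).
    - exact/measurableC/measurable_survives.
    - by move=> j _; exact/measurableC/measurable_survives.
    move=> w /survivesPn[k kw [fk _]].
    have k0 : (0 < k)%N.
      by rewrite lt0n; apply: contraTneq fk => ->; rewrite walk0 -leNgt barrier_ge0.
    have kw' : (k <= w0)%N by rewrite -ltnS.
    have /andP[jk kj] := trunc_log_bounds (isT : (1 < 2)%N) k0.
    exists (trunc_log 2 k).
      by rewrite ltnS; exact: leq_trunc_log.
    move=> /= h; have := h k (ltnW kj); rewrite leNgt => /negP; apply.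
    apply: le_lt_trans fk; apply: le_trans (barrier_le zeta b K0 jk).
    rewrite /A -natrX; apply: barrier_ge => //; first lra.
    by rewrite expn_gt0/= (leq_trans jk).
  apply: ler_sum => j _; rewrite prC; last exact: measurable_survives.
  have -> : 2 * 2 ^+ j = (2 ^ j.+1)%:R :> R by rewrite natrX exprS.
  by apply: pr_max_gt (A0 j); rewrite expn_gt0.
have h2 := pr_walk_le0 s (isT : (0 < w0)%N).
have h3 : 1 - pr P (survives unit_incr f s w0 `&` [set w | S s w0 w <= 0]) <=
    (1 - pr P (survives unit_incr f s w0)) + (1 - pr P [set w | S s w0 w <= 0]).
  rewrite -!prC//; [|exact: measurable_survives|]; last first.
    by apply: measurableI => //; exact: measurable_survives.
  have := @pr_le_sum _ _ _ P 2 (fun i => if i == 0%N then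
     ~` survives unit_incr f s w0 else ~` [set w | S s w0 w <= 0])
     (~` (survives unit_incr f s w0 `&` [set w | S s w0 w <= 0])).
  rewrite !big_ord_recr/= big_ord0 add0r; apply.
  - by apply: measurableC; apply: measurableI => //; exact: measurable_survives.
  - by move=> k _; case: ifP => _; apply: measurableC => //; exact: measurable_survives.
  - by move=> w /not_andP[h|h]; [exists 0%N|exists 1%N].
lra.
Qed.

(** The 12 is 4 from the curved part times 3 from [pr_max_le_ge]. The second event runs over [N]
    steps after time [width b], longer than necessary, which keeps [sqrt N] in the bound. *)
Lemma barrier_survival zeta b s N : 2^-1 < zeta < 1 -> 1 <= b ->
  b <= Num.sqrt N%:R ->
  b / Num.sqrt N%:R / 12 <=
  pr P (survives unit_incr (barrier zeta (barrier_const zeta) b) s N).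
Proof.
move=> z b1 bN; have /andP[z0 z1] := z.
have K1 : 1 <= barrier_const zeta by exact: barrier_const_ge1.
have K0 : 0 <= barrier_const zeta by lra.
have N0 : (0 < N)%N.
  by case: N bN => // ; rewrite sqrtr0; lra.
have h1 := barrier_width_survival s z b1.
have bN' : 0 <= b <= Num.sqrt N%:R by rewrite bN andbT; lra.
have h2 := pr_max_le_ge (s + width b) N0 bN'.
set A := survives _ _ _ _ `&` _ in h1.
set B := survives _ _ _ _ in h2.
have sA : sig unit_incr `I_(s + width b) A.
  apply: sigI; first by apply: sig_survives => i /andP[].
  rewrite (_ : mkset _ = S s (width b) @^-1` `]-oo, 0]); last first.
    by apply/seteqP; split => w /=; rewrite in_itv.
  by apply: sig_walk => // i /andP[].
have sB : sig unit_incr [set i | (s + width b <= i)%N] B.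
  by apply: sig_survives => i /andP[].
apply: (@le_trans _ _ (pr P (A `&` B))).
  rewrite (pr_past_future unit_incr_indep sA sB).
  apply: (@le_trans _ _ (4^-1 * (b / Num.sqrt N%:R / 3))).
    by rewrite le_eqVlt; apply/orP; left; apply/eqP; field; rewrite gt_eqF// sqrtr_gt0 ltr0n.
  apply: ler_pM => //; rewrite !divr_ge0 ?sqrtr_ge0//; lra.
have mA := sig_measurable sA; have mB := sig_measurable sB.
apply: le_pr.
- exact: measurableI.
- exact: measurable_survives.
move=> w [[hA1 hA2] hB] k kN.
have [kw|kw] := leqP k (width b); first exact: hA1.
rewrite -(subnKC (ltnW kw)) walkD.
have := hB (k - width b)%N (leq_trans (leq_subr _ _) kN).
have /= h0 := hA2.
have := barrier_le zeta b K0 (ltnW kw).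
have := barrier_width K1 z b1.
rewrite subnKC ?(ltnW kw)//; lra.
Qed.

End integer_walk.

(** * Concatenating the attempts up to a success *)

Section success.
Context (R : realType) (d : measure_display) (Om : measurableType d)
  (P : probability Om R) (X : nat -> {RV P >-> R}).
Hypothesis indepX : forall n (A : nat -> set R), (forall i, measurable (A i)) ->
  (P (\bigcap_(i < n) (X i @^-1` A i)) = \prod_(i < n) P (X i @^-1` A i))%E.

Lemma prod_one_sub_le (q : nat -> R) L : (forall l, l \in L -> q l <= 1) ->
  0 <= \prod_(l <- L) (1 - q l) <= expR (- \sum_(l <- L) q l).
Proof.
elim: L => [|l L IH] hq; first by rewrite !big_nil oppr0 expR0 lexx ler01.
have /andP[h0 h1] : 0 <= \prod_(l <- L) (1 - q l) <= expR (- \sum_(l <- L) q l).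
  by apply: IH => i iL; apply: hq; rewrite inE iL orbT.
have hl : 0 <= 1 - q l by rewrite subr_ge0 hq// inE eqxx.
rewrite !big_cons opprD expRD mulr_ge0//=; apply: ler_pM => //.
by have := expR_ge1Dx (- q l); lra.
Qed.

Lemma ae_some_success (F : nat -> nat -> R) (N : nat -> nat) (q : nat -> R)
    (L : nat -> seq nat) :
  (forall n l s, l \in L n -> q l <= pr P (survives X (F l) s (N l))) ->
  (forall M, exists n, M <= \sum_(l <- L n) q l) ->
  {ae P, forall w, exists n, ~ all_fail X F N 0 (L n) w}.
Proof.
move=> hq hsum.
have mf n : measurable (all_fail X F N 0 (L n)).
  by apply: sig_measurable; exact: sig_all_fail.
exists (\bigcap_n all_fail X F N 0 (L n)); split.
- by apply: bigcap_measurableType => n _; exact: mf.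
- have mI : measurable (\bigcap_n all_fail X F N 0 (L n)).
    by apply: bigcap_measurableType => n _; exact: mf.
  have {}hle M : pr P (\bigcap_n all_fail X F N 0 (L n)) <= expR (- M).
    have [n hn] := hsum M.
    apply: (@le_trans _ _ (pr P (all_fail X F N 0 (L n)))).
      by apply: le_pr => // w h; exact: h.
    apply: le_trans (pr_all_fail (q := q) indepX _ _) _.
      by move=> l s lL; exact: hq lL.
    have /andP[_ h] : 0 <= \prod_(l <- L n) (1 - q l) <= expR (- \sum_(l <- L n) q l).
      apply: prod_one_sub_le => l lL; apply: le_trans (hq n l 0%N lL) _.
      by apply: pr_le1; exact: measurable_survives.
    by apply: le_trans h _; rewrite ler_expR lerN2.
  rewrite prE//; congr EFin; apply/eqP; rewrite eq_le pr_ge0 andbT.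
  apply/ler_addgt0Pl => e e0; rewrite addr0.
  by have := hle (- ln e); rewrite opprK lnK.
- move=> w /= h n _ /=; apply: contrapT => nf; apply: h; by exists n.
Qed.

(** [v] lists the slopes of each failed barrier up to its exit, then those of the surviving barrier
    [i]. At an exit the walk overshoots by at most its last increment, so the failures in [L1]
    contribute [size L1] times [q]. The cost [phi] is abstract because it will be [psi] at twice the
    slope. *)
Lemma success_path (sl : nat -> nat -> R) (N : nat -> nat) (phi : R -> R)
    (c : nat -> R) (B : R) w L s :
  (forall l j, 0 <= sl l j <= B) -> (forall x, 0 <= phi x) ->
  (forall l n, l \in L -> \sum_(j < n) phi (sl l j) <= c l) ->
  ~ all_fail X (fun l k => \sum_(j < k) sl l j) N s L w ->
  exists L1 i L2 (v : nat -> R), [/\ L = L1 ++ i :: L2,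
    forall j, 0 <= v j <= B,
    forall n, (n <= N i)%N ->
      \sum_(j < n) phi (v j) <= \sum_(l <- rcons L1 i) c l &
    forall q k, 0 <= q -> (k <= N i)%N ->
      (forall j, (j < s + k)%N -> X j w <= q) ->
      walk X s k w <= \sum_(j < k) v j + (size L1)%:R * q].
Proof.
move=> slB phi0; have sl0 l j : 0 <= sl l j by case/andP: (slB l j).
elim: L s => [|l L IH] s hc; first by move=> /= /(_ I).
move=> /= nf.
have [sv|] := pselect (survives X (fun k => \sum_(j < k) sl l j) s (N l) w).
  exists [::], l, L, (sl l); split => //.
  - by move=> n _ /=; rewrite big_seq1; apply: hc; rewrite inE eqxx.
  - by move=> q k q0 kN _; rewrite mul0r addr0; exact: sv.
move=> /survivesPn[k kN exk].
have nf' : ~ all_fail X (fun l k => \sum_(j < k) sl l j) N (s + k) L w.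
  by move=> h; apply: nf; exists k.
have hc' l' n : l' \in L -> \sum_(j < n) phi (sl l' j) <= c l'.
  by move=> l'L; apply: hc; rewrite inE l'L orbT.
have [L1 [i [L2 [v [-> vB hphi hw]]]]] := IH _ hc' nf'.
have v0 j : 0 <= v j by case/andP: (vB j).
have c0 : 0 <= c l.
  by have := hc l 0%N; rewrite big_ord0; apply; rewrite inE eqxx.
pose u j := if (j < k)%N then sl l j else v (j - k)%N.
have sumu (g : R -> R) n : \sum_(j < k + n) g (u j) =
    \sum_(j < k) g (sl l j) + \sum_(j < n) g (v j).
  rewrite big_split_ord/=; congr (_ + _); apply: eq_bigr => j _.
    by rewrite /u ltn_ord.
  by rewrite /u ltnNge leq_addr/= addKn.
have sumu' (g : R -> R) n : (n <= k)%N -> \sum_(j < n) g (u j) =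
    \sum_(j < n) g (sl l j).
  by move=> nk; apply: eq_bigr => j _; rewrite /u (leq_trans (ltn_ord j) nk).
(* Walk and barrier both start at 0, so an exit takes at least one step and there is a last
   increment. *)
have hk0 : (0 < k)%N.
  rewrite lt0n; apply/eqP => k0; case: exk => + _.
  by rewrite k0 walk0 big_ord0 ltxx.
exists (l :: L1), i, L2, u; split => //.
- by move=> j; rewrite /u; case: ifP.
- move=> n nN; rewrite rcons_cons big_cons.
  have [nk|/ltnW nk] := leqP n k.
    rewrite sumu'// -[leLHS]addr0; apply: lerD.
      by apply: hc; rewrite inE eqxx.
    by have := hphi 0%N (leq0n _); rewrite big_ord0.
  rewrite -(subnKC nk) sumu; apply: lerD.
    by apply: hc; rewrite inE eqxx.
  by apply: hphi; exact: leq_trans (leq_subr _ _) nN.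
- move=> q n q0 nN hX; case: exk => [_ exk].
  have [nk|nk] := ltnP n k.
    apply: le_trans (exk n nk) _.
    by rewrite (sumu' id) ?(ltnW nk)// lerDl mulr_ge0.
  rewrite -(subnKC nk) walkD (sumu id) /= -natr1 mulrDl mul1r.
  have h1 : walk X (s + k) (n - k) w <=
      \sum_(j < n - k) v j + (size L1)%:R * q.
    apply: hw => //; first exact: leq_trans (leq_subr _ _) nN.
    by move=> j; rewrite -addnA subnKC//; exact: hX.
  have h2 : walk X s k w <= \sum_(j < k) sl l j + q.
    have := exk k.-1; rewrite prednK// leqnn => /(_ isT) hp.
    rewrite -(prednK hk0) -addn1 walkD /walk [X in _ + X <= _]big_ord1 addn0.
    apply: lerD.
      apply: le_trans hp _.
      by rewrite addn1 big_ord_recr/= lerDl.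
    by apply: hX; rewrite ltn_add2l prednK.
  lra.
Qed.

End success.

(** * Path regularity *)

Section path_bounds.
Context (R : realType) (d : measure_display) (Om : measurableType d)
  (P : probability Om R) (W : R -> {RV P >-> R}).
Hypothesis hW : wiener_process W.

Let grid (u : R) (m : nat) (j : nat) : R := u + j%:R / 2 ^+ m.

Let gridS u m j : grid u m.+1 j.*2 = grid u m j.
Proof.
by rewrite /grid exprS -muln2 natrM; congr (_ + _); field; rewrite expf_neq0.
Qed.

Let grid_homo u m : {homo grid u m : i j / (i <= j)%N >-> i <= j}.
Proof.
move=> i j ij; rewrite lerD2l ler_pM2r ?invr_gt0 ?exprn_gt0//.
by rewrite ler_nat.
Qed.

Let grid0 u m : grid u m 0 = u.
Proof. by rewrite /grid mul0r addr0. Qed.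

Let overshoot u m x : set Om := ~` survives (incr W (grid u m)) (fun=> x) 0 (2 ^ m).

Let measurable_overshoot u m x : measurable (overshoot u m x).
Proof. exact/measurableC/measurable_survives. Qed.

(** The last grid point is [u + 1] whatever the mesh, so the bound does not depend on [m] and passes
    to the increasing union over all meshes. *)
Let pr_overshoot u m x : 0 <= u -> 0 <= x ->
  pr P (overshoot u m x) <= 2 * expR (2^-1 - x).
Proof.
move=> u0 x0; rewrite prC; last exact: measurable_survives.
have hi := incr_indep hW (t := grid u m) _ (@grid_homo u m).
rewrite grid0 in hi.
have hh s k : 2^-1 <= pr P [set w | 0 <= walk (incr W (grid u m)) s k w].
  rewrite (_ : mkset _ = [set w | 0 <= W (grid u m (s + k)) w - W (grid u m s) w]).
    apply: pr_incr_ge0 => //.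
    - by rewrite addr_ge0// divr_ge0// exprn_ge0.
    - by apply: grid_homo; exact: leq_addr.
  by apply/seteqP; split => w /=; rewrite walk_incr.
apply: le_trans (pr_max_le (hi u0) hh _ _ _) _.
rewrite ler_pM2l//.
rewrite (_ : mkset _ = [set w | x < W (u + 1) w - W u w]).
  apply: le_trans (pr_incr_gt hW u0 _ x0) _.
    by rewrite ltrDl.
  by rewrite addrAC subrr add0r sqrtr1 divr1.
apply/seteqP; split => w /=; rewrite walk_incr add0n grid0 /grid natrX divff//;
  by rewrite expf_neq0.
Qed.

Let overshootS u m x : overshoot u m x `<=` overshoot u m.+1 x.
Proof.
move=> w /survivesPn[k kn [fk _]] h; move: fk; rewrite ltNge => /negP; apply.
have := h k.*2; rewrite expnS mul2n leq_double -ltnS => /(_ kn).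
by rewrite !walk_incr !add0n !grid0 gridS.
Qed.

Let oversteps u x : set Om := \bigcup_m overshoot u m x.

Let measurable_oversteps u x : measurable (oversteps u x).
Proof. by apply: bigcupT_measurable => m; exact: measurable_overshoot. Qed.

Let pr_oversteps u x : 0 <= u -> 0 <= x ->
  pr P (oversteps u x) <= 2 * expR (2^-1 - x).
Proof.
move=> u0 x0; rewrite -lee_fin -prE//.
have h : P (overshoot u m x) @[m --> \oo] --> P (oversteps u x).
  apply: nondecreasing_cvg_mu => [m||].
  - exact: measurable_overshoot.
  - exact: measurable_oversteps.
  - apply/nondecreasing_seqP => m; apply/subsetPset; exact: overshootS.
rewrite -(cvg_lim _ h)//; apply: lime_le; first by apply/cvg_ex; exists (P (oversteps u x)).
apply: nearW => m; rewrite prE; last exact: measurable_overshoot.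
by rewrite lee_fin pr_overshoot.
Qed.

(** Borel-Cantelli: each of the [4^(i+3)] unit intervals is bad with probability at most
    [2 exp(1/2 - 4 i)], and [exp 4 >= 16] makes the total [O(4^-i)]. The range [4^(i+3)] covers the
    number of steps of an attempt at scale [i]. *)
Lemma dyadic_oscillation : {ae P, forall w, exists i0, forall i, (i0 <= i)%N ->
  forall k m j, (k < 4 ^ (i + 3))%N -> (j <= 2 ^ m)%N ->
  W (k%:R + j%:R / 2 ^+ m) w <= W k%:R w + (4 * i)%:R}.
Proof.
pose B i := \bigcup_(k in `I_(4 ^ (i + 3))) oversteps k%:R (4 * i)%:R.
have mB i : measurable (B i).
  by apply: bigcup_measurable => k _; exact: measurable_oversteps.
have pB i : pr P (B i) <= 256 / 2 ^+ i.
  apply: (@le_trans _ _ (\sum_(k < 4 ^ (i + 3)) pr P (oversteps k%:R (4 * i)%:R))).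
    apply: (@pr_le_sum _ _ _ _ _ (fun k => oversteps k%:R (4 * i)%:R)).
    - exact: mB.
    - by move=> k _; exact: measurable_oversteps.
    - by move=> w [k /= h1 h2]; exists k.
  apply: (@le_trans _ _ (\sum_(k < 4 ^ (i + 3)) 2 * expR (2^-1 - (4 * i)%:R))).
    by apply: ler_sum => k _; apply: pr_oversteps.
  rewrite sumr_const card_ord -[leLHS]mulr_natr natrX exprD expRD expRN natrM expRM_natr.
  have e4 : 16 <= expR 4 :> R.
    have e1 : 2 <= expR 1 :> R by have := expR_ge1Dx (1 : R); lra.
    have -> : 4 = 1 * 4 :> R by rewrite mul1r.
    rewrite (expRM_natr 4 1); apply: (@le_trans _ _ (2 ^+ 4)); last first.
      by rewrite ler_pXn2r ?nnegrE ?expR_ge0.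
    lra.
  have h2 := @expR_half_le2 R.
  have e16 : (expR 4 ^+ i)^-1 <= (16 ^+ i)^-1 :> R.
    rewrite lef_pV2 ?posrE ?exprn_gt0 ?expR_gt0//.
    by rewrite lerXn2r// ?nnegrE ?expR_ge0.
  apply: (@le_trans _ _ (2 * (2 * (16 ^+ i)^-1) * (4 ^+ i * 4 ^+ 3))).
    apply: ler_wpM2r; first by rewrite mulr_ge0// exprn_ge0.
    apply: ler_wpM2l => //; apply: ler_pM => //; rewrite ?expR_ge0//.
  have -> : (16 : R) ^+ i = 2 ^+ i * 2 ^+ i * 4 ^+ i.
    by rewrite -!exprMn; congr (_ ^+ _); ring.
  have p2 : 1 <= (2 : R) ^+ i by rewrite exprn_ege1// ler1n.
  have -> : 2 * (2 * (2 ^+ i * 2 ^+ i * 4 ^+ i)^-1) * (4 ^+ i * 4 ^+ 3) =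
      256 / 2 ^+ i * (2 ^+ i)^-1 :> R.
    by field; rewrite !expf_neq0.
  by rewrite ler_piMr ?divr_ge0 ?exprn_ge0// invf_le1// (lt_le_trans _ p2).
apply: filterS (borel_cantelli mB pB) => w [i0 hi]; exists i0 => i ii k m j ki jm.
have := hi i ii; apply: contra_notP => /negP; rewrite -ltNge => h.
exists k => //; exists m => // sv; have := sv j jm.
by rewrite walk_incr add0n grid0 /grid; lra.
Qed.

(** By continuity a value above the bound would persist near [t], hence at a dyadic point slightly
    to the left of [t]. *)
Lemma path_oscillation : {ae P, forall w, exists i0, forall i, (i0 <= i)%N ->
  forall k t, (k < 4 ^ (i + 3))%N -> k%:R <= t <= k.+1%:R ->
  W t w <= W k%:R w + (4 * i)%:R}.
Proof.
apply: filterS2 (wiener_continuous hW) dyadic_oscillation => w cW [i0 hi].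
exists i0 => i ii k t ki /andP[kt tk].
have [->|tk'] := eqVneq t k%:R; first by rewrite lerDl.
have t0 : 0 < t by rewrite (le_lt_trans (ler0n _ k))// lt_neqAle eq_sym tk'.
rewrite leNgt; apply/negP => hlt.
have /continuous_within_itvcyP[cW' _] := cW.
have ct : {for t, continuous (fun t => W t w)}.
  by apply: cW'; rewrite in_itv/= t0.
have nt : nbhs t (fun x => W k%:R w + (4 * i)%:R < W x w).
  exact: (cvgr_gt _ ct _ hlt).
have [e /= e0 he] := (nbhs_ballP _ _).1 nt.
have [m hm] : exists m, (2 ^+ m)^-1 < e.
  have [m hm] := ltr_add_invr e0.
  exists m; apply: le_lt_trans hm; rewrite add0r lef_pV2 ?posrE ?exprn_gt0//.
  by rewrite -natrX ler_nat ltn_expl.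
pose j := Num.truncn ((t - k%:R) * 2 ^+ m).
have p0 : (0 : R) < 2 ^+ m by rewrite exprn_gt0.
have ge0 : 0 <= (t - k%:R) * 2 ^+ m by rewrite mulr_ge0 ?subr_ge0// ltW.
have /andP[j1 j2] := truncn_itv ge0; rewrite -/j in j1 j2.
have jm : (j <= 2 ^ m)%N.
  rewrite -(ler_nat R) natrX (le_trans j1)// ler_piMl ?(ltW p0)//.
  by rewrite -natr1 in tk; lra.
have := hi i ii k m j ki jm; rewrite leNgt => /negP; apply.
apply: he; rewrite /ball/= /ball_/=.
have h1 : j%:R / 2 ^+ m <= t - k%:R by rewrite ler_pdivrMr.
have h2 : t - k%:R < j%:R / 2 ^+ m + (2 ^+ m)^-1.
  rewrite (_ : _ + _^-1 = j.+1%:R / 2 ^+ m); last by rewrite -[j.+1]addn1 natrD mulrDl mul1r.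
  by rewrite ltr_pdivlMr.
rewrite ger0_norm; lra.
Qed.

(** The maximum over [2^j] steps exceeds [2^j / 2] with probability [O(2^-j)]. This crude bound
    serves at early times, when the initial stretch has not yet gained enough to pay for the
    overshoots. *)
Lemma path_linear_growth : {ae P, forall w, exists2 C, 0 <= C & forall k,
  walk (unit_incr W) 0 k w <= C + k%:R}.
Proof.
pose B j := ~` survives (unit_incr W) (fun=> 2 ^+ j / 2) 0 (2 ^ j).
have mB j : measurable (B j) by exact/measurableC/measurable_survives.
have pB j : pr P (B j) <= 64 / 2 ^+ j.
  rewrite prC; last exact: measurable_survives.
  have p0 : (0 : R) < 2 ^+ j by rewrite exprn_gt0.
  apply: le_trans (pr_max_gt hW _ _ _) _.
  - by rewrite expn_gt0.
  - by rewrite divr_ge0// ltW.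
  have s0 : 0 < Num.sqrt (2 ^ j)%:R :> R by rewrite sqrtr_gt0 ltr0n expn_gt0.
  apply: (@le_trans _ _ (2 * (8 / (2 ^+ j / 2 / Num.sqrt (2 ^ j)%:R) ^+ 2))).
    rewrite ler_pM2l//; apply: expR_half_sub_le.
    by rewrite !divr_gt0.
  rewrite expr_div_n sqr_sqrtr// natrX.
  by rewrite le_eqVlt; apply/orP; left; apply/eqP; field; rewrite gt_eqF.
apply: filterS (borel_cantelli mB pB) => w [j0 hj]; exists (2 ^+ j0).
  by rewrite exprn_ge0.
move=> k.
have sv j : (j0 <= j)%N -> forall i, (i <= 2 ^ j)%N ->
    walk (unit_incr W) 0 i w <= 2 ^+ j / 2.
  by move=> /hj /contrapT h i; exact: h.
have [kj|kj] := leqP k (2 ^ j0).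
  apply: le_trans (sv j0 (leqnn _) k kj) _.
  have : (0 : R) < 2 ^+ j0 by rewrite exprn_gt0.
  have : (0 : R) <= k%:R by [].
  lra.
have k0 : (0 < k)%N by exact: leq_ltn_trans kj.
have /andP[h1 h2] := trunc_log_bounds (isT : (1 < 2)%N) k0.
have jl : (j0 <= (trunc_log 2 k).+1)%N.
  by apply: leqW; apply: trunc_log_max => //; exact: ltnW.
apply: le_trans (sv _ jl k (ltnW h2)) _.
rewrite exprS mulrAC divff// mul1r -natrX.
have : (2 ^ trunc_log 2 k)%:R <= k%:R :> R by rewrite ler_nat.
have : (0 : R) < 2 ^+ j0 by rewrite exprn_gt0.
lra.
Qed.

End path_bounds.

(** * The cost of a barrier *)

Lemma near_right0 (R : realType) (Q : R -> Prop) : (\forall x \near 0^'+, Q x) ->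
  exists2 e : R, 0 < e & forall x, 0 < x < e -> Q x.
Proof.
move=> nQ.
have [e /= e0 he] := (nbhs_ballP _ _).1 (nQ : nbhs (0 : R) (fun x => 0 < x -> Q x)).
exists e => // x /andP[x0 xe]; apply: he => //.
by rewrite /ball/= sub0r normrN gtr0_norm.
Qed.

Section cost_function.
Context (R : realType) (psi theta : R -> R) (kappa : R).
Hypothesis psi_ge0 : forall u, 0 <= psi u.
Hypothesis psi_convex : convex_function [set: R^o] psi.
Hypothesis kappa_range : 1 <= kappa < 2.
Hypothesis psi_pos : forall u, 0 < u -> psi u = u `^ kappa * theta u.
Hypothesis theta_sv : slowly_varying_at0 theta.

Lemma psi_conv t x y : 0 <= t <= 1 ->
  psi (t * x + (1 - t) * y) <= t * psi x + (1 - t) * psi y.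
Proof.
move=> /andP[t0 t1].
have := psi_convex (Itv01 t0 t1) (x := x) (y := y).
by rewrite !inE => /(_ I I).
Qed.

Lemma theta_gt0_near : exists2 a : R, 0 < a & forall x, 0 < x <= a -> 0 < theta x.
Proof. by have [[a a0 [_ h]] _] := theta_sv; exists a. Qed.

Lemma theta_ratio_near l (e : R) : 0 < l -> 0 < e -> exists2 a : R, 0 < a &
  forall x, 0 < x < a -> `|theta (l * x) - theta x| <= e * theta x.
Proof.
move=> l0 e0; have [a a0 ha] := theta_gt0_near.
have [_ /(_ l l0) hl] := theta_sv.
have /cvgrPdist_le /(_ e e0) /near_right0[b b0 hb] := hl.
exists (Num.min a b); first by rewrite lt_min a0.
move=> x /andP[x0]; rewrite lt_min => /andP[xa xb].
have tx : 0 < theta x by apply: ha; rewrite x0 ltW.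
have := hb x; rewrite x0 xb => /(_ isT).
rewrite distrC (_ : _ / _ - 1 = (theta (l * x) - theta x) / theta x); last first.
  by field; rewrite gt_eqF.
by rewrite normrM normfV (gtr0_norm tx) ler_pdivrMr.
Qed.

(** As [kappa >= 1] the power contributes a factor at most 1/2, and slow variation at most 3/2. The
    product 3/4 drives [psi] to 0 along repeated halving. *)
Lemma psi_halving : exists2 a : R, 0 < a &
  forall x, 0 < x < a -> psi (2^-1 * x) <= 3 / 4 * psi x.
Proof.
have [a a0 ha] := @theta_ratio_near 2^-1 2^-1 ltac:(lra) ltac:(lra).
have [b b0 hb] := theta_gt0_near.
exists (Num.min a b); first by rewrite lt_min a0.
move=> x /andP[x0]; rewrite lt_min => /andP[xa xb].
have tx : 0 < theta x by apply: hb; rewrite x0 ltW.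
have h := ha x; rewrite x0 xa in h; have {}h := h isT.
have {}h : theta (2^-1 * x) <= 3 / 2 * theta x.
  have := ler_norm (theta (2^-1 * x) - theta x); lra.
rewrite !psi_pos//; last by rewrite mulr_gt0.
rewrite powRM ?(ltW x0)//.
have k1 : (2^-1 : R) `^ kappa <= 2^-1.
  have /andP[k1 _] := kappa_range.
  by apply: ge1r_powR => //; lra.
have xk : 0 <= x `^ kappa by exact: powR_ge0.
have -> : 3 / 4 * (x `^ kappa * theta x) = 2^-1 * x `^ kappa * (3 / 2 * theta x) by field.
apply: (@le_trans _ _ (2^-1 `^ kappa * x `^ kappa * (3 / 2 * theta x))).
  by apply: ler_wpM2l => //; rewrite mulr_ge0// powR_ge0.
by rewrite ler_wpM2r//; [rewrite mulr_ge0// ltW|exact: ler_wpM2r].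
Qed.

Lemma psi_small (e : R) : 0 < e -> exists u, [/\ 0 < u, u < e & psi u < e].
Proof.
move=> e0; have [a a0 ha] := psi_halving.
pose u0 := Num.min a e / 2.
have u00 : 0 < u0 by rewrite divr_gt0// lt_min a0.
have u0a : u0 < a.
  have : Num.min a e <= a by rewrite ge_min lexx.
  rewrite /u0; lra.
have u0e : u0 < e.
  have : Num.min a e <= e by rewrite ge_min lexx orbT.
  rewrite /u0; lra.
have hn n : psi (2^-1 ^+ n * u0) <= (3 / 4) ^+ n * psi u0.
  elim: n => [|n IH]; first by rewrite !expr0 !mul1r.
  rewrite !exprS -[_ * _ * u0]mulrA -[leRHS]mulrA; apply: le_trans (ha _ _) _.
    rewrite mulr_gt0 ?exprn_gt0//=; apply: le_lt_trans u0a.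
    by rewrite ler_piMl ?(ltW u00)// exprn_ile1//; lra.
  by rewrite ler_pM2l//; lra.
have c0 : geometric (psi u0) (3 / 4) n @[n --> \oo] --> (0 : R).
  by apply: cvg_geometric; rewrite ger0_norm; lra.
have [n _ hN] : \forall n \near \oo, geometric (psi u0) (3 / 4) n < e.
  exact: (cvgr_lt _ c0).
exists (2^-1 ^+ n * u0); split.
- by rewrite mulr_gt0 ?exprn_gt0.
- by apply: le_lt_trans u0e; rewrite ler_piMl ?(ltW u00)// exprn_ile1//; lra.
- by apply: le_lt_trans (hn n) _; have := hN n (leqnn n); rewrite /geometric/= mulrC.
Qed.

(** The formula for [psi] says nothing at 0. But 0 is a convex combination of -1 and a small
    [u > 0], with weight [u / (1 + u)] on -1, so [psi 0 <= u psi(-1) + psi u], which can be made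
    arbitrarily small. *)
Lemma psi0 : psi 0 = 0.
Proof.
apply/eqP; rewrite eq_le psi_ge0 andbT; apply/ler_addgt0Pl => e e0; rewrite addr0.
pose c := 1 + psi (-1).
have c1 : 1 <= c by rewrite lerDl.
have [u [u0 ue pu]] := @psi_small (e / c / 2) ltac:(by rewrite !divr_gt0//; lra).
pose t := u / (1 + u).
have t01 : 0 <= t <= 1 by rewrite /t divr_ge0 ?ler_pdivrMr//; lra.
have := psi_conv (-1) u t01.
have -> : t * -1 + (1 - t) * u = 0 by rewrite /t; field; lra.
have tu : t <= u by rewrite /t ler_pdivrMr; [rewrite ler_peMr//; lra|lra].
move=> h; apply: le_trans h _.
have h1 : t * psi (-1) <= u * psi (-1) by exact: ler_wpM2r.
have h2 : (1 - t) * psi u <= psi u by rewrite ler_piMl//; case/andP: t01; lra.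
have h3 : u * psi (-1) + psi u <= e / c / 2 * c.
  rewrite /c mulrDr mulr1 addrC; apply: lerD; first exact: ltW.
  by apply: ler_wpM2r => //; exact: ltW.
have -> : e = e / c / 2 * c * 2 by field; lra.
have : 0 <= e / c / 2 * c by rewrite !mulr_ge0// ?invr_ge0; lra.
lra.
Qed.

Lemma psi_star u v : 0 < u -> u <= v -> psi u <= u / v * psi v.
Proof.
move=> u0 uv; have v0 : 0 < v by exact: lt_le_trans uv.
have t01 : 0 <= u / v <= 1 by rewrite divr_ge0 ?ler_pdivrMr ?mul1r//; lra.
have := psi_conv v 0 t01.
by rewrite psi0 !mulr0 !addr0 divfK// gt_eqF.
Qed.

Lemma psi_nd u v : 0 <= u -> u <= v -> psi u <= psi v.
Proof.
rewrite le_eqVlt => /predU1P[<- _|u0 uv]; first by rewrite psi0.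
apply: le_trans (psi_star u0 uv) _.
have v0 : 0 < v by exact: lt_le_trans uv.
by rewrite ler_piMl// ler_pdivrMr ?mul1r.
Qed.

Lemma psi_gt0 u : 0 < u -> 0 < psi u.
Proof.
move=> u0; have [a a0 ha] := theta_gt0_near.
have m0 : 0 < Num.min a u by rewrite lt_min a0.
apply: (@lt_le_trans _ _ (psi (Num.min a u))).
  by rewrite psi_pos// mulr_gt0 ?powR_gt0// ha// m0 ge_min lexx.
by apply: psi_nd; [exact: ltW|rewrite ge_min lexx orbT].
Qed.

Lemma psi_add x y : 0 <= x -> 0 <= y -> psi (x + y) <= psi (2 * x) + psi (2 * y).
Proof.
move=> x0 y0; case: (leP x y) => xy.
  apply: (@le_trans _ _ (psi (2 * y))); last by rewrite lerDr.
  by apply: psi_nd; lra.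
apply: (@le_trans _ _ (psi (2 * x))); last by rewrite lerDl.
by apply: psi_nd; lra.
Qed.

Lemma psi_doubling kp : kappa < kp -> exists2 a : R, 0 < a &
  forall x, 0 < x < a -> psi (2 * x) <= 2 `^ kp * psi x.
Proof.
move=> kkp; pose e : R := 2 `^ (kp - kappa) - 1.
have e0 : 0 < e by rewrite subr_gt0 powR2_gt1// subr_gt0.
have [a a0 ha] := @theta_ratio_near 2 e ltac:(lra) e0.
exists a => // x /andP[x0 xa].
have h := ha x; rewrite x0 xa in h; have {}h := h isT.
have {}h : theta (2 * x) <= 2 `^ (kp - kappa) * theta x.
  have := ler_norm (theta (2 * x) - theta x); move: h; rewrite /e; lra.
rewrite !psi_pos//; last by rewrite mulr_gt0.
rewrite powRM ?(ltW x0)//.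
have -> : 2 `^ kp = 2 `^ kappa * 2 `^ (kp - kappa) :> R.
  by rewrite -powRD ?(pnatr_eq0 _ 2)//; [congr powR; ring|apply/implyP].
rewrite -mulrA [leRHS](_ : _ =
  2 `^ kappa * (x `^ kappa * (2 `^ (kp - kappa) * theta x))); last by ring.
by rewrite !ler_pM2l ?powR_gt0.
Qed.

(** Near 0 the doubling bound is iterated, with one extra factor [2^kp] for the last incomplete
    doubling. Values of [v] up to [U] are compared with [a'] by monotonicity, at the price of the
    factor [rho]. *)
Lemma psi_potter kp U : kappa < kp -> exists2 C, 0 < C &
  forall u v, 0 < u -> u <= v -> v <= U -> psi v <= C * (v / u) `^ kp * psi u.
Proof.
move=> kkp; have [a a0 ha] := psi_doubling kkp.
have kp0 : 0 < kp by have /andP[k1 _] := kappa_range; lra.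
have q1 : 1 <= 2 `^ kp :> R by exact/ltW/powR2_gt1.
have vu1 u v : 0 < u -> u <= v -> 1 <= (v / u) `^ kp.
  move=> u0 uv; apply: (@le_trans _ _ (1 `^ kp)); first by rewrite powR1.
  apply: ge0_ler_powR; rewrite ?nnegrE ?(ltW kp0)//.
    by rewrite divr_ge0; lra.
  by rewrite ler_pdivlMr// mul1r.
have main n u v : 0 < u -> u <= v -> v < a -> v < 2 ^+ n * u ->
    psi v <= 2 `^ kp * (v / u) `^ kp * psi u.
  elim: n u => [|n IH] u u0 uv va; first by rewrite expr0 mul1r; lra.
  move=> vn; have [vu|uv2] := leP v (2 * u).
    apply: le_trans (psi_nd _ vu) _; first by lra.
    apply: le_trans (ha u _) _; first by rewrite u0/=; lra.
    apply: ler_wpM2r => //; rewrite ler_peMr ?vu1//; lra.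
  apply: le_trans (IH (2 * u) _ _ _ _) _; try lra.
    by rewrite mulrA -exprSr.
  have h := ha u; rewrite u0 (le_lt_trans uv va) in h; have {}h := h isT.
  have -> : 2 `^ kp * (v / u) `^ kp * psi u =
      2 `^ kp * (v / (2 * u)) `^ kp * (2 `^ kp * psi u).
    have -> : v / u = v / (2 * u) * 2 by field; lra.
    rewrite (powRM kp _ (_ : 0 <= 2)) ?divr_ge0//; last lra.
      by ring.
    lra.
  by apply: ler_wpM2l => //; rewrite mulr_ge0 ?powR_ge0.
pose a' := a / 2; have a'0 : 0 < a' by rewrite /a'; lra.
have small u v : 0 < u -> u <= v -> v <= a' -> psi v <= 2 `^ kp * (v / u) `^ kp * psi u.
  move=> u0 uv va; pose n := Num.truncn (v / u).
  apply: (main n.+1) => //; first by rewrite /a' in va; lra.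
  rewrite -ltr_pdivrMr//; apply: lt_le_trans (truncnS_gt _) _.
  by rewrite -natrX ler_nat ltnW// ltn_expl.
have pa : 0 < psi a' by exact: psi_gt0.
pose rho := psi (a' + `|U|) / psi a'.
have rho1 : 1 <= rho.
  by rewrite ler_pdivlMr// mul1r; apply: psi_nd; rewrite ?lerDl// ltW.
have big v : 0 < v -> v <= U -> psi v <= rho * psi a'.
  move=> v0 vU; rewrite divfK ?gt_eqF//; apply: psi_nd; first exact: ltW.
  by have := ler_norm U; lra.
exists (2 `^ kp * rho); first by rewrite mulr_gt0 ?powR_gt0//; lra.
move=> u v u0 uv vU; have v0 : 0 < v by lra.
have vp := vu1 u v u0 uv.
have [va|av] := leP v a'.
  apply: le_trans (small u v u0 uv va) _.
  apply: ler_wpM2r => //; apply: ler_wpM2r; first exact: powR_ge0.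
  by rewrite ler_peMr//; lra.
apply: le_trans (big v v0 vU) _.
have [ua|au] := leP u a'.
  apply: (@le_trans _ _ (rho * (2 `^ kp * (v / u) `^ kp * psi u))); last first.
    by rewrite le_eqVlt; apply/orP; left; apply/eqP; ring.
  rewrite ler_pM2l; last lra.
  apply: le_trans (small u a' u0 ua (lexx _)) _.
  apply: ler_wpM2r => //; apply: ler_wpM2l; first by lra.
  apply: ge0_ler_powR; rewrite ?nnegrE ?divr_ge0 ?(ltW kp0)//; try lra.
  by rewrite ler_pM2r ?invr_gt0//; lra.
apply: (@le_trans _ _ (rho * psi u)).
  by rewrite ler_pM2l; [apply: psi_nd; lra|lra].
apply: ler_wpM2r => //; rewrite mulrAC ler_peMl//; first lra.
by rewrite -[leLHS]mul1r; apply: ler_pM.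
Qed.

End cost_function.

Section power_sum.
Context (R : realType).

(** Young's inequality with exponents [1 / s] and [1 / (1 - s)]: a concave power lies below its
    tangent at 1. *)
Lemma powR_le_tangent (x s : R) : 0 <= x -> 0 < s < 1 -> x `^ s <= s * x + (1 - s).
Proof.
move=> x0 /andP[s0 s1].
have h : 1 - s != 0 by rewrite gt_eqF//; lra.
have := @conjugate_powR R (x `^ s) 1 s^-1 (1 - s)^-1 (powR_ge0 _ _) ler01.
rewrite !invrK invr_gt0 invr_gt0 subr_gt0 => /(_ s0 s1).
rewrite addrCA subrr addr0 mulr1 => /(_ erefl).
by rewrite -powRrM divff ?gt_eqF// powRr1// powR1 mul1r mulrC.
Qed.

(** Comparison with the integral of [y^(-g)], by induction; the step is the tangent inequality at
    [n / (n + 1)]. *)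
Lemma sum_powR_le (g : R) n : 0 < g < 1 ->
  \sum_(k < n) k.+1%:R `^ (- g) <= n%:R `^ (1 - g) / (1 - g).
Proof.
move=> /andP[g0 g1]; have s0 : 0 < 1 - g by lra.
elim: n => [|n IH].
  by rewrite big_ord0 divr_ge0 ?powR_ge0// ltW.
rewrite big_ord_recr/=; set m : R := n.+1%:R.
have m0 : 0 < m by rewrite /m ltr0n.
apply: (@le_trans _ _ (n%:R `^ (1 - g) / (1 - g) + m `^ (- g))); first by rewrite lerD2r.
rewrite ler_pdivlMr// mulrDl divfK ?gt_eqF//.
have -> : m `^ (- g) = m `^ (1 - g) / m.
  by rewrite -{3}(powRr1 (ltW m0)) -powRN -powRD ?(gt_eqF m0) ?implybT//; congr powR; ring.
have nm : n%:R = n%:R / m * m :> R by rewrite divfK// gt_eqF.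
rewrite {1}nm powRM ?divr_ge0 ?(ltW m0)//.
have s01 : 0 < 1 - g < 1 by lra.
have h := @powR_le_tangent (n%:R / m) (1 - g) (divr_ge0 (ler0n _ _) (ltW m0)) s01.
apply: (@le_trans _ _ (((1 - g) * (n%:R / m) + (1 - (1 - g))) * m `^ (1 - g) +
    m `^ (1 - g) / m * (1 - g))).
  by rewrite lerD2r ler_wpM2r// powR_ge0.
rewrite le_eqVlt; apply/orP; left; apply/eqP.
have -> : n%:R = m - 1 by rewrite /m -natr1 addrK.
by field; rewrite gt_eqF.
Qed.

End power_sum.

(** * Cost of a barrier as a function of its scale *)

Section block_cost.
Context (R : realType) (psi : R -> R) (kp : R).
Hypothesis psi_ge0 : forall u, 0 <= psi u.
Hypothesis psi0 : psi 0 = 0.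
Hypothesis kp1 : 1 < kp < 2.
Hypothesis potter : forall U, exists2 C, 0 < C &
  forall u v, 0 < u -> u <= v -> v <= U -> psi v <= C * (v / u) `^ kp * psi u.

(** The energy of slope [1 / b] during the time [b^2] in which diffusion reaches height [b]. *)
Definition scale_cost (b : R) : R := b ^+ 2 * psi b^-1.

(** Potter's bound will compare [psi] at [1 / b] with [psi] at twice a slope; this puts the two
    arguments in the right order. *)
Lemma decay_ge_half (zeta b : R) (k : nat) : 2^-1 < zeta < 1 -> 1 <= b ->
  (k < width b)%N -> b^-1 / 2 <= decay zeta b k.+1%:R.
Proof.
move=> /andP[z0 z1] b1 kw; have b0 : 0 < b by lra.
rewrite /decay le_min; apply/andP; split.
  have : b^-1 <= 1 by rewrite invf_le1.
  lra.
apply: (@le_trans _ _ (b `^ (2 * zeta - 1) * (2 * b ^+ 2) `^ (- zeta))); last first.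
  apply: ler_wpM2l; first exact: powR_ge0.
  rewrite !powRN lef_pV2 ?posrE ?powR_gt0 ?mulr_gt0 ?exprn_gt0//.
  apply: ge0_ler_powR; rewrite ?nnegrE ?mulr_ge0 ?sqr_ge0//; try lra.
  by apply: le_trans (width_le b1); rewrite ler_nat.
rewrite powRM ?sqr_ge0// -(powR_mulrn _ (ltW b0)) -powRrM mulrCA -powRD; last first.
  by rewrite (gt_eqF b0) implybT.
rewrite (_ : 2 * zeta - 1 + 2 * - zeta = -1); last by ring.
rewrite (powR_inv1 (ltW b0)) mulrC ler_pM2r ?invr_gt0//.
rewrite -[leLHS](powR_inv1 (ltac:(lra) : (0:R) <= 2)).
by apply: ler_powR; lra.
Qed.

(** With [g = zeta kp], Potter's bound makes the [k]-th term at most a constant times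
    [b^(2 g) (k + 1)^(-g) psi(1/b)]. As [g < 1], the sum of [(k + 1)^(-g)] over [k < width b] is
    [O(b^(2 - 2 g))]. The slopes are doubled in view of [psi_add]. *)
Lemma slope_cost (zeta K : R) : 2^-1 < zeta < 1 -> zeta * kp < 1 -> 1 <= K ->
  exists2 C, 0 < C & forall b n, 1 <= b ->
    \sum_(k < n) psi (2 * slope zeta K b k) <= C * scale_cost b.
Proof.
move=> z zk K1; have /andP[z0 z1] := z; have /andP[k1 k2] := kp1.
have [C C0 hC] := potter (2 * K).
pose g := zeta * kp.
have g01 : 0 < g < 1 by rewrite /g zk andbT mulr_gt0//; lra.
have /andP[g0 g1] := g01.
exists (C * (2 * K) `^ kp * 2 `^ (1 - g) / (1 - g)).
  by rewrite divr_gt0 ?subr_gt0// !mulr_gt0 ?powR_gt0//; lra.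
move=> b n b1; have b0 : 0 < b by lra.
pose c := C * (2 * K) `^ kp * b `^ (2 * g) * psi b^-1.
have c0 : 0 <= c by rewrite !mulr_ge0 ?powR_ge0// ltW.
have hk k : psi (2 * slope zeta K b k) <=
    if (k < width b)%N then c * k.+1%:R `^ (- g) else 0.
  rewrite /slope; case: ifP => kw; last by rewrite mulr0 psi0.
  have dg := decay_ge_half z b1 kw.
  have dl : decay zeta b k.+1%:R <= 1 by rewrite /decay ge_min lexx.
  have dl2 : decay zeta b k.+1%:R <= b `^ (2 * zeta - 1) * k.+1%:R `^ (- zeta).
    by rewrite /decay ge_min lexx orbT.
  set D := decay _ _ _ in dg dl dl2 *.
  have D0 : 0 <= D by exact: decay_ge0.
  apply: le_trans (hC b^-1 (2 * (K * D)) _ _ _) _.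
  - by rewrite invr_gt0.
  - apply: (@le_trans _ _ (2 * D)); first by lra.
    by rewrite ler_pM2l// ler_peMl.
  - by rewrite ler_pM2l// ler_piMr//; lra.
  rewrite invrK /c [leRHS]mulrAC; apply: ler_wpM2r => //.
  rewrite -!(mulrA C) ler_pM2l//.
  apply: (@le_trans _ _ ((2 * K * (b `^ (2 * zeta) * k.+1%:R `^ (- zeta))) `^ kp)).
    apply: ge0_ler_powR; rewrite ?nnegrE ?mulr_ge0 ?powR_ge0//; try lra.
    rewrite -!mulrA ler_pM2l// ler_pM2l; last lra.
    have -> : b `^ (2 * zeta) = b `^ (2 * zeta - 1) * b.
      rewrite -{3}(powRr1 (ltW b0)) -powRD ?(gt_eqF b0) ?implybT//.
      by congr powR; ring.
    by rewrite mulrAC ler_wpM2r// ltW.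
  rewrite powRM ?mulr_ge0 ?powR_ge0//; try lra.
  rewrite (powRM kp (powR_ge0 _ _) (powR_ge0 _ _)) -!powRrM !mulrA.
  rewrite le_eqVlt; apply/orP; left; apply/eqP.
  by congr (_ * _ `^ _ * _ `^ _); rewrite /g; ring.
apply: (@le_trans _ _ (\sum_(k < n) if (k < width b)%N then c * k.+1%:R `^ (- g) else 0)).
  exact: ler_sum.
apply: (@le_trans _ _ (\sum_(k < width b) c * k.+1%:R `^ (- g))).
  have [nw|wn] := leqP n (width b).
    rewrite -(subnKC nw) big_split_ord/=.
    rewrite -[leLHS]addr0; apply: lerD.
      apply: ler_sum => k _.
      by rewrite (leq_trans (ltn_ord k)) ?subnKC.
    by apply: sumr_ge0 => k _; rewrite mulr_ge0 ?powR_ge0.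
  rewrite -(subnKC (ltnW wn)) big_split_ord/= [X in _ + X]big1 ?addr0; last first.
    by move=> k _; rewrite ltnNge leq_addr.
  by apply: ler_sum => k _; rewrite ltn_ord.
rewrite -mulr_sumr.
apply: (@le_trans _ _ (c * ((2 * b ^+ 2) `^ (1 - g) / (1 - g)))).
  apply: ler_wpM2l => //; apply: le_trans (sum_powR_le _ g01) _.
  apply: ler_wpM2r; first by rewrite invr_ge0; lra.
  apply: ge0_ler_powR; rewrite ?nnegrE ?mulr_ge0 ?sqr_ge0//; try lra.
  exact: width_le.
rewrite (powRM (1 - g) (ler0n R 2) (sqr_ge0 b)) -(powR_mulrn 2 (ltW b0)) -powRrM.
rewrite /c /scale_cost.
rewrite -(powR_mulrn 2 (ltW b0)).
have -> : b `^ 2%:R = b `^ (2 * g) * b `^ (2%:R * (1 - g)).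
  rewrite -powRD ?(gt_eqF b0) ?implybT//; congr powR; ring.
by rewrite le_eqVlt; apply/orP; left; apply/eqP; field; lra.
Qed.

Hypothesis psi_nd : forall u v, 0 <= u -> u <= v -> psi u <= psi v.

(** For [x <= b], Potter's bound leaves [(x / b)^(2 - kp)]. For [x > b], monotonicity of [psi]
    leaves [(x / b)^2], and the excess [(x / b)^kp] is at most [A^kp]. Since [kp < 2], costs decay
    geometrically when the scales do. *)
Lemma scale_cost_decay (A : R) : 0 < A -> exists2 C, 0 < C & forall x b t,
  1 <= x -> 1 <= b -> 0 < t <= 1 -> x <= A * t * b ->
  scale_cost x <= C * t `^ (2 - kp) * scale_cost b.
Proof.
move=> A0; have /andP[k1 k2] := kp1; have [C C0 hC] := potter 1.
exists ((C + A `^ kp) * A `^ (2 - kp)).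
  by rewrite mulr_gt0 ?powR_gt0// addr_gt0 ?powR_gt0.
move=> x b t x1 b1 /andP[t0 t1] xb.
have x0 : 0 < x by lra.
have b0 : 0 < b by lra.
have y0 : 0 < x / b by rewrite divr_gt0.
have yA : x / b <= A * t by rewrite ler_pdivrMr.
have yp : (x / b) `^ (2 - kp) <= A `^ (2 - kp) * t `^ (2 - kp).
  rewrite -powRM ?(ltW A0) ?(ltW t0)//.
  by apply: ge0_ler_powR; rewrite ?nnegrE ?(ltW y0)//; [lra|rewrite mulr_ge0; lra].
have y2 : (x / b) `^ kp * (x / b) `^ (2 - kp) = (x / b) ^+ 2.
  rewrite -powRD ?(gt_eqF y0) ?implybT// addrC subrK powR_mulrn//; lra.
suff h : scale_cost x <= (C + A `^ kp) * (x / b) `^ (2 - kp) * scale_cost b.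
  apply: le_trans h _; rewrite -!mulrA; apply: ler_wpM2l.
    by rewrite addr_ge0 ?powR_ge0// ltW.
  rewrite mulrA; apply: ler_wpM2r; first by rewrite mulr_ge0 ?sqr_ge0.
  exact: yp.
rewrite /scale_cost; have [xb'|bx] := leP x b.
  have h := hC b^-1 x^-1.
  rewrite invr_gt0 b0 lef_pV2 ?posrE// invf_le1// in h.
  have {}h := h isT xb' x1; rewrite invrK in h.
  apply: (@le_trans _ _ (x ^+ 2 * (C * (x^-1 * b) `^ kp * psi b^-1))).
    by rewrite ler_wpM2l// sqr_ge0.
  have -> : x ^+ 2 = (x / b) ^+ 2 * b ^+ 2 by field; rewrite gt_eqF.
  have -> : x^-1 * b = (x / b)^-1 by field; rewrite !gt_eqF.
  rewrite -y2 -(powR_inv1 (ltW y0)) -powRrM mulN1r powRN.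
  have z0 : 0 < (x / b) `^ kp by rewrite powR_gt0.
  have -> : (x / b) `^ kp * (x / b) `^ (2 - kp) * b ^+ 2 *
      (C * ((x / b) `^ kp)^-1 * psi b^-1) =
      C * (x / b) `^ (2 - kp) * (b ^+ 2 * psi b^-1) by field; rewrite !gt_eqF.
  apply: ler_wpM2r; first by rewrite mulr_ge0 ?sqr_ge0.
  apply: ler_wpM2r; first exact: powR_ge0.
  by rewrite lerDl powR_ge0.
apply: (@le_trans _ _ (x ^+ 2 * psi b^-1)).
  rewrite ler_wpM2l ?sqr_ge0// psi_nd ?invr_ge0 ?(ltW x0)//.
  by rewrite lef_pV2 ?posrE// ltW.
have -> : x ^+ 2 * psi b^-1 = (x / b) ^+ 2 * (b ^+ 2 * psi b^-1).
  by field; rewrite gt_eqF.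
rewrite -y2; apply: ler_wpM2r; first by rewrite mulr_ge0 ?sqr_ge0.
apply: ler_wpM2r; first exact: powR_ge0.
apply: (@le_trans _ _ (A `^ kp)); last by rewrite lerDr ltW.
apply: ge0_ler_powR; rewrite ?nnegrE ?(ltW y0) ?(ltW A0)//; first lra.
apply: le_trans yA _; by rewrite ler_piMr// ltW.
Qed.

(** Potter's bound between [1 / b] and 1. This polynomial growth in [b] absorbs the initial stretch,
    whose cost is only polylogarithmic in [T]. *)
Lemma scale_cost_growth : 0 < psi 1 -> exists2 c, 0 < c &
  forall b, 1 <= b -> c * b `^ (2 - kp) <= scale_cost b.
Proof.
move=> p1; have /andP[k1 k2] := kp1; have [C C0 hC] := potter 1.
exists (psi 1 / C); first by rewrite divr_gt0.
move=> b b1; have b0 : 0 < b by lra.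
have h := hC b^-1 1; rewrite invr_gt0 b0 invf_le1// in h.
have {}h := h isT b1 (lexx _); rewrite invrK mul1r in h.
have -> : psi 1 / C * b `^ (2 - kp) = psi 1 * (C^-1 * b `^ (2 - kp)) by ring.
apply: (@le_trans _ _ (C * b `^ kp * psi b^-1 * (C^-1 * b `^ (2 - kp)))).
  by apply: ler_wpM2r => //; rewrite mulr_ge0 ?powR_ge0// invr_ge0 ltW.
rewrite /scale_cost -(powR_mulrn 2 (ltW b0)).
have -> : b `^ 2%:R = b `^ kp * b `^ (2 - kp).
  by rewrite -powRD ?(gt_eqF b0) ?implybT//; congr powR; ring.
by rewrite le_eqVlt; apply/orP; left; apply/eqP; field; rewrite gt_eqF.
Qed.

End block_cost.

(** * Choice of scales *)

Section karamata.
Context (R : realType) (theta c eps : R -> R) (alpha : R).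
Local Notation mu := (@lebesgue_measure R).
Hypothesis theta_karamata : karamata_representation theta c eps.
Hypothesis alpha_range : 0 < alpha < 1.
Hypothesis eps_small : \forall v \near 0^'+, `|eps v| < (`|ln v| `^ alpha)^-1.

Lemma karamata_integrable u : 0 < u < 1 ->
  mu.-integrable `]u, 1[ (EFin \o (fun v => eps v / v)).
Proof.
move=> /andP[u0 u1]; apply: measurable_bounded_integrable => //=.
- by rewrite lebesgue_measure_itv/= lte_fin u1 -EFinD ltry.
- apply: measurable_funM.
    apply: measurable_funS (karamata_eps_measurable theta_karamata) => //.
    by move=> x /=; rewrite !in_itv/= => /andP[ux ->]; rewrite (lt_trans u0).
  apply: open_continuous_measurable_fun; first exact: interval_open.
  move=> x; rewrite inE/= in_itv/= => /andP[ux _].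
  by apply: inv_continuous; rewrite gt_eqF// (lt_trans u0).
- have [M [_ hM]] := karamata_eps_bounded theta_karamata.
  have {}hM x : 0 < x < 1 -> `|eps x| <= `|M| + 1.
    by move=> x01; apply: hM => /=; rewrite ?in_itv//; have := ler_norm M; lra.
  exists ((`|M| + 1) / u); split; first exact: num_real.
  move=> y hy x /=; rewrite in_itv/= => /andP[ux x1]; apply/ltW; apply: le_lt_trans hy.
  have x0 := lt_trans u0 ux.
  rewrite normrM normfV (gtr0_norm x0); apply: ler_pM => //.
  - by rewrite invr_ge0 ltW.
  - by apply: hM; rewrite x0.
  - by rewrite lef_pV2 ?posrE// ltW.
Qed.

Lemma Rintegral_inv u v : 0 < u -> u < v ->
  \int[mu]_(x in `]u, v]) (x^-1) = ln (v / u).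
Proof.
move=> u0 uv; have v0 := lt_trans u0 uv.
have cinv : {in `[u, v], continuous (fun x : R => x^-1)}.
  move=> x; rewrite in_itv/= => /andP[ux _].
  by apply: inv_continuous; rewrite gt_eqF// (lt_le_trans u0).
have wc : {within `[u, v], continuous (fun x : R => x^-1)}.
  by apply: continuous_in_subspaceT => x; rewrite inE; exact: cinv.
have cln x : 0 < x -> {for x, continuous (@ln R)} by exact: continuous_ln.
have hF : (\int[mu]_(x in `[u, v]) (x^-1)%:E = (ln v)%:E - (ln u)%:E)%E.
  apply: continuous_FTC2 => //.
    split.
    - move=> x; rewrite in_itv/= => /andP[ux _].
      have [] := is_derive1_ln (lt_trans u0 ux); by [].
    - by apply: cvg_at_right_filter; exact: cln.
    - by apply: cvg_at_left_filter; exact: cln.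
  move=> x; rewrite in_itv/= => /andP[ux _]; rewrite derive1E.
  by have [_ ->] := is_derive1_ln (lt_trans u0 ux).
rewrite /Rintegral integral_itv_obnd_cbnd; last first.
  apply/measurable_EFinP; apply: (@measurable_funS _ _ _ _ `[u, v]%classic) => //.
    exact: subset_itv_oc_cc.
  exact: subspace_continuous_measurable_fun.
by rewrite hF -EFinB/= ln_div ?posrE.
Qed.

(** On []u, v]] the function [eps] is bounded by [|ln v|^(-alpha)], so the integral of [eps x / x]
    there is at most [ln(v / u) |ln v|^(-alpha) <= 1], a factor [exp 1 <= 4]. Near 0 the function
    [c] stays between [|c0| / 2] and [2 |c0|], another factor 4. *)
Lemma karamata_compare : exists2 v0, 0 < v0 & forall u v,
  0 < u -> u <= v -> v <= v0 -> ln (v / u) <= `|ln v| `^ alpha ->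
  theta v <= 16 * theta u.
Proof.
have [c0 c00 hc] := karamata_c_lim theta_karamata.
have e1 : `|c0| / 2 > 0 by rewrite divr_gt0// normr_gt0.
have /near_right0[a a0 ha] : \forall u \near 0^'+, `|c0 - c u| <= `|c0| / 2.
  by move/cvgrPdist_le : hc; exact.
have [b b0 hb] := near_right0 eps_small.
pose v0 := Num.min (Num.min a b) 1 / 2.
have v0a : v0 < a /\ v0 < b /\ v0 < 1 /\ 0 < v0.
  have m0 : 0 < Num.min (Num.min a b) 1 by rewrite !lt_min a0 b0 ltr01.
  have h1 : Num.min (Num.min a b) 1 <= a by rewrite !ge_min lexx.
  have h2 : Num.min (Num.min a b) 1 <= b by rewrite !ge_min lexx orbT.
  have h3 : Num.min (Num.min a b) 1 <= 1 by rewrite !ge_min lexx !orbT.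
  rewrite /v0; split; [lra|split; [lra|split; lra]].
have {v0a}[v0a [v0b [v01 v00]]] := v0a.
have hcu x : 0 < x <= v0 -> `|c0| / 2 <= c x <= 2 * `|c0|.
  move=> /andP[x0 xv]; have cx : 0 < c x.
    by apply: (karamata_c_gt0 theta_karamata); rewrite x0/=; lra.
  have := ha x; rewrite x0 (le_lt_trans xv v0a) => /(_ isT).
  have := lerB_dist c0 (c x); have := lerB_dist (c x) c0.
  by rewrite (distrC (c x)) (gtr0_norm cx); lra.
exists v0 => // u v u0 uv vv0 hln.
have v_gt0 : 0 < v := lt_le_trans u0 uv.
have u1 : 0 < u < 1 by rewrite u0/=; lra.
have v1 : 0 < v < 1 by rewrite v_gt0/=; lra.
rewrite !(karamata_eq theta_karamata)//.
have /andP[cu1 cu2] := hcu u ltac:(by rewrite u0/=; lra).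
have /andP[cv1 cv2] := hcu v ltac:(by rewrite v_gt0/=; lra).
suff h : \int[mu]_(x in `]v, 1[) (eps x / x) <= \int[mu]_(x in `]u, 1[) (eps x / x) + 1.
  set J := \int[mu]_(x in `]u, 1[) _ in h *.
  have e4 : expR 1 <= 4 :> R.
    have -> : 1 = 2^-1 + 2^-1 :> R by lra.
    have h2 := @expR_half_le2 R; rewrite expRD.
    have := ler_pM (expR_ge0 _) (expR_ge0 _) h2 h2; lra.
  have h1 : expR (\int[mu]_(x in `]v, 1[) (eps x / x)) <= expR J * 4.
    apply: (@le_trans _ _ (expR (J + 1))); first by rewrite ler_expR.
    by rewrite expRD ler_pM2l ?expR_gt0.
  apply: (@le_trans _ _ ((2 * `|c0|) * (expR J * 4))).
    exact: ler_pM (le_trans (ltW e1) cv1) (expR_ge0 _) cv2 h1.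
  have eJ := expR_ge0 J.
  have -> : 2 * `|c0| * (expR J * 4) = 16 * (`|c0| / 2 * expR J) by field.
  by rewrite ler_pM2l//; apply: ler_wpM2r.
have [->|uv'] := eqVneq u v; first by rewrite lerDl.
have {uv'}uv' : u < v by rewrite lt_neqAle uv'.
have iu := karamata_integrable u1.
have <- := @Rintegral_itvB _ (fun x => eps x / x) (BRight u) (BLeft 1) v iu
   ltac:(by rewrite bnd_simp) ltac:(by rewrite bnd_simp; lra).
rewrite lerD2l lerNl.
have subv : `]u, v] `<=` `]u, 1[.
  by move=> x /=; rewrite !in_itv/= => /andP[-> xv]/=; lra.
have iuv : mu.-integrable `]u, v] (EFin \o (fun v => eps v / v)).
  exact: integrableS iu.
set J := \int[mu]_(x in _) _.
suff : `|J| <= 1 by rewrite ler_norml => /andP[].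
apply: le_trans (le_normr_Rintegral _ iuv) _ => //.
have lnv : ln v < 0 by apply: ln_lt0; rewrite v_gt0; lra.
pose M := (`|ln v| `^ alpha)^-1.
have M0 : 0 < M by rewrite invr_gt0 powR_gt0// normr_gt0 lt_eqF.
have iinv : mu.-integrable `]u, v] (EFin \o (fun x : R => x^-1)).
  have sub : `]u, v] `<=` `[u, v] by exact: subset_itv_oc_cc.
  apply: integrableS; [| |exact: sub|] => //.
  apply: continuous_compact_integrable; first exact: segment_compact.
  apply: continuous_in_subspaceT => x; rewrite inE/= in_itv/= => /andP[ux _].
  by apply: inv_continuous; rewrite gt_eqF// (lt_le_trans u0).
apply: (@le_trans _ _ (\int[mu]_(x in `]u, v]) (M * x^-1))).
  apply: le_Rintegral => //.
  - by move/integrable_norm : iuv.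
  - rewrite (_ : EFin \o _ = (fun x => M%:E * (EFin \o GRing.inv) x)%E) //.
    exact: integrableZl.
  move=> x /=; rewrite in_itv/= => /andP[ux xv].
  have x0 := lt_trans u0 ux.
  rewrite normrM normfV (gtr0_norm x0) ler_pM2r ?invr_gt0//.
  have xb : 0 < x < b by rewrite x0/=; lra.
  apply: le_trans (ltW (hb x xb)) _.
  have lnx : ln x <= ln v by rewrite ler_ln.
  have lnv' : 0 < `|ln v| by rewrite normr_gt0 lt_eqF.
  have lnxv : `|ln v| <= `|ln x|.
    by rewrite !ltr0_norm//; [lra|exact: le_lt_trans lnv].
  rewrite /M lef_pV2 ?posrE ?powR_gt0//; last exact: lt_le_trans lnxv.
  by apply: ge0_ler_powR; rewrite ?nnegrE//; case/andP: alpha_range => /ltW.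
rewrite RintegralZl// Rintegral_inv//.
rewrite mulrC ler_pdivrMr ?mul1r//.
by rewrite powR_gt0// normr_gt0 lt_eqF.
Qed.

End karamata.

(** * Discarding scales of small probability *)

Section good_indices.
Context (R : realType) (p : nat -> R) (m : nat).
Hypothesis p_gt0 : forall l, (m <= l)%N -> 0 < p l.

(* An index is good when its term is not much smaller than an earlier one; the
   good indices still carry half of the sum of [p]. *)
Definition good (l : nat) : bool :=
  all (fun j => p j <= 4 * (3 / 2) ^+ (l - j) * p l) (iota m (l - m)).

Lemma goodP l j : good l -> (m <= j <= l)%N -> p j <= 4 * (3 / 2) ^+ (l - j) * p l.
Proof.
move=> gl /andP[mj]; rewrite leq_eqVlt => /predU1P[<-|jl].
  by have := p_gt0 mj; rewrite subnn expr0 mulr1; lra.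
move/allP : gl; apply; rewrite mem_iota mj/= subnKC//.
by rewrite (leq_trans mj)// ltnW.
Qed.

(* The potential of the summation argument: a bad term is at most a quarter of
   it, and it loses a third at each step. *)
Fixpoint discounted (n : nat) : R :=
  if n is n'.+1 then 2 / 3 * (discounted n' + p (m + n')) else 0.

Lemma discounted_ge0 n : 0 <= discounted n.
Proof.
elim: n => //= n IH; rewrite mulr_ge0// addr_ge0// ltW// p_gt0//.
exact: leq_addr.
Qed.

Lemma discounted_ge n j : (j < n)%N ->
  (2 / 3) ^+ (n - j) * p (m + j) <= discounted n.
Proof.
elim: n => // n IH; rewrite ltnS leq_eqVlt => /predU1P[->|jn] /=.
  rewrite subSnn expr1 ler_pM2l//.
  by rewrite lerDr discounted_ge0.
rewrite subSn ?(ltnW jn)// exprS -[leLHS]mulrA ler_pM2l//.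
apply: le_trans (IH jn) _; rewrite lerDl ltW// p_gt0//.
exact: leq_addr.
Qed.

Lemma bad_le n : ~~ good (m + n) -> p (m + n) <= discounted n / 4.
Proof.
move=> /allPn[j]; rewrite mem_iota addKn => /andP[mj jn].
rewrite -ltNge => /ltW h.
have jn' : (j - m < n)%N by lia.
have := discounted_ge jn'; rewrite subnKC//.
have -> : (n - (j - m) = m + n - j)%N by lia.
set k := (m + n - j)%N in h *.
have e : (2 / 3 : R) ^+ k * (3 / 2) ^+ k = 1.
  by rewrite -exprMn (_ : _ * _ = 1) ?expr1n//; field.
have k0 : 0 < (2 / 3 : R) ^+ k by rewrite exprn_gt0.
have : (2 / 3) ^+ k * (4 * (3 / 2) ^+ k * p (m + n)) <= (2 / 3) ^+ k * p j.
  by rewrite ler_pM2l.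
have -> : (2 / 3) ^+ k * (4 * (3 / 2) ^+ k * p (m + n)) =
    4 * ((2 / 3 : R) ^+ k * (3 / 2) ^+ k) * p (m + n) by ring.
rewrite e; lra.
Qed.

Lemma sum_good_ge n : 2^-1 * \sum_(l <- iota m n) p l <=
  \sum_(l <- [seq l <- iota m n | good l]) p l.
Proof.
(* Appending a term [p] raises this left-hand side by exactly [p - discounted n / 4]: at most [p]
   for a good index, and at most 0 for a bad one by [bad_le]. *)
suff : 2^-1 * \sum_(l <- iota m n) p l + 3 / 4 * discounted n <=
    \sum_(l <- [seq l <- iota m n | good l]) p l.
  have := discounted_ge0 n; lra.
elim: n => [|n IH]; first by rewrite /= !big_nil; lra.
rewrite -[n.+1]addn1 iotaD filter_cat !big_cat/= big_seq1 addn1/=.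
have := discounted_ge0 n; have pp : 0 < p (m + n) by rewrite p_gt0// leq_addr.
case: ifP => [gd|/negbT/bad_le bd]; rewrite ?big_seq1 ?big_nil; lra.
Qed.

End good_indices.

Section scale_selection.
Context (R : realType) (g : R -> R) (kappa xi_lower xi_upper : R).
Local Notation mu := (@lebesgue_measure R).
Hypothesis kappa_lt2 : kappa < 2.
Hypothesis g_sv : slowly_varying_at_infty g.
Hypothesis xi_upper_gt0 : 0 < xi_upper.
Hypothesis g_lower :
  (fun b : R => (ln b) `^ (- xi_lower)) =O_ (pinfty_filter R) g.
Hypothesis g_upper :
  g =O_ (pinfty_filter R) (fun b : R => (ln b) `^ (- xi_upper)).
Hypothesis g_diverges : \forall A \near +oo_R,
    (\int[mu]_(b in `[A, +oo[) (g b `^ (2 - kappa)^-1 / b)%:E = +oo)%E.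

Lemma near_pinfty (Q : R -> Prop) : (\forall x \near +oo_R, Q x) ->
  exists A, forall x, A < x -> Q x.
Proof. by move=> [A [_ hA]]; exists A. Qed.

Lemma expR1_gt1 : 1 < expR 1 :> R.
Proof. by rewrite expR_gt1. Qed.

Lemma ln_ge1 (b : R) : expR 1 <= b -> 1 <= ln b.
Proof.
move=> eb; rewrite -(expRK 1) ler_ln// ?posrE ?expR_gt0//.
exact: lt_le_trans eb.
Qed.

Lemma powRN_le1 (x a : R) : 1 <= x -> 0 < a -> x `^ (- a) <= 1.
Proof.
move=> x1 a0; rewrite powRN invf_le1 ?powR_gt0//; last exact: lt_le_trans x1.
rewrite powRE; last exact: lt_le_trans x1.
by rewrite -[leLHS]expR0 ler_expR mulr_ge0 ?ln_ge0// ltW.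
Qed.

Lemma slow_bounds : exists A M c : R, [/\ 1 <= A, 0 < M, 0 < c,
  measurable_fun `[A, +oo[ g & forall b, A <= b ->
  [/\ expR 1 <= b, 0 < g b, g b <= M & c * ln b `^ (- xi_lower) <= g b]].
Proof.
have [[a [mg ga]] _] := g_sv.
have [k1 k10 /near_pinfty[A1 h1]] := (eqO_exP _ _ _).1 g_lower.
have [k2 k20 /near_pinfty[A2 h2]] := (eqO_exP _ _ _).1 g_upper.
pose A := `|a| + `|A1| + `|A2| + expR 1 + 1.
have ha := ler_norm a; have hA1 := ler_norm A1; have hA2 := ler_norm A2.
have e1 := expR1_gt1.
have n1 := normr_ge0 a; have n2 := normr_ge0 A1; have n3 := normr_ge0 A2.
exists A, k2, k1^-1; split.
- by rewrite /A; lra.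
- by [].
- by rewrite invr_gt0.
- apply: measurable_funS mg => //.
  by move=> x /=; rewrite !in_itv/= !andbT /A; lra.
move=> b Ab; rewrite /A in Ab.
have eb : expR 1 <= b by lra.
have l1 := ln_ge1 eb.
have gb : 0 < g b by apply: ga; lra.
split => //.
- have := h2 b ltac:(lra); rewrite /= (gtr0_norm gb) ger0_norm ?powR_ge0// => h.
  apply: le_trans h _; rewrite ler_piMr ?(ltW k20)//.
  exact: powRN_le1.
- have := h1 b ltac:(lra); rewrite /= (gtr0_norm gb) ger0_norm ?powR_ge0// => h.
  by rewrite mulrC ler_pdivrMr// mulrC.
Qed.

Let G (b : R) : R := g b `^ (2 - kappa)^-1.

Let G_pos : 0 < (2 - kappa)^-1.
Proof. by rewrite invr_gt0 subr_gt0. Qed.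

(** The supremum of [G] need not be attained; a point with more than half of it is enough. *)
Lemma near_sup (lo hi : R) (M : R) : lo <= hi ->
  (forall b, lo <= b <= hi -> 0 < g b <= M) ->
  exists2 t, lo <= t <= hi & forall b, lo <= b <= hi -> G b <= 2 * G t.
Proof.
move=> lh hg; pose E := [set G b | b in `[lo, hi]].
have Elo : E (G lo) by exists lo => //=; rewrite in_itv/= lexx.
have ubE : ubound E (M `^ (2 - kappa)^-1).
  move=> y [b /=]; rewrite in_itv/= => /hg/andP[b0 bM] <-.
  apply: ge0_ler_powR; [exact: ltW|exact: ltW| |exact: bM].
  exact: le_trans (ltW b0) bM.
have hs : has_sup E by split; [exists (G lo)|exists (M `^ (2 - kappa)^-1)].
have s0 : 0 < sup E.
  apply: (@lt_le_trans _ _ (G lo)); last exact: sup_upper_bound.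
  by rewrite powR_gt0//; have /andP[] := hg lo ltac:(by rewrite lexx).
have [y [t /=]] := sup_adherent (divr_gt0 s0 (ltr0n R 2)) hs.
rewrite in_itv/= => tlh <- ht; exists t => // b blh.
have : G b <= sup E by apply: sup_upper_bound => //; exists b.
rewrite -/(G t) in ht; lra.
Qed.

(** On [[4^l, 4^(l+1)[] the integrand is at most [2 G(T l) / 4^l] and the length is [3 * 4^l], so
    the integral is at most [6 G(T l)]. Bounded partial sums would contradict the divergence. *)
Lemma scales_exist : exists (T : nat -> R) (l0 : nat),
  (forall l, (l0 <= l)%N -> 4 ^+ l <= T l <= 4 ^+ l.+1) /\
  (forall m M, (l0 <= m)%N -> exists n, M <= \sum_(l <- iota m n) G (T l)).
Proof.
have [A [M [c [A1 M0 c0 mg hg]]]] := slow_bounds.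
have [B hB] := near_pinfty g_diverges.
have pow4 (x : R) : exists l, x < 4 ^+ l.
  exists (Num.truncn x).+1; apply: lt_le_trans (truncnS_gt x) _.
  by rewrite -natrX ler_nat ltnW// ltn_expl.
have [l0 hl0] := pow4 (Num.max A B).
have l0P l : (l0 <= l)%N -> A < 4 ^+ l /\ B < 4 ^+ l.
  move=> ll; have h : (4 : R) ^+ l0 <= 4 ^+ l by rewrite ler_weXn2l// ler1n.
  by move: hl0; rewrite gt_max => /andP[h1 h2]; split; lra.
have : forall l, exists t, (l0 <= l)%N -> 4 ^+ l <= t <= 4 ^+ l.+1 /\
    forall b, 4 ^+ l <= b <= 4 ^+ l.+1 -> G b <= 2 * G t.
  move=> l; have [ll|_] := leqP l0 l; last by exists 0.
  have [Al _] := l0P l ll.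
  have [] := @near_sup (4 ^+ l) (4 ^+ l.+1) M.
  - by rewrite ler_weXn2l// ler1n.
  - move=> b /andP[lb _]; have [_ g0 gM _] := hg b (le_trans (ltW Al) lb).
    by rewrite g0.
  by move=> t ht hG; exists t.
move=> /choice[T hT]; exists T, l0; split.
  by move=> l /hT[].
move=> m K lm; apply: contrapT => nK.
have {}nK n : \sum_(l <- iota m n) G (T l) <= K.
  by rewrite leNgt; apply/negP => h; apply: nK; exists n; exact: ltW.
have [Am Bm] := l0P m lm.
have := hB _ Bm.
pose J k : set R := `[4 ^+ (m + k), 4 ^+ (m + k).+1[%classic.
have pm k : (0 : R) < 4 ^+ k by rewrite exprn_gt0.
have JE : `[4 ^+ m, +oo[%classic = \bigcup_k J k.
  apply/seteqP; split => x /=; rewrite in_itv/= andbT.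
    move=> mx; have [l hl] := pow4 x.
    have ex : exists k, x < 4 ^+ (m + k).+1.
      exists l; apply: lt_le_trans hl _; rewrite ler_weXn2l ?ler1n//.
      by apply: leqW; exact: leq_addl.
    case: (ex_minnP ex) => k hk kmin; exists k => //.
    rewrite /J/= in_itv/= hk andbT leNgt; apply/negP => hx.
    case: k => [|k] in hk kmin hx *.
      by move: hx; rewrite addn0 ltNge mx.
    by have := kmin k; rewrite -addnS hx ltnn => /(_ isT).
  move=> [k _]; rewrite /J/= in_itv/= => /andP[h _].
  by apply: le_trans h; rewrite ler_weXn2l ?ler1n// leq_addr.
have f0 b : 4 ^+ m <= b -> (0 <= (G b / b)%:E)%E.
  by move=> mb; rewrite lee_fin divr_ge0 ?powR_ge0// (le_trans (ltW (pm m))).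
have mf : measurable_fun (`[(4 : R) ^+ m, +oo[ : set R) (fun b => (G b / b)%:E).
  apply/measurable_EFinP; apply: measurable_funM.
    apply: (@measurableT_comp _ _ _ _ _ _ (fun x => x `^ (2 - kappa)^-1)) => //.
    apply: measurable_funS mg => // x /=; rewrite !in_itv/= !andbT.
    by apply: le_trans; exact: ltW.
  apply: subspace_continuous_measurable_fun => //.
  apply: continuous_in_subspaceT => x; rewrite inE/= in_itv/= andbT => mx.
  by apply: inv_continuous; rewrite gt_eqF// (lt_le_trans (pm m)).
rewrite JE ge0_integral_bigcup//=; last 4 first.
- by move=> k; rewrite /J.
- by rewrite -JE.
- by move=> b; rewrite -JE/= in_itv/= andbT; exact: f0.
- apply/trivIsetP => i j _ _; wlog ij : i j / (i < j)%N => [hw|_].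
    rewrite neq_ltn => /orP[] ij; first by apply: hw => //; rewrite neq_ltn ij.
    by rewrite setIC; apply: hw => //; rewrite neq_ltn ij.
  apply/seteqP; split => // x; rewrite /J/= !in_itv/= => -[/andP[_ h1] /andP[h2 _]].
  have : (4 : R) ^+ (m + i).+1 <= 4 ^+ (m + j).
    by rewrite ler_weXn2l ?ler1n// ltn_add2l.
  lra.
apply/eqP; rewrite lt_eqF//; apply: (@le_lt_trans _ _ (6 * K)%:E); last exact: ltry.
apply: lime_le.
  apply: is_cvg_nneseries => k _ _; apply: integral_ge0 => x.
  rewrite /J/= in_itv/= => /andP[h _]; apply: f0.
  by apply: le_trans h; rewrite ler_weXn2l ?ler1n// leq_addr.
apply: nearW => n.
apply: (@le_trans _ _ (6 * \sum_(l <- iota m n) G (T l))%:E); last first.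
  by rewrite lee_fin ler_pM2l.
rewrite -[X in iota X _]addn0 iotaDl big_map mulr_sumr -sumEFin.
rewrite /index_iota subn0; apply: lee_sum => k _.
have mk : (l0 <= m + k)%N by apply: leq_trans lm _; exact: leq_addr.
have [_ hTk] := hT _ mk.
have pk := pm (m + k)%N.
apply: (@le_trans _ _ (\int[mu]_(x in J k) (cst (2 * G (T (m + k)%N) / 4 ^+ (m + k))%:E x))%E).
  apply: ge0_le_integral => //.
  - by rewrite /J.
  - by move=> x; rewrite /J/= in_itv/= => /andP[h _]; apply: f0;
      apply: le_trans h; rewrite ler_weXn2l ?ler1n// leq_addr.
  - apply: measurable_funS mf => // x; rewrite /J/= !in_itv/= andbT => /andP[h _].
    by apply: le_trans h; rewrite ler_weXn2l ?ler1n// leq_addr.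
  move=> x; rewrite /J/= in_itv/= => /andP[h1 h2]; rewrite lee_fin.
  have x0 : 0 < x by exact: lt_le_trans h1.
  apply: ler_pM; rewrite ?powR_ge0 ?invr_ge0 ?(ltW x0)//.
    by apply: hTk; rewrite h1 ltW.
  by rewrite lef_pV2 ?posrE.
rewrite integral_cst; last by rewrite /J.
rewrite /J /= lebesgue_measure_itv/= lte_fin ltr_eXn2l ?ltr1n// ltnSn.
rewrite -EFinD -EFinM lee_fin exprS.
by rewrite le_eqVlt; apply/orP; left; apply/eqP; field; rewrite gt_eqF.
Qed.

End scale_selection.

(** * Energy of piecewise linear majorants *)

Section piecewise_linear.
Context (R : realType).
Local Notation mu := (@lebesgue_measure R).

(** The values at the nodes are left free, since a polygon may have no derivative there.
    Measurability belongs to the conclusion: it comes from the same splitting of the interval, one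
    step at a time. *)
Lemma step_integral (phi : R -> R) (tau c : nat -> R) n :
  (forall t, 0 <= phi t) -> (forall j, tau j < tau j.+1) ->
  (forall j t, (j < n)%N -> tau j < t < tau j.+1 -> phi t = c j) ->
  measurable_fun (`[tau 0%N, tau n] : set R) (fun t => (phi t)%:E) /\
  (\int[mu]_(t in `[tau 0%N, tau n]) (phi t)%:E =
   (\sum_(j < n) (tau j.+1 - tau j) * c j)%:E)%E.
Proof.
move=> phi0 ht; elim: n => [|n IH] hc.
  by rewrite set_itv1 integral_set1 big_ord0; split => //; exact: measurable_fun_set1.
have [mphi ephi] := IH (fun j t jn => hc j t (ltnW jn)).
have ht0 j : tau 0%N <= tau j.
  by elim: j => // j IHj; apply: le_trans IHj (ltW (ht j)).
have split1 : `[tau 0%N, tau n.+1]%classic =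
    `[tau 0%N, tau n] `|` (`]tau n, tau n.+1[ `|` [set tau n.+1]).
  apply/seteqP; split => t /=; rewrite !in_itv/=.
    move=> /andP[t0 t1]; have [tn|nt] := leP t (tau n); first by left; rewrite t0.
    right; move: t1; rewrite le_eqVlt => /predU1P[->|tl]; first by right.
    by left.
  have := ht n; have := ht0 n.
  move=> h1 h2 [/andP[-> h]|[/andP[h h']|->]]/=; lra.
have mo : measurable_fun (`]tau n, tau n.+1[ : set R) (fun t => (phi t)%:E).
  apply: (eq_measurable_fun (cst (c n)%:E)) => // t; rewrite inE/= in_itv/= => h.
  by rewrite (hc n).
have mU2 : measurable_fun ((`]tau n, tau n.+1[ : set R) `|` [set tau n.+1])
    (fun t => (phi t)%:E).
  by apply/measurable_funU => //; split => //; exact: measurable_fun_set1.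
have mU : measurable_fun (`[tau 0%N, tau n.+1] : set R) (fun t => (phi t)%:E).
  rewrite split1; apply/measurable_funU => //.
  exact: measurableU.
split => //; rewrite split1 ge0_integral_setU//; first last.
- apply/eqP/seteqP; split => // t /=; rewrite !in_itv/=.
  move=> [/andP[_ h] [/andP[h' _]|h']]; first by have := le_lt_trans h h'; rewrite ltxx.
  by have := lt_le_trans (ht n) (eq_ind t (fun x => x <= tau n) h _ h'); rewrite ltxx.
- by move=> t _; rewrite lee_fin.
- by rewrite -split1.
- exact: measurableU.
rewrite ephi ge0_integral_setU//; first last.
- apply/eqP/seteqP; split => // t /=; rewrite !in_itv/= => -[/andP[_ h] h'].
  by rewrite h' ltxx in h.
- by move=> t _; rewrite lee_fin.
rewrite integral_set1 adde0 big_ord_recr/= EFinD; congr (_ + _)%E.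
rewrite (eq_integral (cst (c n)%:E)); last first.
  by move=> t; rewrite inE/= in_itv/= => h; rewrite (hc n).
rewrite integral_cst//= lebesgue_measure_itv/= lte_fin ht -EFinD -EFinM.
by rewrite mulrC.
Qed.

Definition ramp (a b t : R) : R := Num.min (Num.max t a) b - a.

Lemma ramp_le a b t : a <= b -> t <= a -> ramp a b t = 0.
Proof. by move=> ab ta; rewrite /ramp (max_idPr ta) (min_idPl ab) subrr. Qed.

Lemma ramp_ge a b t : a <= b -> b <= t -> ramp a b t = b - a.
Proof.
move=> ab bt; rewrite /ramp (max_idPl (le_trans ab bt)).
by rewrite (min_idPr bt).
Qed.

Lemma ramp_mid a b t : a <= t <= b -> ramp a b t = t - a.
Proof.
by move=> /andP[at_ tb]; rewrite /ramp (max_idPl at_) (min_idPl tb).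
Qed.

Lemma ramp_ge0 a b t : a <= b -> 0 <= ramp a b t.
Proof. by move=> ab; rewrite /ramp subr_ge0 le_min ab le_max lexx orbT. Qed.

Lemma ramp_lip a b s t : s <= t -> 0 <= ramp a b t - ramp a b s <= t - s.
Proof.
move=> st; rewrite /ramp.
by case: (leP t a) => ?; case: (leP s a) => ?;
  case: (leP a b) => ?; case: (leP t b) => ?; case: (leP s b) => ?;
  apply/andP; split; lra.
Qed.

(** As a sum of ramps with nonnegative coefficients, its Lipschitz bound, its local slope and lower
    bounds for its values are read off term by term. *)
Definition polygon (r : R) (tau s : nat -> R) (n : nat) (t : R) : R :=
  r + \sum_(j < n) s j * ramp (tau j) (tau j.+1) t.

Lemma absolutely_continuous_polygon r tau s n a b : (forall j, 0 <= s j) ->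
  absolutely_continuous a b (polygon r tau s n).
Proof.
move=> s0 e e0; pose L := 1 + \sum_(j < n) s j.
have L1 : 1 <= L by rewrite lerDl; apply: sumr_ge0 => i _; exact: s0.
exists (e / L); first by rewrite divr_gt0//; lra.
move=> k x y hxy _ hsum.
apply: (@le_lt_trans _ _ (\sum_(i < k) L * (y i - x i))); last first.
  by rewrite -mulr_sumr mulrC -ltr_pdivlMr//; lra.
apply: ler_sum => i _; have [_ [xy _]] := hxy i.
rewrite /polygon opprD addrACA subrr add0r -sumrB.
under eq_bigr do rewrite -mulrBr.
have h j := ramp_lip (tau j) (tau j.+1) xy.
rewrite ger0_norm; last first.
  by apply: sumr_ge0 => j _; rewrite mulr_ge0//; case/andP: (h j).
apply: (@le_trans _ _ ((\sum_(j < n) s j) * (y i - x i))); last first.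
  by apply: ler_wpM2r; rewrite ?subr_ge0 ?lerDr.
rewrite mulr_suml; apply: ler_sum => j _; apply: ler_wpM2l => //.
by case/andP: (h j).
Qed.

Lemma incr_le (tau : nat -> R) i j : (forall j, tau j < tau j.+1) -> (i <= j)%N ->
  tau i <= tau j.
Proof.
move=> ht; elim: j => [|j IH]; first by rewrite leqn0 => /eqP->.
rewrite leq_eqVlt => /predU1P[->//|ij].
by apply: le_trans (IH ij) (ltW (ht j)).
Qed.

Lemma derive1_polygon r tau s n j t : (forall j, tau j < tau j.+1) ->
  (j < n)%N -> tau j < t < tau j.+1 -> derive1 (polygon r tau s n) t = s j.
Proof.
move=> ht jn /andP[jt tj].
pose q := polygon r tau s n t.
have tl k (ht' := ht k) : tau k <= tau k.+1 := ltW ht'.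
have loc : \forall x \near t, q + s j * (x - t) = polygon r tau s n x.
  have : \forall x \near t, x \in `]tau j, tau j.+1[.
    by apply: near_in_itvoo; rewrite in_itv/= jt.
  apply: filterS => x; rewrite in_itv/= => /andP[jx xj].
  rewrite /q /polygon -addrA; congr (_ + _).
  apply/eqP; rewrite eq_sym addrC -subr_eq -sumrB; apply/eqP.
  rewrite (bigD1 (Ordinal jn))//= big1 ?addr0.
    by rewrite -mulrBr !ramp_mid ?(ltW jt) ?(ltW tj) ?(ltW jx) ?(ltW xj)//; congr (_ * _); ring.
  move=> i ij; have {}ij : nat_of_ord i != j by [].
  move: ij; rewrite neq_ltn => /orP[] h.
    have h1 := incr_le ht h.
    rewrite !ramp_ge ?subrr//; apply: le_trans h1 _; exact: ltW.
  have h1 := incr_le ht h.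
  rewrite !ramp_le ?subrr//; (apply: le_trans h1; exact: ltW).
have dq : is_derive t 1 (fun x => q + s j * (x - t)) (s j).
  apply: is_derive_eq; rewrite /GRing.scale/=; ring.
have dp := near_eq_is_derive loc dq.
by rewrite derive1E; case: dp.
Qed.

End piecewise_linear.

Section majorant.
Context (R : realType).
Local Notation mu := (@lebesgue_measure R).
Variables (psi f : R -> R) (r T dl A : R) (M : nat) (v : nat -> R).
Hypothesis psi_ge0 : forall u, 0 <= psi u.
Hypothesis TM : T <= M.+1%:R.
Hypothesis dl0 : 0 < dl < 1.
Hypothesis A0 : 0 <= A.
Hypothesis v0 : forall j, 0 <= v j.

(** The nodes are 0, [dl], 1, 2, 3 and so on: the polygon climbs by [A] before [dl], is flat until
    1, and has slope [v j] on [[j + 1, j + 2]]. *)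
Let tau (k : nat) : R := if k is k'.+1 then if k' is k''.+1 then k''.+1%:R else dl else 0.
Let s (k : nat) : R := if k is k'.+1 then if k' is k''.+1 then v k'' else 0 else A / dl.

Let tau_lt j : tau j < tau j.+1.
Proof.
have /andP[d0 d1] := dl0.
by case: j => [|[|j]] //=; rewrite ltr_nat.
Qed.

Let s_ge0 j : 0 <= s j.
Proof.
have /andP[d0 d1] := dl0.
by case: j => [|[|j]] //=; rewrite divr_ge0// ltW.
Qed.

Let h := polygon r tau s M.+2.

Let ramp_tau_ge0 j t : 0 <= ramp (tau j) (tau j.+1) t.
Proof. by apply: ramp_ge0; exact: ltW. Qed.

(** On each piece the path is compared only with the value of the nondecreasing polygon at the left
    end, which is why the sum in the third condition stops before [v i]. *)
Lemma min_energy_le :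
  (forall t, 0 <= t <= dl -> f t <= r) ->
  (forall t, 0 <= t <= 1 -> f t <= r + A) ->
  (forall i t, (i < M)%N -> i.+1%:R <= t <= i.+2%:R ->
     f t <= r + A + \sum_(j < i) v j) ->
  (min_energy psi f T r <=
   (dl * psi (A / dl) + (1 - dl) * psi 0 + \sum_(i < M) psi (v i))%:E)%E.
Proof.
move=> f1 f2 f3; have /andP[d0 d1] := dl0.
have [mphi ephi] := @step_integral R (fun t => psi (derive1 h t)) tau
  (fun j => psi (s j)) M.+2 (fun t => psi_ge0 _) tau_lt
  (fun j t jM jt => congr1 psi (derive1_polygon r s tau_lt jM jt)).
have energy_le : (energy psi T h <=
   (dl * psi (A / dl) + (1 - dl) * psi 0 + \sum_(i < M) psi (v i))%:E)%E.
  apply: (@le_trans _ _ (\int[mu]_(t in `[tau 0%N, tau M.+2]) (psi (derive1 h t))%:E)%E).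
    apply: ge0_subset_integral => //.
    - by move=> t _; rewrite lee_fin.
    - by move=> t /=; rewrite !in_itv/= => /andP[-> tT]/=; exact: le_trans tT TM.
  rewrite ephi lee_fin !big_ord_recl/= subr0 !addrA lerD2l.
  apply: ler_sum => i _; rewrite /bump/= !add1n/=.
  by rewrite -[X in X - _]natr1 addrAC subrr add0r mul1r.
apply: le_trans energy_le; apply: ereal_inf_lbound; exists h => //; split.
- by apply: absolutely_continuous_polygon.
- rewrite /h /polygon big1 ?addr0// => j _; rewrite ramp_le ?mulr0//.
    exact/ltW/tau_lt.
  by have := incr_le tau_lt (leq0n j).
move=> t /andP[t0 tT].
have hge k : (k <= M.+2)%N -> tau k <= t ->
    r + \sum_(j < k) s j * (tau j.+1 - tau j) <= h t.
  move=> kM kt; rewrite /h /polygon lerD2l -(subnKC kM) big_split_ord/=.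
  rewrite -[leLHS]addr0; apply: lerD; last first.
    by apply: sumr_ge0 => j _; rewrite mulr_ge0.
  apply: ler_sum => j _; rewrite ramp_ge//; first exact/ltW/tau_lt.
  by apply: le_trans kt; exact: incr_le tau_lt (ltn_ord j).
have [td|dt] := leP t dl.
  apply: le_trans (f1 t _) _; first by rewrite t0.
  by have := hge 0%N isT t0; rewrite big_ord0 addr0.
have [t1|lt1] := leP t 1.
  apply: le_trans (f2 t _) _; first by rewrite t0.
  have := hge 1%N isT (ltW dt).
  by rewrite big_ord1/= subr0 divfK// gt_eqF.
pose k := Num.truncn t.
have /andP[kt tk] := truncn_itv t0; rewrite -/k in kt tk.
have k0 : (0 < k)%N by rewrite /k truncn_gt0 ltW.
(* When [T = M.+1] the time [t] may be the last node; it is then treated as the right end of the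
   last interval. *)
have kM : (k <= M)%N \/ k = M.+1.
  have : (k <= M.+1)%N by rewrite -(ler_nat R) (le_trans kt)// (le_trans tT).
  by rewrite leq_eqVlt => /predU1P[->|]; [right|left].
have sumE i : \sum_(j < i.+2) s j * (tau j.+1 - tau j) = A + \sum_(j < i) v j.
  rewrite !big_ord_recl/= subr0 divfK ?gt_eqF// mul0r add0r; congr (_ + _).
  apply: eq_bigr => j _; rewrite /bump/= !add1n/=.
  by rewrite -[X in X - _]natr1 addrAC subrr add0r mulr1.
have [i [iM it]] : exists i, (i < M)%N /\ i.+1%:R <= t <= i.+2%:R.
  case: kM => [kM|kM].
    by exists k.-1; rewrite !prednK// kM kt ltW.
  exists M.-1; rewrite kM in kt.
  have M0 : (0 < M)%N.
    rewrite lt0n; apply/eqP => M0; move: (le_trans tT TM).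
    by rewrite M0 leNgt lt1.
  rewrite !prednK//; split; first exact: leqnn.
  apply/andP; split.
    by apply: le_trans kt; rewrite ler_nat.
  by apply: le_trans (le_trans tT TM) _.
apply: le_trans (f3 i t iM it) _.
rewrite -addrA -sumE; apply: hge; first by rewrite ltnS ltnW.
by case/andP: it.
Qed.

End majorant.

(** * Scales at which a barrier is cheap *)

Section scales.
Context (R : realType) (psi theta c eps g : R -> R).
Variables (kappa alpha xi_lower xi_upper : R).
Local Notation mu := (@lebesgue_measure R).
Hypothesis kappa_range : 1 <= kappa < 2.
Hypothesis psi_pos : forall u, 0 < u -> psi u = u `^ kappa * theta u.
Hypothesis theta_karamata : karamata_representation theta c eps.
Hypothesis alpha_range : 0 < alpha < 1.
Hypothesis eps_small : \forall v \near 0^'+, `|eps v| < (`|ln v| `^ alpha)^-1.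
Hypothesis g_sv : slowly_varying_at_infty g.
Hypothesis xi_lower_gt0 : 0 < xi_lower.
Hypothesis xi_upper_gt0 : 0 < xi_upper.
Hypothesis g_lower :
  (fun b : R => (ln b) `^ (- xi_lower)) =O_ (pinfty_filter R) g.
Hypothesis g_upper :
  g =O_ (pinfty_filter R) (fun b : R => (ln b) `^ (- xi_upper)).
Hypothesis g_diverges : \forall A \near +oo_R,
    (\int[mu]_(b in `[A, +oo[) (g b `^ (2 - kappa)^-1 / b)%:E = +oo)%E.

(** With [y = L^(alpha / 2)] the left-hand side is [O(y)], whereas the right-hand side is
    [y^2 / 4^alpha]. *)
Lemma ln_powR_bound (C1 C2 : R) : 0 <= C2 -> exists L0, forall L, L0 <= L ->
  4 <= L /\ C1 + C2 * ln L <= (L / 4) `^ alpha.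
Proof.
have /andP[a0 a1] := alpha_range.
move=> C20; pose D := (`|C1| + C2 * (2 / alpha)) * 4 `^ alpha.
have q0 : 0 < 4 `^ alpha :> R by rewrite powR_gt0.
have D0 : 0 <= D.
  by rewrite mulr_ge0 ?(ltW q0)// addr_ge0// mulr_ge0// divr_ge0// ltW.
exists (4 + (1 + D) `^ (2 / alpha)) => L hL.
have z0 : 0 <= (1 + D) `^ (2 / alpha) by exact: powR_ge0.
have L4 : 4 <= L by lra.
split => //; have L0 : 0 < L by lra.
pose y := L `^ (alpha / 2).
have yD : 1 + D <= y.
  have -> : 1 + D = ((1 + D) `^ (2 / alpha)) `^ (alpha / 2).
    rewrite -powRrM (_ : 2 / alpha * (alpha / 2) = 1) ?powRr1//; first by lra.
    by field; rewrite gt_eqF.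
  apply: ge0_ler_powR; rewrite ?nnegrE//; [|exact: ltW|by lra].
  by rewrite divr_ge0// ltW.
have lnL : ln L <= 2 / alpha * y.
  have : ln y <= y.
    have y0 : 0 < y by lra.
    by have := ln_sublinear y0; move=> /ltW.
  rewrite /y ln_powR => h.
  have -> : ln L = 2 / alpha * (alpha / 2 * ln L) by field; rewrite gt_eqF.
  by apply: ler_wpM2l => //; rewrite divr_ge0// ltW.
have -> : (L / 4) `^ alpha = y ^+ 2 / 4 `^ alpha.
  rewrite powRM ?invr_ge0 ?(ltW L0)//; congr (_ * _).
    by rewrite exprn_powR ?(ltW L0)// /y -powR_mulrn ?(ltW L0)// -powRrM; congr powR; field.
  by rewrite -(powR_inv1 (ler0n R 4)) -powRrM mulN1r powRN.
rewrite ler_pdivlMr//.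
have h1 : C1 + C2 * ln L <= (`|C1| + C2 * (2 / alpha)) * y.
  rewrite mulrDl; apply: lerD.
    by apply: le_trans (ler_norm _) _; rewrite ler_peMr//; lra.
  by rewrite -mulrA ler_wpM2l.
apply: (@le_trans _ _ (D * y)).
  rewrite /D -mulrA (mulrC _ y) mulrA; apply: ler_wpM2r => //; exact: ltW.
by rewrite expr2 ler_wpM2r; lra.
Qed.

Definition normalization T := T * psi (T `^ (- 2^-1)) * g T.

Lemma scales_with_cost : exists2 dl0, 0 < dl0 & forall dl, 0 < dl <= dl0 ->
  exists (T : nat -> R) (l0 : nat),
    let p := fun l => dl * g (T l) `^ (2 - kappa)^-1 in
    let b := fun l => Num.sqrt (T l) * p l in
  (forall l, (l0 <= l)%N -> [/\ 4 ^+ l <= T l <= 4 ^+ l.+1, 0 < p l <= 1,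
     1 <= b l, 2 ^+ l <= b l ^+ 2 &
     scale_cost psi (b l) <= 16 * dl `^ (2 - kappa) * normalization (T l)]) /\
  (forall m M, (l0 <= m)%N -> exists n, M <= \sum_(l <- iota m n) p l).
Proof.
have /andP[k1 k2] := kappa_range; have /andP[a0 a1] := alpha_range.
have [A [M [c0 [A1 M0 c00 mg hg]]]] :=
  slow_bounds g_sv xi_upper_gt0 g_lower g_upper.
have [v0 v00 hv0] := karamata_compare theta_karamata alpha_range eps_small.
have [T [l0 [hT1 hT2]]] :=
  scales_exist k2 g_sv xi_upper_gt0 g_lower g_upper g_diverges.
pose e := (2 - kappa)^-1.
have e0 : 0 < e by rewrite invr_gt0 subr_gt0.
pose G b := g b `^ e.
have Me0 : 0 < M `^ e by rewrite powR_gt0.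
(* Together with [g <= M] this choice gives [p <= 1]. *)
exists (M `^ e)^-1; first by rewrite invr_gt0.
move=> dl /andP[dl0 dlM].
have [L0 hL0] := @ln_powR_bound (- ln dl - e * ln c0) (e * xi_lower)
  (mulr_ge0 (ltW e0) (ltW xi_lower_gt0)).
pose X := expR 1 + A + expR L0 + v0^-1 ^+ 4 + 1.
have [l1 hl1] : exists l1, X < 4 ^+ l1.
  exists (Num.truncn X).+1; apply: lt_le_trans (truncnS_gt X) _.
  by rewrite -natrX ler_nat ltnW// ltn_expl.
exists T, (maxn l0 l1) => p b; split; last first.
  move=> m K lm; have [|n hn] := hT2 m (K / dl).
    exact: leq_trans (leq_maxl _ _) lm.
  exists n; rewrite /p -mulr_sumr mulrC -ler_pdivrMr//.
move=> l; rewrite geq_max => /andP[ll0 ll1].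
have Tl := hT1 l ll0; have /andP[T4 _] := Tl.
set t := T l in Tl T4 *.
have XT : X < t.
  apply: lt_le_trans hl1 (le_trans _ T4).
  by rewrite ler_weXn2l// ler1n.
have v4 : 0 < v0^-1 ^+ 4 by rewrite exprn_gt0// invr_gt0.
have ee := expR_gt0 (1 : R); have eL := expR_gt0 L0.
have tA : A <= t by rewrite /X in XT; lra.
have t0 : 0 < t by lra.
have [_ gt0 gM gc] := hg t tA.
have pl0 : 0 < p l by rewrite mulr_gt0// powR_gt0.
have pl1 : p l <= 1.
  apply: (@le_trans _ _ ((M `^ e)^-1 * M `^ e)); last by rewrite mulVf// gt_eqF.
  apply: ler_pM; rewrite ?powR_ge0 ?(ltW dl0)//.
  by apply: ge0_ler_powR => //; rewrite ?nnegrE; exact: ltW.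
have st0 : 0 < Num.sqrt t by rewrite sqrtr_gt0.
have b0 : 0 < b l by rewrite mulr_gt0.
have lnt0 : L0 <= ln t.
  by rewrite -[leLHS]expRK ler_ln ?posrE ?expR_gt0//; rewrite /X in XT; lra.
have [L4 hln] := hL0 _ lnt0.
(* By the lower bound on [g], [- ln p] is of order at most [ln (ln t)]. The bound is used twice: it
   gives [ln b >= ln t / 4], hence [t <= b^4], and then [- ln p <= (ln b)^alpha], which is the
   condition of [karamata_compare] for [1 / sqrt t] and [1 / b]. This is also the origin of the
   4. *)
have lnp : - ln (p l) <= (ln t / 4) `^ alpha.
  apply: le_trans hln; rewrite /p lnM ?posrE ?powR_gt0// ln_powR.
  have h : ln c0 - xi_lower * ln (ln t) <= ln (g t).
    rewrite -lerN2 opprB -lerN2 !opprK opprB.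
    have lt0 : 0 < ln t by lra.
    have <- : ln (c0 * ln t `^ (- xi_lower)) = ln c0 - xi_lower * ln (ln t).
      by rewrite lnM ?posrE ?powR_gt0// ln_powR mulNr.
    by rewrite ler_ln// posrE mulr_gt0// powR_gt0.
  have := ler_wpM2l (ltW e0) h.
  rewrite -/e mulrBr mulrA; lra.
have lt4 : (ln t / 4) `^ alpha <= ln t / 4.
  by apply: ler1_powR; lra.
have lnst : ln (Num.sqrt t) = ln t / 2.
  by rewrite -[in RHS](sqr_sqrtr (ltW t0)) lnXn// -(mulr_natr (ln _)) mulfK.
have lnb : ln t / 4 <= ln (b l).
  rewrite /b lnM ?posrE// lnst; lra.
have b1 : 1 <= b l.
  by rewrite -[leRHS](lnK b0) -[leLHS]expR0 ler_expR; lra.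
have b4 : t <= b l ^+ 4.
  rewrite -[leLHS](lnK t0) -[X in _ <= X ^+ _](lnK b0) -expRM_natl ler_expR.
  by rewrite -mulr_natl in lnb *; lra.
split => //.
- by rewrite pl0.
- have : 2 ^+ l ^+ 2 <= (b l ^+ 2) ^+ 2.
    rewrite -!exprM mulnC exprM; apply: le_trans b4; apply: le_trans T4.
    by rewrite (_ : 2 ^+ 2 = 4)//; ring.
  by rewrite ler_pXn2r ?nnegrE ?exprn_ge0// ltW.
rewrite /scale_cost.
pose u := (Num.sqrt t)^-1; pose v := (b l)^-1.
have u0 : 0 < u by rewrite invr_gt0.
have v_gt0 : 0 < v by rewrite invr_gt0.
have uv : u <= v by rewrite lef_pV2 ?posrE// ler_piMr// ltW.
have vv0 : v <= v0.
  rewrite -[leRHS]invrK lef_pV2 ?posrE ?invr_gt0//.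
  rewrite -(ler_pXn2r (isT : (0 < 4)%N)) ?nnegrE ?invr_ge0 ?(ltW v00) ?(ltW b0)//.
  by apply: le_trans b4; rewrite /X in XT; lra.
have lnvu : ln (v / u) <= `|ln v| `^ alpha.
  have -> : v / u = (p l)^-1.
    by rewrite /v /u /b; field; rewrite !gt_eqF.
  rewrite lnV ?posrE//; apply: le_trans lnp _.
  rewrite /v lnV ?posrE// normrN ger0_norm ?ln_ge0//.
  by apply: ge0_ler_powR; rewrite ?nnegrE ?ln_ge0 ?(ltW a0)//; lra.
have th := hv0 u v u0 uv vv0 lnvu.
have uE : t `^ (- 2^-1) = u.
  by rewrite powRN powR12_sqrt// ltW.
rewrite /normalization uE !psi_pos//.
(* The definition of [p] is made for this identity: [p^(2 - kappa)] is [dl^(2 - kappa) g(t)]. *)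
have key : b l ^+ 2 * v `^ kappa = dl `^ (2 - kappa) * (t * u `^ kappa * g t).
  have pE : p l `^ (2 - kappa) = dl `^ (2 - kappa) * g t.
    rewrite /p powRM ?powR_ge0 ?(ltW dl0)// -powRrM mulVf ?powRr1 ?(ltW gt0)//.
    by rewrite gt_eqF// subr_gt0.
  have invE x : 0 < x -> x ^+ 2 * (x^-1) `^ kappa = x `^ (2 - kappa).
    move=> x0; rewrite -(powR_inv1 (ltW x0)) -powRrM mulN1r -(powR_mulrn 2 (ltW x0)).
    by rewrite -powRD// (gt_eqF x0) implybT.
  rewrite invE// /b powRM ?(ltW st0) ?(ltW pl0)// pE -(invE _ st0).
  rewrite sqr_sqrtr ?(ltW t0)// -/u; ring.
rewrite mulrA key.
apply: (@le_trans _ _ (dl `^ (2 - kappa) * (t * u `^ kappa * g t) * (16 * theta u))).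
  apply: ler_wpM2l => //; rewrite mulr_ge0 ?powR_ge0// mulr_ge0 ?(ltW gt0)//.
  by rewrite mulr_ge0 ?powR_ge0// ltW.
by rewrite le_eqVlt; apply/orP; left; apply/eqP; ring.
Qed.

End scales.

(** * Majorant of the path after a success *)

Section majorant_of_success.
Context (R : realType) (psi f : R -> R) (r dl Cg B : R) (i0 : nat).
Hypothesis psi_ge0 : forall u, 0 <= psi u.
Hypothesis psi0 : psi 0 = 0.
Hypothesis psi_nd : forall u v, 0 <= u -> u <= v -> psi u <= psi v.
Hypothesis psi_add : forall x y, 0 <= x -> 0 <= y ->
  psi (x + y) <= psi (2 * x) + psi (2 * y).
Hypothesis dl0 : 0 < dl < 1.
Hypothesis r0 : 0 < r.
Hypothesis Cg0 : 0 <= Cg.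
Hypothesis B0 : 0 <= B.
Hypothesis f0 : f 0 = 0.
Hypothesis f_start : forall t, 0 <= t <= dl -> f t <= r.
Hypothesis f_growth : forall k : nat, f k%:R <= Cg + k%:R.
Hypothesis f_osc : forall i, (i0 <= i)%N -> forall k t, (k < 4 ^ (i + 3))%N ->
  k%:R <= t <= k.+1%:R -> f t <= f k%:R + (4 * i)%:R.

(** [Cg + 4 i0 + 5] covers the path up to time 2, and [B] pays for [v 0], which is lost because the
    slopes only start at time 1. *)
Definition initial_rise : R := Cg + 4 * i0%:R + 5 + B.

(** During about [n = i^2 + i] steps an extra slope 8 beats the growth of the path, of rate 5.
    Afterwards it has gained [8 n], enough for the overshoots [4 i^2] and the oscillation [4 i].
    [psi_add] separates this slope from the barrier's, whence [psi 16] and the doubled [v]. *)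
Lemma min_energy_success (T : R) (M i : nat) (v : nat -> R) :
  T <= M.+1%:R -> (M.+1 <= 4 ^ (i + 3))%N -> (i0 <= i)%N ->
  (forall j, 0 <= v j <= B) ->
  (forall k, (k <= M.+1)%N -> f k%:R <= \sum_(j < k) v j + i%:R * (4 * i)%:R) ->
  (min_energy psi f T r <=
   (dl * psi (initial_rise / dl) + (i ^ 2 + i)%:R * psi 16 +
    \sum_(j < M.+1) psi (2 * v j))%:E)%E.
Proof.
move=> TM M4 i0i vB fv.
have v0 j : 0 <= v j by case/andP: (vB j).
have Cg0' := Cg0; have B0' := B0; have r0' := r0.
set A := initial_rise; set n := (i ^ 2 + i)%N.
have i00 : (0 : R) <= i0%:R by [].
have A0 : 0 <= A by rewrite !addr_ge0// mulr_ge0.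
pose u j : R := (if (j < n)%N then 8 else 0) + v j.+1.
have u0 j : 0 <= u j by rewrite addr_ge0//; case: ifP.
have sumu k : \sum_(j < k) u j =
    8 * (minn k n)%:R + \sum_(j < k) v j.+1.
  rewrite big_split/=; congr (_ + _); elim: k => [|k IH].
    by rewrite big_ord0 min0n mulr0.
  rewrite big_ord_recr/= IH; case: ifP => kn.
    rewrite (minn_idPl (ltnW kn)) (minn_idPl kn) -[k.+1]addn1 natrD; ring.
  have nk : (n <= k)%N by rewrite leqNgt kn.
  by rewrite addr0 (minn_idPr nk) (minn_idPr (leqW nk)).
(* The oscillation bound is taken at level [i0 + k], which grows with [k]; the rate is 1 from
   [f_growth] plus 4 from this level. *)
have early k t : k%:R <= t <= k.+1%:R -> f t <= Cg + 4 * i0%:R + 5 * k%:R.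
  move=> kt; have kl : (k < 4 ^ (i0 + k + 3))%N.
    apply: leq_trans (ltn_expl k (isT : (1 < 4)%N)) _.
    by rewrite leq_pexp2l// -addnA addnCA leq_addr.
  have := f_osc (leq_addr k i0) kl kt.
  by rewrite natrM natrD; have := f_growth k; lra.
have f2 t : 0 <= t <= 1 -> f t <= r + A.
  move=> t01.
  have i04 : (0 < 4 ^ (i0 + 3))%N by rewrite expn_gt0.
  have := f_osc (leqnn i0) i04 t01; rewrite f0 add0r natrM.
  rewrite /A /initial_rise; lra.
have f3 k t : (k < M)%N -> k.+1%:R <= t <= k.+2%:R ->
    f t <= r + A + \sum_(j < k) u j.
  move=> kM kt; rewrite sumu; have [kn|nk] := leqP k n.
    have := early k.+1 t kt; rewrite -[k.+1]addn1 natrD.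
    have : 0 <= \sum_(j < k) v j.+1 by apply: sumr_ge0 => j _; exact: v0.
    have : (0 : R) <= k%:R by [].
    rewrite /A /initial_rise; lra.
  have kM' : (k.+1 < 4 ^ (i + 3))%N by apply: leq_trans M4.
  have := f_osc i0i kM' kt; have := fv k.+1 (leqW kM).
  rewrite big_ord_recl/=.
  have := vB 0%N => /andP[_ v0B].
  have : (4 * i ^ 2 + 4 * i)%:R <= 8 * n%:R :> R.
    by rewrite -natrM ler_nat /n -mulnDr leq_mul2r orbT.
  have -> : i%:R * (4 * i)%:R = (4 * i ^ 2)%:R :> R.
    by rewrite -natrM mulnCA mulnn.
  rewrite natrD.
  under eq_bigr do rewrite /bump/= add1n.
  rewrite /A /initial_rise; lra.
apply: le_trans (min_energy_le psi_ge0 TM dl0 A0 u0 f_start f2 f3) _.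
rewrite psi0 mulr0 addr0 lee_fin -addrA lerD2l.
apply: (@le_trans _ _ (\sum_(j < M) ((if (j < n)%N then psi 16 else 0) + psi (2 * v j.+1)))).
  apply: ler_sum => j _; rewrite /u; case: ifP => _.
    by apply: le_trans (psi_add _ _) _ => //; rewrite -natrM.
  rewrite !add0r; apply: psi_nd => //; have := v0 j.+1; lra.
rewrite big_split/=; apply: lerD.
  rewrite -big_mkcond/= sumr_const -[leLHS]mulr_natl; apply: ler_wpM2r => //.
  rewrite ler_nat -sum1_card.
  apply: (@leq_trans (\sum_(j < M | (j < n)%N) 1)); first by [].
  rewrite -(big_mkord (fun j => (j < n)%N) (fun=> 1%N)) sum1_count.
  rewrite -size_filter; apply: (@leq_trans (size (iota 0 n))); last by rewrite size_iota.
  apply: uniq_leq_size; first by rewrite filter_uniq// iota_uniq.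
  by move=> j; rewrite mem_filter !mem_iota => /andP[-> _].
by rewrite big_ord_recl/= lerDr.
Qed.

End majorant_of_success.

Section sums.
Context (R : realType).

(** [s^i] is the cube of [exp(i ln s / 3)], hence at least a multiple of [i^3]. *)
Lemma quadratic_le_exponential (a b c s : R) : 1 < s -> 0 < c ->
  exists i0, forall i, (i0 <= i)%N -> a + b * i%:R ^+ 2 <= c * s ^+ i.
Proof.
move=> s1 c0; have s0 : 0 < s by lra.
have ls : 0 < ln s by exact: ln_gt0.
pose k := c * (ln s / 3) ^+ 3.
have k0 : 0 < k by rewrite mulr_gt0// exprn_gt0// divr_gt0.
exists (Num.truncn ((`|a| + `|b|) / k)).+1 => i hi.
have i1 : 1 <= i%:R :> R by rewrite ler1n (leq_trans _ hi).
have hk : (`|a| + `|b|) / k < i%:R.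
  by apply: lt_le_trans (truncnS_gt _) _; rewrite ler_nat.
rewrite ltr_pdivrMr// in hk.
apply: (@le_trans _ _ ((`|a| + `|b|) * i%:R ^+ 2)).
  rewrite mulrDl; apply: lerD.
    apply: le_trans (ler_norm _) _; rewrite ler_peMr// expr_ge1//.
  by apply: ler_wpM2r; [exact: sqr_ge0|exact: ler_norm].
apply: (@le_trans _ _ (k * i%:R ^+ 3)).
  have -> : k * i%:R ^+ 3 = i%:R * k * i%:R ^+ 2 by ring.
  by apply: ler_wpM2r; [exact: sqr_ge0|exact: ltW].
rewrite /k -mulrA ler_pM2l// -exprMn.
rewrite -[in leRHS](lnK s0) -expRM_natl.
have -> : i%:R * ln s = 3%:R * (ln s / 3 * i%:R) by field.
rewrite expRM_natl ler_pXn2r ?nnegrE ?expR_ge0//.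
  by have := expR_ge1Dx (ln s / 3 * i%:R); lra.
by rewrite mulr_ge0// divr_ge0// ltW.
Qed.

Lemma sum_uniq_le (F : nat -> R) (s : seq nat) n : uniq s ->
  (forall l, l \in s -> (l < n)%N) -> (forall l, 0 <= F l) ->
  \sum_(l <- s) F l <= \sum_(l < n) F l.
Proof.
move=> us sn F0; rewrite -(big_mkord xpredT F) /index_iota subn0.
have ps : perm_eq s [seq l <- iota 0 n | l \in s].
  apply: uniq_perm => //; first by rewrite filter_uniq// iota_uniq.
  move=> l; rewrite mem_filter mem_iota/= add0n.
  by case: (boolP (l \in s)) => //= /sn ->.
rewrite (perm_big _ ps)/= big_filter big_mkcond/=.
by apply: ler_sum => l _; case: ifP.
Qed.

Lemma sum_geometric_rev (q : R) n : 0 <= q < 1 ->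
  \sum_(l < n.+1) q ^+ (n - l) <= (1 - q)^-1.
Proof.
move=> /andP[q0 q1]; have h : 0 < 1 - q by lra.
elim: n => [|n IH].
  by rewrite big_ord1 subnn expr0 -[leLHS]invr1 lef_pV2 ?posrE//; lra.
rewrite big_ord_recr/= subnn expr0.
under eq_bigr => l _ do rewrite subSn ?exprS ?(ltn_ord l : l <= n)%N//.
rewrite -mulr_sumr.
apply: (@le_trans _ _ (q * (1 - q)^-1 + 1)); first by rewrite lerD2r ler_wpM2l.
by rewrite le_eqVlt; apply/orP; left; apply/eqP; field; rewrite gt_eqF.
Qed.

End sums.

(** * Proof of the theorem *)

Section conclusion.
Context (R : realType) (d : measure_display) (Om : measurableType d)
  (P : probability Om R) (W : R -> {RV P >-> R}).
Hypothesis hW : wiener_process W.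
Variables (psi theta c eps g : R -> R) (kappa alpha xi_lower xi_upper : R).
Hypothesis psi_ge0 : forall u, 0 <= psi u.
Hypothesis psi_convex : convex_function [set: R^o] psi.
Hypothesis kappa_range : 1 <= kappa < 2.
Hypothesis psi_pos : forall u, 0 < u -> psi u = u `^ kappa * theta u.
Hypothesis theta_sv : slowly_varying_at0 theta.
Hypothesis theta_karamata : karamata_representation theta c eps.
Hypothesis alpha_range : 0 < alpha < 1.
Hypothesis eps_small : \forall v \near 0^'+, `|eps v| < (`|ln v| `^ alpha)^-1.
Hypothesis g_sv : slowly_varying_at_infty g.
Hypothesis xi_lower_gt0 : 0 < xi_lower.
Hypothesis xi_upper_gt0 : 0 < xi_upper.
Hypothesis g_lower :
  (fun b : R => (ln b) `^ (- xi_lower)) =O_ (pinfty_filter R) g.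
Hypothesis g_upper :
  g =O_ (pinfty_filter R) (fun b : R => (ln b) `^ (- xi_upper)).
Hypothesis g_diverges : \forall A \near +oo_R,
    (\int[lebesgue_measure]_(b in `[A, +oo[)
       (g b `^ (2 - kappa)^-1 / b)%:E = +oo)%E.
Variable r : R.
Hypothesis r_gt0 : 0 < r.

(** The room [r] at time 0 leaves a positive, path-dependent time in which the majorant can climb
    with a finite slope. *)
Lemma path_starts_low w : W 0 w = 0 ->
  {within `[0, +oo[, continuous (fun t : R => W t w)} ->
  exists2 dl, 0 < dl < 1 & forall t, 0 <= t <= dl -> W t w <= r.
Proof.
move=> w0 /continuous_within_itvcyP[_]; rewrite w0 => /cvgrPdist_le /(_ r r_gt0).
move=> /near_right0[e e0 he].
exists (Num.min e 1 / 2).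
  have : 0 < Num.min e 1 by rewrite lt_min e0 ltr01.
  have : Num.min e 1 <= 1 by rewrite ge_min lexx orbT.
  lra.
move=> t /andP[]; rewrite le_eqVlt => /predU1P[<- _|t0 te].
  by rewrite w0 ltW.
have me : Num.min e 1 <= e by rewrite ge_min lexx.
have m0 : 0 < Num.min e 1 by rewrite lt_min e0 ltr01.
have := he t ltac:(by rewrite t0/=; lra).
by rewrite sub0r normrN; apply: le_trans; exact: ler_norm.
Qed.

Lemma small_energy_often e : 0 < e -> {ae P, forall w, forall T0, exists2 T,
  T0 < T &
  (min_energy psi (fun t => W t w) T r <= (e * normalization psi g T)%:E)%E}.
Proof.
move=> e0; have /andP[k1 k2] := kappa_range.
have four_bound (x y : R) : 1 <= y -> x <= y + 1 -> x <= 4 * y.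
  by move=> *; lra.
have pow_bound (x y : R) : 1 <= y -> x <= 4 * y -> x + 1 <= y * 4 ^+ 3.
  by move=> *; lra.
have good_bound (x y M : R) : x <= 2 * y -> 48 * M <= x -> M <= y / 24.
  by move=> *; lra.
have sq_bound (n : nat) : (n ^ 2 + n <= 2 * n ^ 2)%N.
  by rewrite mul2n -addnn leq_add2l; case: n => // n; rewrite -mulnn leq_pmulr.
have threequarters : 0 <= 3 / 4 :> R /\ 3 / 4 <= 1 :> R by split; lra.
(* [kp] is the midpoint of [kappa] and 2, and [zeta] that of 1/2 and [1 / kp]. *)
pose kp := (kappa + 2) / 2; pose zeta := (2^-1 + kp^-1) / 2.
have kp12 : 1 < kp < 2 by rewrite /kp; lra.
have /andP[kp1 kp2] := kp12.
have kpV : 2^-1 < kp^-1 < 1.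
  by rewrite invf_lt1 ?ltf_pV2 ?posrE ?kp1 ?kp2//; lra.
have /andP[kpV1 kpV2] := kpV.
have z : 2^-1 < zeta < 1 by rewrite /zeta; lra.
have zk : zeta * kp < 1.
  have : zeta < kp^-1 by rewrite /zeta; lra.
  by rewrite -(ltr_pM2r (_ : 0 < kp)) ?mulVf//; lra.
have potter U : exists2 C, 0 < C &
    forall u v, 0 < u -> u <= v -> v <= U -> psi v <= C * (v / u) `^ kp * psi u.
  apply: (psi_potter psi_ge0 psi_convex kappa_range psi_pos theta_sv).
  by rewrite /kp; lra.
have psi0' := psi0 psi_ge0 psi_convex kappa_range psi_pos theta_sv.
have psi_nd' := psi_nd psi_ge0 psi_convex kappa_range psi_pos theta_sv.
have psi_gt0' := psi_gt0 psi_ge0 psi_convex kappa_range psi_pos theta_sv.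
have psi_add' := psi_add psi_ge0 psi_convex kappa_range psi_pos theta_sv.
have /andP[z0 z1] := z.
pose K := barrier_const zeta.
have K1 : 1 <= K by exact: barrier_const_ge1.
have [C1 C10 hC1] := slope_cost psi_ge0 psi0' kp12 potter z zk K1.
have [C2 C20 hC2] := scale_cost_decay psi_ge0 kp12 potter psi_nd' (ltr0n R 8).
have [cg cg0 hcg] := scale_cost_growth kp12 potter (psi_gt0' _ ltr01).
pose rho : R := (3 / 4) `^ (2 - kp).
have rho01 : 0 <= rho < 1.
  rewrite powR_ge0/= /rho powRE; last lra.
  rewrite expR_lt1 pmulr_rlt0; last lra.
  by apply: ln_lt0; lra.
have /andP[rho0 rho1] := rho01.
pose C3 := C1 * (C2 / (1 - rho)).
have C30 : 0 < C3 by rewrite mulr_gt0// divr_gt0// subr_gt0.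
have [dl0 dl00 hdl] := scales_with_cost kappa_range psi_pos
  theta_karamata alpha_range eps_small g_sv xi_lower_gt0 xi_upper_gt0 g_lower
  g_upper g_diverges.
have f0 : 0 < e / (32 * C3) by rewrite divr_gt0// mulr_gt0.
(* This gives [16 dl^(2 - kappa) <= e / (2 C3)]; the 2 is there because the barriers and the initial
   stretch each cost at most [C3 * scale_cost psi (b i)]. *)
pose dl := Num.min dl0 ((e / (32 * C3)) `^ (2 - kappa)^-1).
have dl_gt0 : 0 < dl by rewrite lt_min dl00 powR_gt0.
have dle : dl `^ (2 - kappa) <= e / (32 * C3).
  have k2' : 0 <= 2 - kappa by rewrite subr_ge0 ltW.
  apply: (@le_trans _ _ (((e / (32 * C3)) `^ (2 - kappa)^-1) `^ (2 - kappa))).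
    apply: ge0_ler_powR => //; rewrite ?nnegrE ?powR_ge0 ?(ltW dl_gt0)//.
    by rewrite ge_min lexx orbT.
  by rewrite -powRrM mulVf ?powRr1 ?(ltW f0)// gt_eqF// subr_gt0.
have [|T [l0 /= [hT hsum]]] := hdl dl.
  by rewrite dl_gt0 ge_min lexx.
set p := fun l => dl * g (T l) `^ (2 - kappa)^-1 in hT hsum.
pose b l := Num.sqrt (T l) * p l.
pose N l := (Num.truncn (T l)).+1.
pose sl l j := slope zeta K (b l) j.
have T1 l : (l0 <= l)%N -> 1 <= T l.
  move=> ll; have [/andP[h _] _ _ _ _] := hT l ll.
  by apply: le_trans h; rewrite exprn_ege1// ler1n.
have TN l : T l <= (N l)%:R by exact/ltW/truncnS_gt.
have NT l : (l0 <= l)%N -> (N l)%:R <= T l + 1.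
  move=> ll; rewrite /N -addn1 natrD lerD2r truncn_le.
  exact: le_trans (T1 l ll).
(* The 24 is 12 from [barrier_survival] times 2 from [sqrt (N l) <= 2 sqrt (T l)]. *)
have hq l s : (l0 <= l)%N -> p l / 24 <=
    pr P (survives (unit_incr W) (fun k => \sum_(j < k) sl l j) s (N l)).
  move=> ll; have [_ /andP[p0 p1] b1 _ _] := hT l ll.
  have t1 := T1 l ll; have nt := NT l ll; have tn := TN l.
  have st : 0 < Num.sqrt (T l) by rewrite sqrtr_gt0 (lt_le_trans ltr01).
  have sN : Num.sqrt (T l) <= Num.sqrt (N l)%:R by exact: ler_wsqrtr.
  have bN : b l <= Num.sqrt (N l)%:R.
    by apply: le_trans sN; rewrite /b ler_piMr// ltW.
  apply: le_trans (barrier_survival hW s z b1 bN).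
  have sN2 : Num.sqrt (N l)%:R <= 2 * Num.sqrt (T l).
    have -> : 2 * Num.sqrt (T l) = Num.sqrt (4 * T l).
      rewrite sqrtrM//; congr (_ * _).
      by rewrite (_ : 4 = 2 ^+ 2) ?sqrtr_sqr ?ger0_norm//; ring.
    by apply: ler_wsqrtr; exact: four_bound t1 nt.
  have sN0 : 0 < Num.sqrt (N l)%:R :> R by exact: lt_le_trans sN.
  have -> : p l / 24 = b l / (2 * Num.sqrt (T l)) / 12.
    by rewrite /b; field; rewrite gt_eqF.
  rewrite ler_pM2r ?invr_gt0//; apply: ler_wpM2l.
    by rewrite /b mulr_ge0// ltW.
  by rewrite lef_pV2 ?posrE// mulr_gt0.
(* Stated for every [m]: how far out the scales must start depends on the path, and the countably
   many null sets are discarded together. *)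
have success m : {ae P, forall w, exists n, ~ all_fail (unit_incr W)
    (fun l k => \sum_(j < k) sl l j) N 0
    [seq l <- iota (l0 + m) n | good p (l0 + m) l] w}.
  have p_gt0 l : (l0 + m <= l)%N -> 0 < p l.
    by move=> ml; have [_ /andP[]] := hT l (leq_trans (leq_addr _ _) ml).
  apply: (@ae_some_success _ _ _ P (unit_incr W) (unit_incr_indep hW)
    _ _ (fun l => p l / 24)).
    move=> n l s; rewrite mem_filter mem_iota => /and3P[_ ml _].
    by apply: hq; exact: leq_trans (leq_addr _ _) ml.
  move=> M; have [n hn] := hsum (l0 + m)%N (48 * M) (leq_addr _ _).
  exists n; rewrite -mulr_suml; have h := sum_good_ge p_gt0 n.
  by apply: good_bound hn; rewrite -ler_pdivrMl.
have path_facts : {ae P, forall w, [/\ W 0 w = 0,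
    {within `[0, +oo[, continuous (fun t : R => W t w)} &
    exists2 C, 0 <= C & forall k, walk (unit_incr W) 0 k w <= C + k%:R]}.
  by apply: filterS3 (wiener_start hW) (wiener_continuous hW)
    (path_linear_growth hW).
apply: filterS3 path_facts (path_oscillation hW) (ae_foralln success).
move=> w [w0 cw [Cg Cg0 grow]] [i0 osc] succ T0.
have [dt dt01 start] := path_starts_low w0 cw.
have growf k : W k%:R w <= Cg + k%:R.
  by have := grow k; rewrite walk_unit add0n w0 subr0.
have K0 : 0 <= K by exact: le_trans ler01 K1.
pose A := initial_rise Cg K i0.
(* As [b^2 >= 2^i], the growth [b^(2 - kp)] is at least [sg^i], which outweighs the quadratic cost
   of the initial stretch. *)
pose sg : R := 2 `^ ((2 - kp) / 2).
have sg1 : 1 < sg by apply: powR2_gt1; rewrite divr_gt0// subr_gt0.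
have [i1 hi1] := quadratic_le_exponential (dt * psi (A / dt)) (2 * psi 16) sg1
  (mulr_gt0 C30 cg0).
have [l2 hl2] : exists l2, T0 < 4 ^+ l2.
  exists (Num.truncn T0).+1; apply: lt_le_trans (truncnS_gt T0) _.
  by rewrite -natrX ler_nat ltnW// ltn_expl.
pose m := maxn i0 (maxn i1 l2).
have [n nf] := succ m.
have slB l j : 0 <= sl l j <= K by rewrite slope_ge0// slope_le.
have hc l k : l \in [seq l <- iota (l0 + m) n | good p (l0 + m) l] ->
    \sum_(j < k) psi (2 * sl l j) <= C1 * scale_cost psi (b l).
  rewrite mem_filter mem_iota => /and3P[_ ml _]; apply: hC1.
  by have [] := hT l (leq_trans (leq_addr _ _) ml).
have [L1 [i [L2 [v [LE vB cost walkb]]]]] := success_path slB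
  (fun x => psi_ge0 (2 * x)) hc nf.
have memL l : l \in rcons L1 i -> good p (l0 + m) l /\ (l0 + m <= l)%N.
  move=> lL; have : l \in [seq l <- iota (l0 + m) n | good p (l0 + m) l].
    by rewrite LE -cat_rcons mem_cat lL.
  by rewrite mem_filter mem_iota => /and3P[].
have [gi mi] : good p (l0 + m) i /\ (l0 + m <= i)%N.
  by apply: memL; rewrite mem_rcons inE eqxx.
have uL : uniq (rcons L1 i).
  have : uniq [seq l <- iota (l0 + m) n | good p (l0 + m) l].
    by rewrite filter_uniq// iota_uniq.
  by rewrite LE -cat_rcons cat_uniq => /and3P[].
have ltL l : l \in L1 -> (l < i)%N.
  have : sorted ltn [seq l <- iota (l0 + m) n | good p (l0 + m) l].
    by apply: sorted_filter; [exact: ltn_trans|exact: iota_ltn_sorted].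
  rewrite LE (sorted_pairwise ltn_trans) pairwise_cat => /and3P[/allrelP h _ _] lL.
  by apply: h => //; rewrite inE eqxx.
have leL l : l \in rcons L1 i -> (l < i.+1)%N.
  by rewrite mem_rcons inE => /predU1P[->//|/ltL/leqW].
have szL : (size L1 <= i)%N.
  rewrite -(size_iota 0 i); apply: uniq_leq_size.
    by move: uL; rewrite rcons_uniq => /andP[].
  by move=> l /ltL; rewrite mem_iota.
have l0i : (l0 <= i)%N by apply: leq_trans mi; exact: leq_addr.
have mi' : (m <= i)%N by apply: leq_trans mi; exact: leq_addl.
have i0i : (i0 <= i)%N by apply: leq_trans mi'; exact: leq_maxl.
have i1i : (i1 <= i)%N.
  by apply: leq_trans mi'; rewrite /m !leq_max leqnn orbT.
have l2i : (l2 <= i)%N.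
  by apply: leq_trans mi'; rewrite /m !leq_max leqnn !orbT.
have [/andP[T4 T5] /andP[p0 p1] b1 b2 scost] := hT i l0i.
exists (T i).
  apply: lt_le_trans hl2 (le_trans _ T4).
  by rewrite ler_weXn2l// ler1n.
have N4 : (N i <= 4 ^ (i + 3))%N.
  rewrite -(ler_nat R); apply: le_trans (NT i l0i) _.
  rewrite natrX exprD; rewrite exprS in T5.
  have h4 : 1 <= (4 : R) ^+ i by rewrite exprn_ege1// ler1n.
  exact: pow_bound h4 T5.
(* Every increment in this range is at most [4 i] by the oscillation bound, and there are at most
   [i] failures since their indices are distinct and below [i]. *)
have fv k : (k <= N i)%N -> W k%:R w <= \sum_(j < k) v j + i%:R * (4 * i)%:R.
  move=> kN; have := walkb (4 * i)%:R k (ler0n _ _) kN.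
  rewrite walk_unit add0n w0 subr0 => h; apply: le_trans (h _) _.
    move=> j jk; rewrite /unit_incr /incr /=.
    have j4 : (j < 4 ^ (i + 3))%N by rewrite (leq_trans jk)// (leq_trans kN).
    have := osc i i0i j j.+1%:R j4; rewrite ler_nat leqnSn lexx => /(_ isT).
    by rewrite lerBlDl.
  by rewrite lerD2l ler_wpM2r// ler_nat.
apply: le_trans (min_energy_success psi_ge0 psi0' psi_nd' psi_add' dt01 r_gt0
  Cg0 K0 w0 start growf osc (TN i) N4 i0i vB fv) _.
rewrite lee_fin -/A.
have sb : 0 < scale_cost psi (b i).
  by apply: lt_le_trans (hcg _ b1); rewrite mulr_gt0 ?powR_gt0// (lt_le_trans ltr01).
have costi : \sum_(j < N i) psi (2 * v j) <= C3 * scale_cost psi (b i).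
  apply: le_trans (cost _ (leqnn _)) _.
  pose D := C1 * (C2 * scale_cost psi (b i)).
  have D0 : 0 < D by rewrite mulr_gt0// mulr_gt0.
  apply: (@le_trans _ _ (\sum_(l <- rcons L1 i) D * rho ^+ (i - l))).
    rewrite !big_seq; apply: ler_sum => l lL.
    have [gl ml] := memL l lL; have li := leL l lL.
    have l0l : (l0 <= l)%N := leq_trans (leq_addr _ _) ml.
    have [/andP[Tl4 Tl5] /andP[pl0 pl1] bl1 _ _] := hT l l0l.
    have pli : p l <= 4 * (3 / 2) ^+ (i - l) * p i.
      apply: (@goodP _ _ (l0 + m)) => //; last by rewrite ml.
      by move=> k mk; have [_ /andP[]] := hT k (leq_trans (leq_addr _ _) mk).
    set k := (i - l)%N in pli *.
    have t0 : 0 < (3 / 4 : R) ^+ k by rewrite exprn_gt0.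
    have t1 : (3 / 4 : R) ^+ k <= 1 by have [? ?] := threequarters; exact: exprn_ile1.
    (* From [l] to [i = l + k], [sqrt T] gains a factor at least [2^(k - 1)], while goodness lets
       [p] lose at most [4 (3/2)^k]. Since 3/2 < 2, the widths of the failed barriers are bounded by
       a geometric sequence. *)
    have bli : b l <= 8 * (3 / 4) ^+ k * b i.
      have e2 : (3 / 4 : R) ^+ k * 2 ^+ i = (3 / 2) ^+ k * 2 ^+ l.
        have <- : (k + l = i)%N by rewrite subnK.
        by rewrite exprD mulrA -exprMn; congr (_ ^+ _ * _); field.
      have sTl : Num.sqrt (T l) <= 2 ^+ l.+1.
        rewrite -[leRHS](ger0_norm (exprn_ge0 _ _))// -sqrtr_sqr.
        apply: ler_wsqrtr; apply: le_trans Tl5 _.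
        by rewrite -exprM mulnC exprM (_ : 2 ^+ 2 = 4)//; ring.
      have sTi : 2 ^+ i <= Num.sqrt (T i).
        rewrite -[leLHS](ger0_norm (exprn_ge0 _ _))// -sqrtr_sqr.
        apply: ler_wsqrtr; apply: le_trans T4.
        by rewrite -exprM mulnC exprM (_ : 2 ^+ 2 = 4)//; ring.
      apply: (@le_trans _ _ (2 ^+ l.+1 * (4 * (3 / 2) ^+ k * p i))).
        by apply: ler_pM => //; exact: ltW.
      apply: (@le_trans _ _ (8 * (3 / 4) ^+ k * (2 ^+ i * p i))).
        rewrite -[leRHS]mulrA (mulrA _ (2 ^+ i)) e2 exprS.
        by rewrite le_eqVlt; apply/orP; left; apply/eqP; ring.
      apply: ler_wpM2l; first by rewrite mulr_ge0// ltW.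
      by apply: ler_wpM2r => //; exact: ltW.
    have := hC2 (b l) (b i) _ bl1 b1 _ bli; rewrite t0 t1 => /(_ isT) h.
    apply: le_trans (ler_wpM2l (ltW C10) h) _.
    rewrite exprn_powR; last by have [] := threequarters.
    by rewrite le_eqVlt /D; apply/orP; left; apply/eqP; ring.
  rewrite -mulr_sumr; apply: (@le_trans _ _ (D * (1 - rho)^-1)).
    rewrite ler_pM2l//; apply: le_trans (sum_geometric_rev i rho01).
    by apply: sum_uniq_le => // l; rewrite exprn_ge0.
  by rewrite le_eqVlt /D /C3; apply/orP; left; apply/eqP; ring.
have normi : 2 * C3 * scale_cost psi (b i) <= e * normalization psi g (T i).
  have n0 : 0 <= normalization psi g (T i).
    have d16 : 0 < 16 * dl `^ (2 - kappa) by rewrite mulr_gt0// powR_gt0.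
    by rewrite -(pmulr_rge0 _ d16); apply: le_trans scost; exact: ltW.
  apply: (@le_trans _ _ (2 * C3 * (16 * (e / (32 * C3)) * normalization psi g (T i)))).
    rewrite ler_pM2l; last by rewrite mulr_gt0.
    apply: le_trans scost _; rewrite ler_wpM2r//.
    by rewrite ler_pM2l.
  by rewrite le_eqVlt; apply/orP; left; apply/eqP; field; rewrite gt_eqF.
have early : dt * psi (A / dt) + (i ^ 2 + i)%:R * psi 16 <= C3 * scale_cost psi (b i).
  apply: (@le_trans _ _ (dt * psi (A / dt) + 2 * psi 16 * i%:R ^+ 2)).
    rewrite lerD2l mulrAC ler_wpM2r// -natrX -natrM ler_nat.
    exact: sq_bound.
  apply: le_trans (hi1 i i1i) _; rewrite -mulrA ler_pM2l//.
  apply: le_trans (hcg _ b1); rewrite ler_pM2l//.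
  have -> : sg ^+ i = (2 ^+ i) `^ ((2 - kp) / 2) by exact: exprn_powR.
  have -> : b i `^ (2 - kp) = (b i ^+ 2) `^ ((2 - kp) / 2).
    rewrite -(powR_mulrn 2); last exact: le_trans ler01 b1.
    by rewrite -powRrM; congr powR; field.
  apply: ge0_ler_powR => //; rewrite ?nnegrE ?sqr_ge0 ?exprn_ge0//.
  by rewrite divr_ge0// subr_ge0 ltW.
apply: le_trans normi.
have -> : 2 * C3 * scale_cost psi (b i) =
    C3 * scale_cost psi (b i) + C3 * scale_cost psi (b i) by ring.
exact: lerD.
Qed.

End conclusion.

Theorem theorem3 (R : realType)
  (d : measure_display) (Om : measurableType d) (P : probability Om R)
  (W : R -> {RV P >-> R}) (hW : wiener_process W)
  (psi theta c eps g : R -> R) (kappa alpha xi_lower xi_upper : R)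
  (psi_ge0 : forall u, 0 <= psi u)
  (psi_convex : convex_function [set: R^o] psi)
  (kappa_range : 1 <= kappa < 2)
  (psi_pos : forall u, 0 < u -> psi u = u `^ kappa * theta u)
  (theta_sv : slowly_varying_at0 theta)
  (theta_karamata : karamata_representation theta c eps)
  (alpha_range : 0 < alpha < 1)
  (eps_small : \forall v \near 0^'+, `|eps v| < (`|ln v| `^ alpha)^-1)
  (g_sv : slowly_varying_at_infty g)
  (xi_lower_range : 2 - kappa < xi_lower)
  (xi_upper_range : 0 < xi_upper < 2 - kappa)
  (g_lower : (fun b : R => (ln b) `^ (- xi_lower)) =O_ (pinfty_filter R) g)
  (g_upper : g =O_ (pinfty_filter R) (fun b : R => (ln b) `^ (- xi_upper)))
  (g_diverges : \forall A \near +oo_R,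
    (\int[lebesgue_measure]_(b in `[A, +oo[)
       (g b `^ (2 - kappa)^-1 / b)%:E = +oo)%E)
  (r : R) (r_gt0 : 0 < r) :
  {ae P, forall w,
    limf_einf
      (fun T : R =>
         min_energy psi (fun t : R => W t w) T r *
         ((T * psi (T `^ (- 2^-1)) * g T)^-1)%:E)%E
      +oo_R = 0%E}.
Proof.
have /andP[k1 k2] := kappa_range; have /andP[xu0 xu1] := xi_upper_range.
have xl0 : 0 < xi_lower by lra.
have psi_pos0 := psi_gt0 psi_ge0 psi_convex kappa_range psi_pos theta_sv.
have [A [M [c0 [A1 _ _ _ hg]]]] := slow_bounds g_sv xu0 g_lower g_upper.
have norm_gt0 T : A <= T -> 0 < normalization psi g T.
  move=> AT; have T0 : 0 < T by lra.
  have [_ gT _ _] := hg T AT.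
  by rewrite !mulr_gt0// psi_pos0// powR_gt0.
(* Tolerances of the form [1 / (n + 1)] keep the number of exceptional null sets countable. *)
have nV n : 0 < n.+1%:R^-1 :> R by rewrite invr_gt0.
have often n := small_energy_often hW psi_ge0 psi_convex kappa_range psi_pos
  theta_sv theta_karamata alpha_range eps_small g_sv xl0 xu0 g_lower g_upper
  g_diverges r_gt0 (nV n).
apply: filterS (ae_foralln often) => w hw.
rewrite limf_einfE; apply/eqP; rewrite eq_le; apply/andP; split.
- apply: ge_ereal_sup => _ [V [a [_ ha]] <-].
  apply/lee_addgt0Pr => e e0; rewrite add0e.
  have [n hn] := ltr_add_invr e0; rewrite add0r in hn.
  have [T] := hw n (Num.max a A); rewrite gt_max => /andP[aT AT] hT.
  have nT := norm_gt0 T (ltW AT).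
  apply: (@le_trans _ _ (min_energy psi (fun t => W t w) T r *
      ((normalization psi g T)^-1)%:E)%E).
    by apply: ereal_inf_lbound; exists T => //; exact: ha.
  apply: (@le_trans _ _ ((n.+1%:R^-1 * normalization psi g T)%:E *
      ((normalization psi g T)^-1)%:E)%E).
    by apply: lee_wpmul2r => //; rewrite lee_fin invr_ge0 ltW.
  by rewrite -EFinM mulfK ?gt_eqF// lee_fin ltW.
(* Conversely the ratio is nonnegative where the normalization is positive, which is ensured beyond
   [A]; one such neighbourhood of infinity bounds the lower limit from below. *)
- apply: (@le_trans _ _ (ereal_inf ((fun T : R =>
      min_energy psi (fun t : R => W t w) T r *
      ((T * psi (T `^ (- 2^-1)) * g T)^-1)%:E)%E @` `]A, +oo[%classic))).
    apply: le_ereal_inf_tmp => y [T /=]; rewrite in_itv/= andbT => AT <-.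
    apply: mule_ge0; last by rewrite lee_fin invr_ge0 ltW// norm_gt0// ltW.
    apply: le_ereal_inf_tmp => _ [h _ <-]; apply: integral_ge0 => t _.
    by rewrite lee_fin.
  apply: ereal_sup_ubound; exists `]A, +oo[%classic => //.
  by exists A; split; [exact: num_real|move=> x Ax; rewrite /= in_itv/= Ax].
Qed.
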